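(* Let $m\ge1$ and $\mu\in\mathfrak h^*$. Put $z=\pm\frac12$. The bimodule $\mathcal F_m(M_\mu)_{\mathfrak n}$ over $\mathfrak h$ and $\mathrm X(\mathfrak g_n)$ is equivalent to the tensor product $$P_{\mu_m+z}\otimes P_{\mu_{m-1}+z+1}\otimes\cdots\otimes P_{\mu_1+z+m-1}$$ pulled back through the automorphism $S_{ij}(u)\mapsto f(u)S_{ij}(u)$ of $\mathrm X(\mathfrak g_n)$, where $$f(u)=\prod_{a=1}^m\Big(1-\frac1{u+z+m-a+1+\mu_a}\Big).$$ The element $F_{m-a+1,m-a+1}\in\mathfrak h$ (for $a=1,\dots,m$) acts on this tensor product as the operator $\frac n2+\deg_a-\mu_a$.
   Context: Conventions. $n\ge1$ is an integer; $G_n$ is one of the complex groups $O_n$, $Sp_n$ ($n$ even if $G_n=Sp_n$). In all double signs the upper sign is for $G_n=O_n$, the lower for $G_n=Sp_n$. For $1\le i\le n$: $\tilde\imath=i-1$ if $i$ is even; $\tilde\imath=i+1$ if $i$ is odd, $i<n$; $\tilde\imath=n$ if $i=n$ is odd. $\theta_i=1$ for $O_n$, $\theta_i=(-1)^{i-1}$ for $Sp_n$. $G_n$ preserves the form $\langle e_i,e_j\rangle=\theta_i\delta_{\tilde\imath j}$ on $\mathbb C^n$; $\mathfrak g_n$ is its Lie algebra. Yangians. $\mathrm Y(\mathfrak{gl}_n)$ has generators $T_{ij}^{(r)}$ ($r\ge1$, $1\le i,j\le n$), $T_{ij}(u)=\delta_{ij}+\sum_{r\ge1}T_{ij}^{(r)}u^{-r}$,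 and relations $(u-v)[T_{ij}(u),T_{kl}(v)]=T_{kj}(u)T_{il}(v)-T_{kj}(v)T_{il}(u)$; comultiplication $T_{ij}(u)\mapsto\sum_kT_{ik}(u)\otimes T_{kj}(u)$, used to form tensor products of modules. $\mathrm X(\mathfrak g_n)$ is the unital associative algebra with generators $S_{ij}^{(r)}$, $S_{ij}(u)=\delta_{ij}+\sum_{r\ge1}S_{ij}^{(r)}u^{-r}$, $S(u)=(S_{ij}(u))$, and relations $R(u-v)S_1(u)R'(-u-v)S_2(v)=S_2(v)R'(-u-v)S_1(u)R(u-v)$, where $R(u)=u-\sum E_{ij}\otimes E_{ji}$, $R'(u)=u-\sum\theta_i\theta_jE_{ij}\otimes E_{\tilde\imath\tilde\jmath}$, $S_1(u)=S(u)\otimes1$, $S_2(v)=1\otimes S(v)$. Any $\mathrm Y(\mathfrak{gl}_n)$-module is regarded as an $\mathrm X(\mathfrak g_n)$-module via the homomorphism $\mathrm X(\mathfrak g_n)\to\mathrm Y(\mathfrak{gl}_n)$, $S_{ij}(u)\mapsto\sum_k\theta_i\theta_kT_{\tilde k\tilde\imath}(-u)T_{kj}(u)$. $P_z$ ($z\in\mathbb C$) is the $\mathrm Y(\mathfrak{gl}_n)$-module on $\mathcal P(\mathbb C^n)=\mathbb C[x_1,\dots,x_n]$ given by $T_{ij}(u)\mapsto\delta_{ij}+\dfrac{x_i\partial_j}{u-z}$. In a tensor product $P_{z_m}\otimes\cdots\otimes P_{z_1}$, $\deg_a$ is the operator of polynomial degree in the factor $P_{z_a}$ (the $a$-th factor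 counting from right to left). $\mathfrak f_m=\mathfrak{sp}_{2m}$ if $G_n=O_n$, $\mathfrak{so}_{2m}$ if $G_n=Sp_n$, realized in $\mathfrak{gl}_{2m}$ (indices $-m,\dots,-1,1,\dots,m$) as the span of $F_{ab}=E_{ab}-\varepsilon_{ab}E_{-b,-a}$, with $\varepsilon_{ab}=\operatorname{sign}a\cdot\operatorname{sign}b$ for $\mathfrak{sp}_{2m}$, $\varepsilon_{ab}=1$ for $\mathfrak{so}_{2m}$. $F_{ab}(u)$ is the $a,b$ entry of $(u-F)^{-1}$, $F=(F_{ab})$. $\mathfrak h$ is the Cartan subalgebra with basis $F_{-m,-m},\dots,F_{-1,-1}$; $\mathfrak n$ (resp. $\mathfrak n'$) is spanned by $F_{ab}$ with $a>b$ (resp. $a<b$). A weight $\mu\in\mathfrak h^*$ has labels $\mu_a=\mu(F_{a-m-1,a-m-1})=-\mu(F_{m-a+1,m-a+1})$, $a=1,\dots,m$. The Verma module $M_\mu$ is the quotient of $\mathrm U(\mathfrak f_m)$ by the left ideal generated by all $X\in\mathfrak n'$ and all $X-\mu(X)$, $X\in\mathfrak h$. The functor $\mathcal F_m$. $\mathcal P(\mathbb C^m\otimes\mathbb C^n)$ is the polynomial ring in $x_{ai}$ ($1\le a\le m$, $1\le i\le n$), $\partial_{ai}=\partial/\partial x_{ai}$. $\zeta_n:\mathrm U(\mathfrak f_m)\to\mathcal{PD}(\mathbb C^m\otimes\mathbb C^n)$ (polynomial differential operators) is, for $a,b=1,\dots,m$: $F_{ab}\mapsto\delta_{ab}\frac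 n2+\sum_kx_{ak}\partial_{bk}$, $F_{a,-b}\mapsto-\sum_k\theta_kx_{a\tilde k}x_{bk}$, $F_{-a,b}\mapsto\sum_k\theta_k\partial_{ak}\partial_{b\tilde k}$. For $c<0$ put $p_{ci}=x_{-c,i}$, $q_{ci}=\partial_{-c,i}$; for $c>0$ put $p_{ci}=-\theta_i\partial_{c\tilde\imath}$, $q_{ci}=\theta_ix_{c\tilde\imath}$. The homomorphism $\beta_m:\mathrm X(\mathfrak g_n)\to\mathrm U(\mathfrak f_m)\otimes\mathcal{PD}(\mathbb C^m\otimes\mathbb C^n)$ is $S_{ij}(u)\mapsto\delta_{ij}+\sum_{|c|,|d|=1}^mF_{cd}(u\pm\frac12+m)\otimes p_{ci}q_{dj}$. For an $\mathfrak f_m$-module $V$, $\mathcal F_m(V)=V\otimes\mathcal P(\mathbb C^m\otimes\mathbb C^n)$ is a bimodule over $\mathfrak f_m$ ($X$ acting as $X\otimes1+1\otimes\zeta_n(X)$) and $\mathrm X(\mathfrak g_n)$ (acting via $\beta_m$); the actions commute. $\mathcal F_m(V)_{\mathfrak n}=\mathcal F_m(V)/\mathfrak n\mathcal F_m(V)$ is the space of $\mathfrak n$-coinvariants, a bimodule over $\mathfrak h$ and $\mathrm X(\mathfrak g_n)$. *)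

(* Defs.v *)
From HB Require Import structures.
From mathcomp Require Import all_boot all_order all_algebra.
From mathcomp Require Import finmap.
From mathcomp Require Import boolp reals complex.
From mathcomp Require Import mpoly monalg.
Import mpoly.

Set Implicit Arguments.
Unset Strict Implicit.
Unset Printing Implicit Defensive.

Import GRing.Theory.
Local Open Scope ring_scope.
Local Open Scope quotient_scope.

(* The operations on quotients are locked to keep unification tractable. *)
Fact quotient_key : unit. Proof. by []. Qed.

Section Quotient.
Variables (K : fieldType) (V : lmodType K).

Inductive lspan (N : V -> Prop) : V -> Prop :=
| lspan0 : lspan N 0
| lspanZD c x y : N x -> lspan N y -> lspan N (c *: x + y).

Variable N : V -> Prop.

Lemma lspan_in x : N x -> lspan N x.
Proof.
by move=> Nx; rewrite -[x]scale1r -[_ *: x]addr0; apply: lspanZD Nx (lspan0 _).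
Qed.

Lemma lspanD x y : lspan N x -> lspan N y -> lspan N (x + y).
Proof.
by move=> Nx Ny; elim: Nx => [|c u v Nu _ IH]; rewrite ?add0r // -addrA;
   apply: lspanZD.
Qed.

Lemma lspanZ c x : lspan N x -> lspan N (c *: x).
Proof.
elim=> [|d u v Nu _ IH]; first by rewrite scaler0; apply: lspan0.
by rewrite scalerDr scalerA; apply: lspanZD.
Qed.

Lemma lspanB x y : lspan N x -> lspan N y -> lspan N (x - y).
Proof. by move=> Nx Ny; rewrite -scaleN1r; apply/lspanD/lspanZ. Qed.

Definition qeqv (x y : V) := `[< lspan N (x - y) >].

Lemma qeqv_is_equiv : equiv_class_of qeqv.
Proof.
split=> [x|x y|y x z]; rewrite /qeqv.
- by apply/asboolP; rewrite subrr; apply: lspan0.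
- by apply/asboolP/asboolP => /(lspanZ (-1)); rewrite scaleN1r opprB.
- move=> /asboolP xy /asboolP yz; apply/asboolP.
  by rewrite -(subrKA y) addrC; apply: lspanD; rewrite // addrC.
Qed.

Canonical qeqv_equiv := EquivRelPack qeqv_is_equiv.

Definition quotient := {eq_quot qeqv}.
HB.instance Definition _ := Choice.on quotient.
HB.instance Definition _ := EqQuotient.on quotient.

Definition qproj (x : V) : quotient := \pi x.

Lemma qprojP x y : (qproj x = qproj y) <-> lspan N (x - y).
Proof. by split=> [/eqmodP /asboolP|H]//; apply/eqmodP/asboolP. Qed.

Lemma qproj_repr (q : quotient) : qproj (repr q) = q.
Proof. exact: reprK. Qed.

Lemma repr_qproj x : lspan N (repr (qproj x) - x).
Proof. by apply/qprojP; rewrite qproj_repr. Qed.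

Definition qzero := locked_with quotient_key (qproj 0).
Definition qadd := locked_with quotient_key
  (fun p q : quotient => qproj (repr p + repr q)).
Definition qscale := locked_with quotient_key
  (fun (c : K) (q : quotient) => qproj (c *: repr q)).
Definition qopp := locked_with quotient_key
  (fun q : quotient => qproj (- repr q)).

Lemma qproj_zero : qproj 0 = qzero.
Proof. by rewrite /qzero locked_withE. Qed.

Lemma qproj_add x y : qadd (qproj x) (qproj y) = qproj (x + y).
Proof.
by rewrite /qadd locked_withE; apply/qprojP; rewrite opprD addrACA; apply: lspanD; apply: repr_qproj.
Qed.

Lemma qproj_scale c x : qscale c (qproj x) = qproj (c *: x).
Proof.
by rewrite /qscale locked_withE; apply/qprojP; rewrite -scalerBr; apply/lspanZ/repr_qproj. Qed.

Lemma qproj_opp x : qopp (qproj x) = qproj (- x).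
Proof.
rewrite /qopp locked_withE; apply/qprojP; rewrite -opprD -[- (_ - _)]scaleN1r; apply: lspanZ; exact: repr_qproj.
Qed.

Lemma quot_ind (P : quotient -> Prop) : (forall x, P (qproj x)) -> forall q, P q.
Proof. by move=> HP q; rewrite -[q]qproj_repr. Qed.

Lemma qaddA : associative qadd.
Proof.
by elim/quot_ind=> x; elim/quot_ind=> y; elim/quot_ind=> z;
   rewrite !qproj_add addrA.
Qed.
Lemma qaddC : commutative qadd.
Proof.
by elim/quot_ind=> x; elim/quot_ind=> y; rewrite !qproj_add addrC.
Qed.
Lemma qadd0 : left_id qzero qadd.
Proof. by elim/quot_ind=> x; rewrite -qproj_zero qproj_add add0r. Qed.
Lemma qaddN : left_inverse qzero qopp qadd.
Proof. by elim/quot_ind=> x; rewrite qproj_opp qproj_add addNr qproj_zero. Qed.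

HB.instance Definition _ := GRing.isZmodule.Build quotient qaddA qaddC qadd0 qaddN.

Lemma qscaleA a b q : qscale a (qscale b q) = qscale (a * b) q.
Proof. by elim/quot_ind: q => x; rewrite !qproj_scale scalerA. Qed.
Lemma qscale1 : left_id 1 qscale.
Proof. by elim/quot_ind=> x; rewrite !qproj_scale scale1r. Qed.
Lemma qscaleDr : right_distributive qscale +%R.
Proof.
move=> c; elim/quot_ind=> x; elim/quot_ind=> y.
by rewrite [qproj x + _]qproj_add !qproj_scale [RHS]qproj_add scalerDr.
Qed.
Lemma qscaleDl q : {morph qscale^~ q : a b / a + b}.
Proof.
elim/quot_ind: q => x a b.
by rewrite !qproj_scale [RHS]qproj_add scalerDl.
Qed.

HB.instance Definition _ :=
  GRing.Zmodule_isLmodule.Build K quotient qscaleA qscale1 qscaleDr qscaleDl.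

Lemma qproj_is_linear : linear qproj.
Proof. by move=> c x y; rewrite -qproj_add -qproj_scale. Qed.
HB.instance Definition _ :=
  GRing.isLinear.Build K V quotient *:%R qproj qproj_is_linear.

Lemma qproj0P x : (qproj x = 0) <-> lspan N x.
Proof. by rewrite -[0]/qzero -qproj_zero qprojP subr0. Qed.

End Quotient.

Arguments quotient {K V} N.
Arguments qproj {K V} N x.

Lemma lspan_map (K : fieldType) (V W : lmodType K) (f : V -> W)
    (N : V -> Prop) (M : W -> Prop) :
  linear f -> (forall x, N x -> lspan M (f x)) ->
  forall x, lspan N x -> lspan M (f x).
Proof.
move=> fL H x; elim=> [|c u v Nu _ IH].
  have := fL (-1) 0 0; rewrite !scaleN1r addNr addNr => ->.
  exact: lspan0.
by rewrite fL; apply: lspanD => //; apply/lspanZ/H.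
Qed.

(* The map between quotients induced by a linear map f with
   f (lspan N) included in lspan M. *)
Definition qmap (K : fieldType) (V W : lmodType K) (N : V -> Prop)
    (M : W -> Prop) (f : V -> W) : quotient N -> quotient M :=
  fun q => qproj M (f (repr q)).
Arguments qmap {K V W} N M f q.

Lemma qmapE (K : fieldType) (V W : lmodType K) (N : V -> Prop)
    (M : W -> Prop) (f : V -> W) x :
  linear f -> (forall x, N x -> lspan M (f x)) ->
  qmap N M f (qproj N x) = qproj M (f x).
Proof.
move=> fL H; apply/qprojP.
rewrite addrC -scaleN1r -fL scaleN1r addrC.
exact: (lspan_map fL H (repr_qproj _ _)).
Qed.

Lemma qmap_is_linear (K : fieldType) (V W : lmodType K) (N : V -> Prop)
    (M : W -> Prop) (f : V -> W) :
  linear f -> (forall x, N x -> lspan M (f x)) -> linear (qmap N M f).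
Proof.
move=> fL H c; elim/quot_ind=> x; elim/quot_ind=> y.
by rewrite -(qproj_is_linear N) !qmapE // fL qproj_is_linear.
Qed.

Section QuotientRing.
Variables (K : fieldType) (A : lalgType K) (R : A -> Prop).

(* lspan (tideal R) is the two-sided ideal generated by R. *)
Definition tideal (x : A) : Prop := exists a r b, R r /\ x = a * r * b.

Lemma tidealMl a x : lspan tideal x -> lspan tideal (a * x).
Proof.
elim=> [|c u v [a' [r [b [Rr ->]]]] _ IH]; first by rewrite mulr0; apply: lspan0.
rewrite mulrDr; apply: lspanD => //; apply: lspan_in.
exists (a * (c *: a')), r, b; split=> //.
by rewrite !scalerAl !mulrA.
Qed.

Lemma tidealMr a x : lspan tideal x -> lspan tideal (x * a).
Proof.
elim=> [|c u v [a' [r [b [Rr ->]]]] _ IH]; first by rewrite mul0r; apply: lspan0.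
rewrite mulrDl -scalerAl; apply: lspanZD => //.
by exists a', r, (b * a); split=> //; rewrite mulrA.
Qed.

Definition quotient_ring := quotient tideal.
HB.instance Definition _ := GRing.Lmodule.on quotient_ring.

Definition qone : quotient_ring :=
  locked_with quotient_key (qproj tideal 1).
Definition qmul := locked_with quotient_key
  (fun p q : quotient_ring => qproj tideal (repr p * repr q) : quotient_ring).

Lemma qproj_one : qproj tideal 1 = qone.
Proof. by rewrite /qone locked_withE. Qed.

Lemma qproj_mul x y : qmul (qproj tideal x) (qproj tideal y) = qproj tideal (x * y).
Proof.
rewrite /qmul locked_withE; apply/qprojP.
set x' := repr _; set y' := repr _.
have -> : x' * y' - x * y = (x' - x) * y' + x * (y' - y).
  by rewrite mulrBl mulrBr addrA subrK.
by apply: lspanD; [apply: tidealMr|apply: tidealMl]; apply: repr_qproj.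
Qed.

Lemma qproj_addE x y :
  qproj tideal x + qproj tideal y = qproj tideal (x + y) :> quotient_ring.
Proof. exact: qproj_add. Qed.

Lemma qmulA : associative qmul.
Proof.
by elim/quot_ind=> x; elim/quot_ind=> y; elim/quot_ind=> z;
   rewrite !qproj_mul mulrA.
Qed.
Lemma qmul1l : left_id qone qmul.
Proof. by elim/quot_ind=> x; rewrite -qproj_one qproj_mul mul1r. Qed.
Lemma qmul1r : right_id qone qmul.
Proof. by elim/quot_ind=> x; rewrite -qproj_one qproj_mul mulr1. Qed.
Lemma qmulDl : left_distributive qmul +%R.
Proof.
elim/quot_ind=> x; elim/quot_ind=> y; elim/quot_ind=> z.
by rewrite qproj_addE !qproj_mul !qproj_addE mulrDl.
Qed.
Lemma qmulDr : right_distributive qmul +%R.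
Proof.
elim/quot_ind=> x; elim/quot_ind=> y; elim/quot_ind=> z.
by rewrite qproj_addE !qproj_mul !qproj_addE mulrDr.
Qed.

HB.instance Definition _ :=
  GRing.Zmodule_isPzRing.Build quotient_ring qmulA qmul1l qmul1r qmulDl qmulDr.

Definition qring_proj (x : A) : quotient_ring := qproj tideal x.

Lemma qring_projM x y : qring_proj (x * y) = qring_proj x * qring_proj y.
Proof. by rewrite -[RHS]/(qmul _ _) qproj_mul. Qed.

Lemma qring_projZ c x : qring_proj (c *: x) = c *: qring_proj x.
Proof. by rewrite -[RHS]/(qscale c _) qproj_scale. Qed.

Lemma qring_projD x y : qring_proj (x + y) = qring_proj x + qring_proj y.
Proof. by rewrite -[LHS]qproj_addE. Qed.

Lemma qring_scalerAl (c : K) (x y : quotient_ring) : c *: (x * y) = (c *: x) * y.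
Proof.
elim/quot_ind: x => x; elim/quot_ind: y => y.
rewrite -[qproj tideal x]/(qring_proj x) -[qproj tideal y]/(qring_proj y).
by rewrite -qring_projM -!qring_projZ scalerAl qring_projM.
Qed.

End QuotientRing.

Arguments quotient_ring {K A} R.
Arguments qring_proj {K A} R x.

Section Tensor.
Variables (K : fieldType).

Lemma malgUZ (T : choiceType) (c a : K) (k : T) :
  << c * a *g k >> = c *: << a *g k >>.
Proof.
by apply/malgP => l; rewrite monalg.mcoeffZ !monalg.mcoeffU mulrnAr.
Qed.

Inductive bilinear_rel (V W : lmodType K) : {malg K[(V * W)%type]} -> Prop :=
| bilinear_rel_l c v v' w :
    bilinear_rel (<<(c *: v + v', w)>> - c *: <<(v, w)>> - <<(v', w)>>)
| bilinear_rel_r c v w w' :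
    bilinear_rel (<<(v, c *: w + w')>> - c *: <<(v, w)>> - <<(v, w')>>).

Definition tensor (V W : lmodType K) := quotient (@bilinear_rel V W).
HB.instance Definition _ V W := GRing.Lmodule.on (tensor V W).

Definition tens (V W : lmodType K) (v : V) (w : W) : tensor V W :=
  qproj (@bilinear_rel V W) <<(v, w)>>.

Section Map.
Variables (V W V' W' : lmodType K) (f : V -> V') (g : W -> W').

Definition free_map (x : {malg K[(V * W)%type]}) : {malg K[(V' * W')%type]} :=
  \sum_(p <- monalg.msupp x) << monalg.mcoeff p x *g (f p.1, g p.2) >>.

Definition tmap : tensor V W -> tensor V' W' :=
  qmap (@bilinear_rel V W) (@bilinear_rel V' W') free_map.

Lemma free_mapEw (D : {fset V * W}) x : (monalg.msupp x `<=` D)%fset ->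
  free_map x = \sum_(p <- D) << monalg.mcoeff p x *g (f p.1, g p.2) >>.
Proof.
move=> sD; rewrite /free_map (big_fset_incl _ sD) // => p _ /mcoeff_outdom ->.
exact: monalgU0.
Qed.

Lemma free_map_is_linear : linear free_map.
Proof.
move=> c x y.
pose D := (monalg.msupp x `|` monalg.msupp y `|` monalg.msupp (c *: x + y))%fset.
rewrite (@free_mapEw D) ?fsubsetUr // (@free_mapEw D x); last first.
  by rewrite /D -fsetUA fsubsetUl.
rewrite (@free_mapEw D y); last by rewrite /D fsetUAC fsubsetUr.
rewrite scaler_sumr -big_split /=; apply: eq_bigr => p _.
by rewrite monalg.mcoeffD monalg.mcoeffZ monalgUD malgUZ.
Qed.

Lemma free_mapU v w : free_map <<(v, w)>> = <<(f v, g w)>>.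
Proof.
rewrite (@free_mapEw [fset (v, w)]%fset) ?msuppU_le //.
by rewrite big_seq_fset1 monalg.mcoeffUU.
Qed.

Hypotheses (fL : linear f) (gL : linear g).

Lemma free_map_rel x : bilinear_rel x -> lspan (@bilinear_rel V' W') (free_map x).
Proof.
have fB a b : free_map (a - b) = free_map a - free_map b.
  by rewrite addrC -scaleN1r free_map_is_linear scaleN1r addrC.
have fZ c a : free_map (c *: a) = c *: free_map a.
  by rewrite -[c *: a]addr0 free_map_is_linear /free_map monalg.msupp0 big_seq_fset0 addr0.
case=> [c v v' w|c v w w']; rewrite 2!fB fZ 3!free_mapU.
  by rewrite fL; apply/lspan_in/bilinear_rel_l.
by rewrite gL; apply/lspan_in/bilinear_rel_r.
Qed.

Lemma tmap_tens v w : tmap (tens v w) = tens (f v) (g w).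
Proof.
by rewrite /tmap /tens qmapE ?free_mapU //;
   [apply: free_map_is_linear|apply: free_map_rel].
Qed.

Lemma tmap_is_linear : linear tmap.
Proof. exact: qmap_is_linear free_map_is_linear free_map_rel. Qed.

End Map.

Section Theory.
Variables V W : lmodType K.

Lemma tensDZl c v v' (w : W) : tens (c *: v + v') w = c *: tens v w + tens v' w :> tensor V W.
Proof.
rewrite /tens -[RHS]linearP; apply/qprojP/lspan_in.
by rewrite opprD addrA; apply: bilinear_rel_l.
Qed.

Lemma tensDZr c (v : V) w w' : tens v (c *: w + w') = c *: tens v w + tens v w' :> tensor V W.
Proof.
rewrite /tens -[RHS]linearP; apply/qprojP/lspan_in.
by rewrite opprD addrA; apply: bilinear_rel_r.
Qed.

Lemma eq_tensor (U : lmodType K) (f g : tensor V W -> U) :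
  linear f -> linear g -> (forall v w, f (tens v w) = g (tens v w)) -> f =1 g.
Proof.
move=> fL gL fg; elim/quot_ind=> x.
have l0 (h : tensor V W -> U) : linear h -> h 0 = 0.
  by move=> hL; have := hL (-1) 0 0; rewrite !scaleN1r !addNr.
have -> : x = \sum_(p <- monalg.msupp x) monalg.mcoeff p x *: <<(p.1, p.2)>>.
  rewrite {1}[x]monalgE; apply: eq_bigr => -[v w] _ /=.
  by rewrite -malgUZ mulr1.
elim: (enum_fset _) => [|p s IH].
  by rewrite big_nil (@raddf0 _ _ (qproj (@bilinear_rel V W))) !l0.
by rewrite big_cons qproj_is_linear fL gL IH -/(tens _ _) fg.
Qed.

End Theory.
End Tensor.

Section Enveloping.
Variables (K : fieldType) (N : nat) (L : {vspace 'M[K]_N}).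

Definition lie_free := {malg K[{fmonom (subvs_of L)}]}.
Definition lie_var (X : subvs_of L) : lie_free := << fmu X >>.

Inductive env_rel : lie_free -> Prop :=
| env_rel_linear c X Y :
    env_rel (lie_var (c *: X + Y) - c *: lie_var X - lie_var Y)
| env_rel_bracket X Y Z :
    vsval Z = vsval X *m vsval Y - vsval Y *m vsval X ->
    env_rel (lie_var X * lie_var Y - lie_var Y * lie_var X - lie_var Z).

(* The universal enveloping algebra of L, when L is closed under commutators. *)
Definition env := quotient_ring env_rel.
HB.instance Definition _ := GRing.Lmodule.on env.
HB.instance Definition _ := GRing.PzRing.on env.

Definition env_gen (X : subvs_of L) : env := qring_proj env_rel (lie_var X).

Lemma env_scalerAr (c : K) (x y : env) : c *: (x * y) = x * (c *: y).
Proof.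
elim/quot_ind: x => x; elim/quot_ind: y => y.
rewrite -[qproj _ x]/(qring_proj env_rel x) -[qproj _ y]/(qring_proj env_rel y).
rewrite -qring_projM -!qring_projZ -qring_projM; congr qring_proj.
rewrite [RHS](malgMEw (fsubset_refl _) (monalg.msuppZ_le c y)) malgME scaler_sumr.
apply: eq_bigr => k _; rewrite scaler_sumr; apply: eq_bigr => l _.
by rewrite -malgUZ monalg.mcoeffZ mulrCA.
Qed.

Lemma env_mulr_is_linear (u : env) : linear ( *%R u).
Proof. by move=> c x y; rewrite mulrDr env_scalerAr. Qed.

Lemma env_gen_linear c X Y : env_gen (c *: X + Y) = c *: env_gen X + env_gen Y.
Proof.
rewrite /env_gen -qring_projZ -qring_projD; apply/qprojP/lspan_in.
exists 1, (lie_var (c *: X + Y) - c *: lie_var X - lie_var Y), 1.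
by split; [apply: env_rel_linear|rewrite mul1r mulr1 opprD addrA].
Qed.

Lemma env_gen_bracket X Y Z :
  vsval Z = vsval X *m vsval Y - vsval Y *m vsval X ->
  env_gen X * env_gen Y - env_gen Y * env_gen X = env_gen Z.
Proof.
move=> ZE; rewrite /env_gen -!qring_projM -scaleN1r -qring_projZ -qring_projD.
apply/qprojP/lspan_in; rewrite scaleN1r.
exists 1, (lie_var X * lie_var Y - lie_var Y * lie_var X - lie_var Z), 1.
by split; [apply: env_rel_bracket|rewrite mul1r mulr1].
Qed.

Record env_module := EnvModule {
  env_space :> lmodType K;
  env_act : env -> env_space -> env_space;
  env_act_linear : forall u, linear (env_act u);
  env_act_linearl : forall v, linear (env_act^~ v);
  env_act1 : forall v, env_act 1 v = v;
  env_actM : forall u u' v, env_act (u * u') v = env_act u (env_act u' v)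
}.

Section LeftQuotient.
Variable J : env -> Prop.

(* lspan left_multiples is the left ideal generated by J. *)
Definition left_multiples (x : env) : Prop := exists u y, J y /\ x = u * y.

Lemma left_multiplesM u x : left_multiples x -> lspan left_multiples (u * x).
Proof.
by case=> [u' [y [Jy ->]]]; apply: lspan_in; exists (u * u'), y; rewrite mulrA.
Qed.

Definition lq_act (u : env) :=
  qmap left_multiples left_multiples ( *%R u).

Lemma lq_actE u x : lq_act u (qproj _ x) = qproj _ (u * x).
Proof.
by apply: qmapE; [apply: env_mulr_is_linear|apply: left_multiplesM].
Qed.

Lemma lq_act_linear u : linear (lq_act u).
Proof. exact: qmap_is_linear (@env_mulr_is_linear u) (@left_multiplesM u). Qed.

Lemma lq_act_linearl v : linear (lq_act^~ v).
Proof.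
elim/quot_ind: v => x c u u'.
by rewrite !lq_actE mulrDl -qring_scalerAl qproj_is_linear.
Qed.

Lemma lq_act1 v : lq_act 1 v = v.
Proof. by elim/quot_ind: v => x; rewrite lq_actE mul1r. Qed.

Lemma lq_actM u u' v : lq_act (u * u') v = lq_act u (lq_act u' v).
Proof. by elim/quot_ind: v => x; rewrite !lq_actE mulrA. Qed.

Definition left_quotient : env_module :=
  EnvModule lq_act_linear lq_act_linearl lq_act1 lq_actM.

End LeftQuotient.
End Enveloping.

Variant classical_group := Orthogonal | Symplectic.

Section ClassicalGroup.
Variables (K : fieldType) (G : classical_group).

(* The sign read off from the double signs: upper for O_n, lower for Sp_n. *)
Definition pm : K := if G is Orthogonal then 1 else -1.

(* Indices are counted from 0, so the parities below are opposite to those of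
   indices counted from 1; insubd returns i when the image is not below n. *)
Definition theta (n : nat) (i : 'I_n) : K :=
  if G is Orthogonal then 1 else (-1) ^+ i.

Definition tilde (n : nat) (i : 'I_n) : 'I_n :=
  insubd i (if odd i then i.-1 else i.+1).

Variable m : nat.

(* The index set -m, ..., -1, 1, ..., m is 'I_(m + m) in increasing order, so
   c |-> -c is rev_ord; lshift m a stands for a - m and rshift m a for a + 1. *)
Definition isgn (a : 'I_(m + m)) : K := if (a < m)%N then -1 else 1.

Definition eps (a b : 'I_(m + m)) : K :=
  if G is Orthogonal then isgn a * isgn b else 1.

Definition Fmx (a b : 'I_(m + m)) : 'M[K]_(m + m) :=
  delta_mx a b - eps a b *: delta_mx (rev_ord b) (rev_ord a).

(* sp_(2m) for O_n and so_(2m) for Sp_n *)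
Definition fm : {vspace 'M[K]_(m + m)} :=
  <<[seq Fmx p.1 p.2 | p : 'I_(m + m) * 'I_(m + m)]>>%VS.

Definition cartan : {vspace 'M[K]_(m + m)} :=
  <<[seq Fmx (lshift m a) (lshift m a) | a : 'I_m]>>%VS.

Definition nprime : {vspace 'M[K]_(m + m)} :=
  <<[seq Fmx p.1 p.2 |
      p in [pred p : 'I_(m + m) * 'I_(m + m) | (p.1 < p.2)%N]]>>%VS.

Definition Fel (a b : 'I_(m + m)) : subvs_of fm := vsproj fm (Fmx a b).
Definition FU (a b : 'I_(m + m)) : env fm := env_gen (Fel a b).

Definition weight := {linear subvs_of cartan -> K^o}.

Definition wlabel (mu : weight) (a : 'I_m) : K :=
  mu (vsproj cartan (Fmx (lshift m a) (lshift m a))).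

Inductive verma_rel (mu : weight) : env fm -> Prop :=
| verma_nprime (X : subvs_of fm) :
    vsval X \in nprime -> verma_rel mu (env_gen X)
| verma_cartan (X : subvs_of fm) (H : subvs_of cartan) :
    vsval X = vsval H -> verma_rel mu (env_gen X - (mu H : K) *: (1 : env fm)).

Definition verma (mu : weight) : env_module fm := left_quotient (verma_rel mu).

(* The coefficient at u^(-r) of the formal power series (u - A)^(-1). *)
Definition resolvent (k : nat) (A : 'M[env fm]_k) (r : nat) : 'M[env fm]_k :=
  if r is r'.+1 then A ^+ r' else 0.

(* F(u + h) = (u - (F - h))^(-1) *)
Definition Fseries (h : K) (r : nat) : 'M[env fm]_(m + m) :=
  resolvent (\matrix_(a, b) FU a b - (h *: (1 : env fm))%:M) r.

Section Polynomials.
Variable n : nat.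

Definition polymn := mpoly (m * n) K.
Definition xop (a : 'I_m) (i : 'I_n) (f : polymn) : polymn :=
  'X_(mxvec_index a i) * f.
Definition dop (a : 'I_m) (i : 'I_n) (f : polymn) : polymn :=
  f^`M(mxvec_index a i).

(* split c is inl for c < 0 and inr for c > 0; on negative indices, rev_ord of
   the argument of inl is the absolute value. *)
Definition pop (c : 'I_(m + m)) (i : 'I_n) (f : polymn) : polymn :=
  match split c with
  | inl c' => xop (rev_ord c') i f
  | inr c' => - theta i *: dop c' (tilde i) f
  end.

Definition qop (c : 'I_(m + m)) (i : 'I_n) (f : polymn) : polymn :=
  match split c with
  | inl c' => dop (rev_ord c') i f
  | inr c' => theta i *: xop c' (tilde i) f
  end.

Definition zeta_pos (a b : 'I_m) (f : polymn) : polymn :=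
  ((a == b)%:R * n%:R / 2%:R) *: f + \sum_k xop a k (dop b k f).

(* The action of F_ab through zeta_n; F_{-a,-b} = - F_{ba} for a, b > 0. *)
Definition zeta (a b : 'I_(m + m)) (f : polymn) : polymn :=
  match split a, split b with
  | inr a', inr b' => zeta_pos a' b' f
  | inr a', inl b' => - \sum_k theta k *: xop a' (tilde k) (xop (rev_ord b') k f)
  | inl a', inr b' => \sum_k theta k *: dop (rev_ord a') k (dop b' (tilde k) f)
  | inl a', inl b' => - zeta_pos (rev_ord b') (rev_ord a') f
  end.

Section Functor.
Variable V : env_module fm.

Definition Fm := tensor V polymn.

Definition Fm_lie (a b : 'I_(m + m)) (t : Fm) : Fm :=
  tmap (env_act (FU a b)) idfun t + tmap idfun (zeta a b) t.

Definition Fm_S (r : nat) (i j : 'I_n) (t : Fm) : Fm :=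
  ((r == 0%N) && (i == j))%:R *: t
  + \sum_c \sum_d
      tmap (env_act (Fseries (pm / 2%:R + m%:R) r c d)) (pop c i \o qop d j) t.

(* n is spanned by the F_ab with a > b. *)
Inductive coinv_rel : Fm -> Prop :=
| coinv_rel_lie (a b : 'I_(m + m)) t : (b < a)%N -> coinv_rel (Fm_lie a b t).

End Functor.
End Polynomials.

(* A space with operators S_ij^(r), where S_ij^(0) = delta_ij by convention,
   and F_(a+1,a+1), for a in 'I_m. *)
Record bimodule (n : nat) := Bimodule {
  bispace :> lmodType K;
  Sop : nat -> 'I_n -> 'I_n -> bispace -> bispace;
  Hop : 'I_m -> bispace -> bispace
}.

Definition coinvariants (n : nat) (V : env_module fm) : bimodule n :=
  @Bimodule n (quotient (@coinv_rel n V))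
    (fun r i j => qmap (@coinv_rel n V) (@coinv_rel n V) (Fm_S r i j))
    (fun a => qmap (@coinv_rel n V) (@coinv_rel n V)
                   (Fm_lie (rshift m a) (rshift m a))).

End ClassicalGroup.

Section XModules.
Variables (K : fieldType) (G : classical_group) (n : nat).

(* Formal power series in u^(-1), as sequences of coefficients. *)
Definition series := nat -> K.
Definition series1 : series := fun r => (r == 0%N)%:R.
Definition series_mul (f g : series) : series :=
  fun r => \sum_(s < r.+1) f s * g (r - s)%N.
(* 1 / (u + c) *)
Definition series_inv (c : K) : series :=
  fun r => if r is r'.+1 then (- c) ^+ r' else 0.
(* 1 - 1 / (u + c) *)
Definition series_fac (c : K) : series := fun r => series1 r - series_inv c r.

Section Reflection.
Variables (V : lmodType K) (S : nat -> 'I_n -> 'I_n -> V -> V).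

(* Formal power series in u^(-1) and v^(-1) whose coefficients are matrices on
   C^n (x) C^n with entries operators on V: A r s x y is the (x, y) entry of
   the coefficient at u^(-r) v^(-s). *)
Local Notation mxseries :=
  (nat -> nat -> 'I_n * 'I_n -> 'I_n * 'I_n -> V -> V).

Definition mxseries_mul (A B : mxseries) : mxseries := fun r s x y w =>
  \sum_(r1 < r.+1) \sum_(s1 < s.+1) \sum_(z : 'I_n * 'I_n)
    A r1 s1 x z (B (r - r1)%N (s - s1)%N z y w).

Definition flip_mx (x y : 'I_n * 'I_n) : K :=
  \sum_i \sum_j delta_mx i j x.1 y.1 * delta_mx j i x.2 y.2.

Definition flip'_mx (x y : 'I_n * 'I_n) : K :=
  \sum_i \sum_j theta K G i * theta K G j *
    (delta_mx i j x.1 y.1 * delta_mx (tilde i) (tilde j) x.2 y.2).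

(* u^(-1) v^(-1) R(u - v) = v^(-1) - u^(-1) - u^(-1) v^(-1) sum E_ij (x) E_ji *)
Definition R_series : mxseries := fun r s x y w =>
  match r, s with
  | 0%N, 1%N => (x == y)%:R *: w
  | 1%N, 0%N => - (x == y)%:R *: w
  | 1%N, 1%N => - flip_mx x y *: w
  | _, _ => 0
  end.

(* u^(-1) v^(-1) R'(- u - v) *)
Definition R'_series : mxseries := fun r s x y w =>
  match r, s with
  | 0%N, 1%N => - (x == y)%:R *: w
  | 1%N, 0%N => - (x == y)%:R *: w
  | 1%N, 1%N => - flip'_mx x y *: w
  | _, _ => 0
  end.

Definition S1_series : mxseries := fun r s x y w =>
  ((s == 0%N) && (x.2 == y.2))%:R *: S r x.1 y.1 w.

Definition S2_series : mxseries := fun r s x y w =>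
  ((r == 0%N) && (x.1 == y.1))%:R *: S s x.2 y.2 w.

(* The defining relations of X(g_n), divided by (u v)^2. *)
Definition X_relations : Prop := forall r s x y w,
  mxseries_mul R_series
    (mxseries_mul S1_series (mxseries_mul R'_series S2_series)) r s x y w =
  mxseries_mul S2_series
    (mxseries_mul R'_series (mxseries_mul S1_series R_series)) r s x y w.

End Reflection.

Definition is_bimodule (m : nat) (B : bimodule K m n) : Prop :=
  [/\ (forall r i j, linear (@Sop _ _ _ B r i j)) /\
      (forall a, linear (@Hop _ _ _ B a)),
      forall i j w, @Sop _ _ _ B 0 i j w = (i == j)%:R *: w,
      X_relations (@Sop _ _ _ B),
      forall a b w, Hop a (Hop b w) = Hop b (Hop a w) :> B &
      forall a r i j w, Hop a (Sop r i j w) = Sop r i j (Hop a w) :> B].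

Definition bimodule_equiv (m : nat) (B B' : bimodule K m n) : Prop :=
  [/\ is_bimodule B, is_bimodule B' &
      exists phi : {linear B -> B'},
        [/\ bijective phi,
            forall r i j w, phi (Sop r i j w) = Sop r i j (phi w) &
            forall a w, phi (Hop a w) = Hop a (phi w)]].

(* A space with operators T_ij^(r), where T_ij^(0) = delta_ij by convention. *)
Record ymodule := YModule {
  yspace :> lmodType K;
  Top : nat -> 'I_n -> 'I_n -> yspace -> yspace
}.

Definition P_module (z : K) : ymodule :=
  @YModule (mpoly n K) (fun r i j f =>
    (series1 r * (i == j)%:R) *: f + series_inv (- z) r *: ('X_i * f^`M(j))).

Definition ytensor (M N : ymodule) : ymodule :=
  @YModule (tensor M N) (fun r i j t =>
    \sum_(s < r.+1) \sum_k tmap (@Top M s i k) (@Top N (r - s) k j) t).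

(* P_{z_m} (x) ... (x) P_{z_1} for m = k.+1, where z_{a+1} is z a. *)
Fixpoint P_tensor (z : nat -> K) (k : nat) : ymodule :=
  if k is k'.+1 then ytensor (P_module (z k)) (P_tensor z k')
  else P_module (z 0%N).

Definition poly_degree (f : mpoly n K) : mpoly n K :=
  \sum_(e <- msupp f) ((mdeg e)%:R * f@_e) *: 'X_[e].

(* The degree operator in the factor P_{z_{a+1}}, for a <= k. *)
Fixpoint P_degree (z : nat -> K) (k a : nat) : P_tensor z k -> P_tensor z k :=
  match k return P_tensor z k -> P_tensor z k with
  | 0%N => poly_degree
  | k'.+1 => if a == k'.+1 then tmap poly_degree idfun
             else tmap idfun (@P_degree z k' a)
  end.

(* S_ij(u) |-> sum_k theta_i theta_k T_{~k ~i}(-u) T_kj(u) *)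
Definition S_of_T (M : ymodule) (r : nat) (i j : 'I_n) (w : M) : M :=
  \sum_(s < r.+1) \sum_k
    ((-1) ^+ s * theta K G i * theta K G k) *:
      Top s (tilde k) (tilde i) (Top (r - s) k j w).

(* S_ij(u) |-> f(u) S_ij(u) *)
Definition S_twist (f : series) (V : lmodType K)
    (S : nat -> 'I_n -> 'I_n -> V -> V) (r : nat) (i j : 'I_n) (w : V) : V :=
  \sum_(s < r.+1) f s *: S (r - s)%N i j w.

End XModules.

Definition extend0 (K : fieldType) (m : nat) (f : 'I_m -> K) (a : nat) : K :=
  oapp f 0 (insub a).

(* Main.v *)
Require Import Defs.
From HB Require Import structures.
From mathcomp Require Import all_boot all_order all_algebra.
From mathcomp Require Import finmap boolp reals complex.
From mathcomp Require Import mpoly monalg.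
From mathcomp Require Import ring zify ssrAC.
Import mpoly.

Set Implicit Arguments.
Unset Strict Implicit.
Unset Printing Implicit Defensive.

Import GRing.Theory.
Local Open Scope ring_scope.

(** Both bimodules are compared with the polynomial ring P in all the variables
    x_ai. In the formal series below, z_a = mu_a + z + m - a, so that the
    factors of the tensor product are the P_(z_a) and f(u) is the product of
    the 1 - 1 / (u + z_a + 1); T(u) is the product L_m(u) ... L_1(u), where
    L_a(u) = 1 + (x_i d_j) / (u - z_a) involves the variables of row m - a + 1
    only; and T'(-u) is the matrix with entries theta_i theta_j T_(~j ~i)(-u).
    On P, let S(u) act by f(u) T'(-u) T(u).

    The coinvariants. Let v be the highest weight vector of M_mu. Modulo
    n F_m(M_mu), a lowering operator in front of a vector of M_mu can be traded
    for minus its oscillator action on P, and an element of the Borel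
    subalgebra can be moved to v, where it acts by the weight. As a recursion
    on words this defines a map from the tensor algebra of f_m to the operators
    on P; it respects the relations of the enveloping algebra and of M_mu
    ([word_act_compatible], [free_act_rel], [verma_act_rel]), which gives the
    inverse of the map from P to the coinvariants that sends g to the class of
    v (x) g ([coinv_ofK], [poly_ofK]).

    The action of S(u). It is given by p (u + h - F)^-1 q with h = m + z, whose
    powers of F act on v (x) P. As F_ed kills v for e < d and acts on the
    coinvariants through - zeta for e > d, where zeta(F_ed) = - sum q_e p_d,
    the powers satisfy a triangular recursion ([row_vecS]), whose solution is
    an ordered product of 2 m matrices 1 + p_d q_d / (u - c_d) in decreasing
    order of d ([row_vec_prod]). The commutators of F shift the weight, and the
    shifts turn c_d into z_a for the index d = - (m - a + 1), where p_d q_d is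
    x d/dx and the factor is L_a(u), and into - (z_a + 1) for d = m - a + 1,
    where p_d q_d is - d/dx x up to indices and the factor is
    (1 - 1 / (u + z_a + 1)) L_a'(-u) ([factor_lax], [factor_dual_lax]). As
    T'(-u) reverses products, S(u) acts by f(u) T'(-u) T(u)
    ([prodT_factors]).

    The tensor product. Multiplying out identifies the tensor product of the
    P_(z_a) with P, and its comultiplication yields T(u) ([tens_poly_Top]).

    The relations. Each L_a(u) satisfies the RTT relation ([lax_rtt]), hence so
    does T(u) ([mulT_rtt]), and the reflection equation for T'(-u) T(u) follows
    formally ([reflection]); it passes to both bimodules along the two
    isomorphisms ([bimodule_equiv_common]). *)

(** * Linear maps out of free modules, quotients and tensor products *)

Section LinearPredicate.
Variables (K : fieldType) (U V W : lmodType K).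
Implicit Types f : U -> V.

Lemma lin0 f : linear f -> f 0 = 0.
Proof. by move=> fL; have := fL (-1) 0 0; rewrite !scaleN1r !addNr. Qed.

Lemma linZ f c x : linear f -> f (c *: x) = c *: f x.
Proof. by move=> fL; rewrite -[c *: x]addr0 fL lin0 // addr0. Qed.

Lemma linD f x y : linear f -> f (x + y) = f x + f y.
Proof. by move=> fL; rewrite -{1}[x]scale1r fL scale1r. Qed.

Lemma linN f x : linear f -> f (- x) = - f x.
Proof. by move=> fL; rewrite -scaleN1r linZ // scaleN1r. Qed.

Lemma linB f x y : linear f -> f (x - y) = f x - f y.
Proof. by move=> fL; rewrite linD // linN. Qed.

Lemma lin_sum f I (r : seq I) (P : pred I) F :
  linear f -> f (\sum_(i <- r | P i) F i) = \sum_(i <- r | P i) f (F i).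
Proof.
by move=> fL; apply: (big_morph f) => [x y|]; [apply: linD|apply: lin0].
Qed.

Lemma linear_comp (g : V -> W) f : linear g -> linear f -> linear (g \o f).
Proof. by move=> gL fL c x y; rewrite /= fL gL. Qed.

Lemma linear_addf f g : linear f -> linear g -> linear (fun x => f x + g x).
Proof. by move=> fL gL c x y; rewrite fL gL scalerDr addrACA. Qed.

Lemma linear_scalef a f : linear f -> linear (fun x => a *: f x).
Proof. by move=> fL c x y; rewrite fL scalerDr !scalerA mulrC. Qed.

Lemma linear_oppf f : linear f -> linear (fun x => - f x).
Proof. by move=> fL c x y; rewrite fL opprD scalerN. Qed.

Lemma linear_sumf I (r : seq I) (P : pred I) (F : I -> U -> V) :
  (forall i, linear (F i)) -> linear (fun x => \sum_(i <- r | P i) F i x).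
Proof.
move=> FL c x y; rewrite scaler_sumr -big_split.
by apply: eq_bigr => i _; rewrite FL.
Qed.

Lemma linear_cst0 : linear (fun _ : U => 0 : V).
Proof. by move=> c x y; rewrite scaler0 addr0. Qed.

End LinearPredicate.

Lemma linear_idfun (K : fieldType) (V : lmodType K) : linear (@idfun V).
Proof. by []. Qed.

Lemma linear_scale (K : fieldType) (V : lmodType K) (a : K) :
  linear (fun x : V => a *: x).
Proof. exact: (linear_scalef a (@linear_idfun K V)). Qed.

Section QuotientLift.
Variables (K : fieldType) (V U : lmodType K) (N : V -> Prop) (f : V -> U).
Hypotheses (fL : linear f) (fN : forall x, N x -> f x = 0).

Definition qlift (q : quotient N) : U := f (repr q).

Lemma lspan_ker x : lspan N x -> f x = 0.
Proof.
elim=> [|c u v Nu _ IH]; first exact: lin0.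
by rewrite fL IH fN // scaler0 addr0.
Qed.

Lemma qliftE x : qlift (qproj N x) = f x.
Proof.
apply/eqP; rewrite /qlift -subr_eq0 -(linB _ _ fL); apply/eqP/lspan_ker.
exact: repr_qproj.
Qed.

Lemma qlift_linear : linear qlift.
Proof.
move=> c q q'; elim/quot_ind: q => x; elim/quot_ind: q' => y.
by rewrite -(qproj_is_linear N) !qliftE; apply: fL.
Qed.

End QuotientLift.

Section FreeLift.
Variables (K : fieldType) (T : choiceType) (U : lmodType K) (h : T -> U).

Definition free_lift (x : {malg K[T]}) : U :=
  \sum_(k <- monalg.msupp x) monalg.mcoeff k x *: h k.

Lemma free_liftEw (D : {fset T}) x : (monalg.msupp x `<=` D)%fset ->
  free_lift x = \sum_(k <- D) monalg.mcoeff k x *: h k.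
Proof.
move=> sD; rewrite /free_lift (big_fset_incl _ sD) // => k _ /mcoeff_outdom ->.
by rewrite scale0r.
Qed.

Lemma free_lift_linear : linear free_lift.
Proof.
move=> c x y.
pose D := (monalg.msupp x `|` monalg.msupp y `|` monalg.msupp (c *: x + y))%fset.
rewrite (@free_liftEw D) ?fsubsetUr // (@free_liftEw D x); last first.
  by rewrite /D -fsetUA fsubsetUl.
rewrite (@free_liftEw D y); last by rewrite /D fsetUAC fsubsetUr.
rewrite scaler_sumr -big_split /=; apply: eq_bigr => p _.
by rewrite monalg.mcoeffD monalg.mcoeffZ scalerDl scalerA.
Qed.

Lemma free_liftU k : free_lift << k >> = h k.
Proof.
rewrite (@free_liftEw [fset k]%fset) ?msuppU_le //.
by rewrite big_seq_fset1 monalg.mcoeffUU scale1r.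
Qed.

End FreeLift.

Lemma eq_free (K : fieldType) (T : choiceType) (U : lmodType K)
    (f g : {malg K[T]} -> U) :
  linear f -> linear g -> (forall k, f << k >> = g << k >>) -> f =1 g.
Proof.
move=> fL gL fg x; rewrite [x]monalgE !lin_sum //; apply: eq_bigr => k _.
by rewrite -[monalg.mcoeff k x]mulr1 malgUZ !linZ // fg.
Qed.

Section TensorLift.
Variables (K : fieldType) (V W : lmodType K).

Lemma tens_linearl (w : W) : linear (fun v : V => tens v w).
Proof. by move=> c v v'; rewrite tensDZl. Qed.

Lemma tens_linearr (v : V) : linear (fun w : W => tens v w).
Proof. by move=> c w w'; rewrite tensDZr. Qed.

Variables (U : lmodType K) (b : V -> W -> U).
Hypotheses (bl : forall w, linear (b^~ w)) (br : forall v, linear (b v)).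

Definition tlift : tensor V W -> U :=
  qlift (free_lift (fun p : V * W => b p.1 p.2)).

Let h := fun p : V * W => b p.1 p.2.

Lemma tlift_rel x : bilinear_rel x -> free_lift h x = 0.
Proof.
have hL := free_lift_linear h.
case=> [c v v' w|c v w w']; rewrite !linB // linZ // !free_liftU /h /=.
  by rewrite (bl w) addrAC addrK subrr.
by rewrite (br v) addrAC addrK subrr.
Qed.

Lemma tlift_tens v w : tlift (tens v w) = b v w.
Proof.
rewrite /tlift /tens qliftE ?free_liftU //; first exact: free_lift_linear.
exact: tlift_rel.
Qed.

Lemma tlift_linear : linear tlift.
Proof.
apply: qlift_linear; [exact: free_lift_linear|exact: tlift_rel].
Qed.

End TensorLift.

(** * The Weyl algebra and the oscillator representation *)

Section Signs.
Variables (K : fieldType) (G : classical_group) (n m : nat).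
Hypothesis n_even : G = Symplectic -> ~~ odd n.

Lemma tilde_val (i : 'I_n) :
  tilde i = (if odd i then i.-1 else if i.+1 < n then i.+1 else i)%N :> nat.
Proof.
rewrite /tilde val_insubd; case oi: (odd i) => //.
by rewrite (leq_ltn_trans (leq_pred _) (ltn_ord i)).
Qed.

Lemma tildeK : involutive (@tilde n).
Proof.
move=> i; apply: val_inj; rewrite /= !tilde_val.
case oi: (odd i).
  by case: (nat_of_ord i) oi (ltn_ord i) => //= k /negbTE -> ->.
by case lin: (i.+1 < n)%N; rewrite /= oi ?lin.
Qed.

Lemma theta_sq (i : 'I_n) : theta K G i * theta K G i = 1.
Proof.
rewrite /theta; case: G; first by rewrite mulr1.
by rewrite -exprD addnn -mul2n exprM sqrrN !expr1n.
Qed.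

Lemma theta_tilde (i : 'I_n) : theta K G (tilde i) = pm K G * theta K G i.
Proof.
rewrite /theta /pm; case: G n_even => [_|/(_ erefl) ne]; first by rewrite mulr1.
rewrite tilde_val; case oi: (odd i).
  by case: (nat_of_ord i) oi => //= k _; rewrite exprS mulrA mulrNN !mul1r.
case: ifP => lin; first by rewrite exprS.
have: i.+1 = n by apply/eqP; rewrite eqn_leq (ltn_ord i) leqNgt lin.
by move=> /(congr1 odd) /= ; rewrite oi (negbTE ne).
Qed.

Lemma theta_mul_tilde (i : 'I_n) : theta K G i * theta K G (tilde i) = pm K G.
Proof. by rewrite theta_tilde mulrCA theta_sq mulr1. Qed.

Lemma pm_sq : pm K G * pm K G = 1.
Proof. by rewrite /pm; case: G; rewrite ?mulr1 // mulrNN mulr1. Qed.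

(** The sign matrix eps has rank one: it is the outer square of this sign,
    which also relates the operators q_c and p_(-c). *)
Definition index_sign (c : 'I_(m + m)) : K :=
  if G is Orthogonal then isgn K c else 1.

Local Notation sg := index_sign.

Lemma epsE a b : eps K G a b = sg a * sg b.
Proof. by rewrite /eps /sg; case: G; rewrite ?mulr1. Qed.

Lemma sg_sq c : sg c * sg c = 1.
Proof.
by rewrite /sg /isgn; case: G; rewrite ?mulr1 //; case: ifP; rewrite ?mulr1 ?mulrNN ?mulr1.
Qed.

Lemma rev_lshift (a : 'I_m) : rev_ord (lshift m a) = rshift m (rev_ord a).
Proof. by apply: val_inj => /=; rewrite addnBA. Qed.

Lemma rev_rshift (a : 'I_m) : rev_ord (rshift m a) = lshift m (rev_ord a).
Proof. by apply: val_inj => /=; rewrite -addnS subnDl. Qed.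

Lemma isgn_rev (c : 'I_(m + m)) : isgn K (rev_ord c) = - isgn K c.
Proof.
case: (split_ordP c) => a ->; rewrite /isgn.
  by rewrite rev_lshift /= ltn_ord ltnNge leq_addr opprK.
by rewrite rev_rshift /= (ltn_ord (rev_ord a)) ltnNge leq_addr.
Qed.

Lemma sg_rev c : sg (rev_ord c) = - pm K G * sg c.
Proof.
rewrite /sg /pm; case: G; last by rewrite opprK mulr1.
by rewrite isgn_rev mulN1r.
Qed.

Lemma eps_rev (a b : 'I_(m + m)) : eps K G (rev_ord b) (rev_ord a) = eps K G a b.
Proof. by rewrite !epsE !sg_rev mulrACA mulrNN pm_sq mul1r mulrC. Qed.

Lemma eps_sq (a b : 'I_(m + m)) : eps K G a b * eps K G a b = 1.
Proof. by rewrite epsE mulrACA !sg_sq mulr1. Qed.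

Lemma eps_diag (a : 'I_(m + m)) : eps K G a a = 1.
Proof. by rewrite epsE sg_sq. Qed.

Lemma eps_mul (a b c : 'I_(m + m)) : eps K G a b * eps K G b c = eps K G a c.
Proof. by rewrite !epsE mulrA -[sg a * _ * _]mulrA sg_sq mulr1. Qed.

Lemma eps_rev_self (a : 'I_(m + m)) : eps K G (rev_ord a) a = - pm K G.
Proof. by rewrite epsE sg_rev -mulrA sg_sq mulr1. Qed.

End Signs.

Section Weyl.
Variables (K : fieldType) (G : classical_group) (n m : nat).
Hypothesis n_even : G = Symplectic -> ~~ odd n.
Local Notation P := (polymn K m n).
Local Notation sg := (index_sign K G).
Local Notation th := (theta K G).
Local Notation pop := (@pop K G m n).
Local Notation qop := (@qop K G m n).

Lemma xop_linear a i : linear (@xop K m n a i).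
Proof. by move=> c f g; rewrite /xop mulrDr scalerAr. Qed.

Lemma dop_linear a i : linear (@dop K m n a i).
Proof. exact: mderiv_is_linear. Qed.

Lemma dop_comm a b i j (f : P) : dop a i (dop b j f) = dop b j (dop a i f).
Proof. exact: mderiv_comm. Qed.

Lemma xop_comm a b i j (f : P) : xop a i (xop b j f) = xop b j (xop a i f).
Proof. exact: mulrCA. Qed.

Lemma mxvec_index_eq a b (i j : 'I_n) :
  (mxvec_index a i == mxvec_index b j :> 'I_(m * n)) = (a == b) && (i == j).
Proof.
apply/eqP/andP => [|[/eqP-> /eqP->] //].
rewrite /mxvec_index => /cast_ord_inj /enum_rank_inj [-> ->].
by rewrite !eqxx.
Qed.

Lemma dop_xop a b i j (f : P) :
  dop a i (xop b j f) = xop b j (dop a i f) + ((a == b) && (i == j))%:R *: f.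
Proof.
rewrite /dop /xop mderivM mderivX addrC; congr (_ + _).
rewrite mnm1E mxvec_index_eq eq_sym [j == i]eq_sym.
case: andP => [[/eqP -> /eqP ->]|_]; last by rewrite !scale0r mul0r.
rewrite !scale1r (_ : _ - _ = 0)%MM ?mpolyX0 ?mul1r //.
by apply/mnmP=> k; rewrite mnmBE mnm0E subnn.
Qed.

Lemma pop_linear c i : linear (pop c i).
Proof.
rewrite /Defs.pop; case: (split c) => c'; first exact: xop_linear.
by apply: linear_scalef; apply: dop_linear.
Qed.

Lemma qop_linear c i : linear (qop c i).
Proof.
rewrite /Defs.qop; case: (split c) => c'; first exact: dop_linear.
by apply: linear_scalef; apply: xop_linear.
Qed.

Lemma split_lshift (a : 'I_m) : split (lshift m a) = inl a.
Proof. exact: (unsplitK (inl a)). Qed.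

Lemma split_rshift (a : 'I_m) : split (rshift m a) = inr a.
Proof. exact: (unsplitK (inr a)). Qed.

Lemma pop_lshift a i f : pop (lshift m a) i f = xop (rev_ord a) i f.
Proof. by rewrite /Defs.pop split_lshift. Qed.

Lemma pop_rshift a i f : pop (rshift m a) i f = - th i *: dop a (tilde i) f.
Proof. by rewrite /Defs.pop split_rshift. Qed.

Lemma qop_lshift a i f : qop (lshift m a) i f = dop (rev_ord a) i f.
Proof. by rewrite /Defs.qop split_lshift. Qed.

Lemma qop_rshift a i f : qop (rshift m a) i f = th i *: xop a (tilde i) f.
Proof. by rewrite /Defs.qop split_rshift. Qed.

Lemma qop_pop_rev c j f :
  qop c j f = sg c * th j *: pop (rev_ord c) (tilde j) f.
Proof.
case: (split_ordP c) => a ->.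
  rewrite rev_lshift qop_lshift pop_rshift tildeK scalerA mulrN -mulrA.
  rewrite theta_mul_tilde // /index_sign /isgn /pm /= ltn_ord.
  by case: G; rewrite ?mulr1 ?mul1r ?opprK scale1r.
rewrite rev_rshift qop_rshift pop_lshift rev_ordK /index_sign /isgn /= ltnNge leq_addr.
by case: G; rewrite ?mul1r.
Qed.

Lemma qop_pop c d k i f :
  qop c k (pop d i f) = pop d i (qop c k f) + ((c == d) && (k == i))%:R *: f.
Proof.
case: (split_ordP c) => a ->; case: (split_ordP d) => b ->.
- rewrite !qop_lshift !pop_lshift dop_xop (inj_eq rev_ord_inj).
  by rewrite (inj_eq (@lshift_inj _ _)).
- rewrite !qop_lshift !pop_rshift (linZ _ _ (dop_linear _ _)).
  by rewrite dop_comm eq_lrshift scale0r addr0.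
- rewrite !qop_rshift !pop_lshift (linZ _ _ (xop_linear _ _)).
  by rewrite xop_comm eq_rlshift scale0r addr0.
rewrite !qop_rshift !pop_rshift (linZ _ _ (xop_linear _ _)).
rewrite (linZ _ _ (dop_linear _ _)).
rewrite dop_xop !scalerA scalerDr mulrC -addrA scalerA -scalerDl.
rewrite (inj_eq (inv_inj (@tildeK n))) [b == a]eq_sym [i == k]eq_sym.
rewrite (inj_eq (@rshift_inj _ _)) -[LHS]addr0; congr (_ + _).
case: andP => [[_ /eqP ->]|_]; last by rewrite mulr0 addr0 scale0r.
by rewrite mulr1 mulNr theta_sq addNr scale0r.
Qed.
End Weyl.

Section Oscillator.
Variables (K : fieldType) (G : classical_group) (n m : nat).
Hypothesis n_even : G = Symplectic -> ~~ odd n.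
Hypothesis two_neq0 : 2%:R != 0 :> K.
Local Notation P := (polymn K m n).
Local Notation sg := (index_sign K G).
Local Notation th := (theta K G).
Local Notation eps := (eps K G).
Local Notation pop := (@pop K G m n).
Local Notation qop := (@qop K G m n).
Local Notation zeta := (@zeta K G m n).

Lemma pop_qop_rev b k f :
  pop b k f = sg (rev_ord b) * th (tilde k) *: qop (rev_ord b) (tilde k) f.
Proof.
rewrite (qop_pop_rev n_even) rev_ordK tildeK scalerA.
by rewrite mulrACA sg_sq theta_sq mulr1 scale1r.
Qed.

Lemma pop_pop b c k i f : pop b k (pop c i f) = pop c i (pop b k f)
  + (sg (rev_ord b) * th (tilde k) * ((rev_ord b == c) && (tilde k == i))%:R) *: f.
Proof.
rewrite pop_qop_rev qop_pop [in RHS](pop_qop_rev b) (linZ _ _ (pop_linear _ _ _)).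
by rewrite scalerDr scalerA.
Qed.

(** The four cases in the definition of zeta become one: in terms of p and q
    the constant n/2 has the same sign on all the F_aa. *)
Lemma zetaE a b f :
  zeta a b f = - (\sum_k qop a k (pop b k f))
               + ((a == b)%:R * (n%:R / 2%:R)) *: f.
Proof.
rewrite /Defs.zeta.
case: (split_ordP a) => a' ->; case: (split_ordP b) => b' ->;
  rewrite ?split_lshift ?split_rshift ?eq_lrshift ?eq_rlshift ?mul0r ?scale0r ?addr0.
- under eq_bigr do rewrite qop_lshift pop_lshift dop_xop eqxx andbT.
  rewrite big_split /= sumr_const card_ord /zeta_pos (inj_eq (@lshift_inj _ _)).
  rewrite !(inj_eq rev_ord_inj) [b' == a']eq_sym.
  case: eqP => _; last first.
    by rewrite !mul0r !scale0r mul0rn add0r !addr0.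
  rewrite !mul1r scale1r !opprD addrC -addrA; congr (_ + _).
  rewrite -scaler_nat -!scaleNr -scalerDl; congr (_ *: _).
  apply: (mulIf two_neq0); rewrite mulrDl !mulNr divfK //.
  by rewrite mulr_natr mulr2n opprD subrK.
- rewrite -sumrN; apply: eq_bigr => k _.
  rewrite qop_lshift pop_rshift (linZ _ _ (dop_linear _ _)) scaleNr opprK.
  by [].
- congr (- _); apply: eq_bigr => k _.
  by rewrite qop_rshift pop_lshift.
rewrite /zeta_pos addrC (inj_eq (@rshift_inj _ _)) mulrA; congr (_ + _).
rewrite -sumrN (reindex_inj (inv_inj (@tildeK n))); apply: eq_bigr => k _.
rewrite qop_rshift pop_rshift (linZ _ _ (xop_linear _ _)) scalerA.
by rewrite mulrN theta_sq scaleN1r opprK.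
Qed.

Lemma zeta_linear a b : linear (zeta a b).
Proof.
move=> c f g; rewrite !zetaE.
under eq_bigr do rewrite pop_linear qop_linear.
rewrite big_split /= -scaler_sumr opprD !scalerDr scalerN addrACA.
by rewrite !scalerA mulrC.
Qed.

Lemma zeta_pop a b c i f :
  zeta a b (pop c i f) = pop c i (zeta a b f)
   - (a == c)%:R *: pop b i f
   + (eps a b * (c == rev_ord b)%:R) *: pop (rev_ord a) i f.
Proof.
rewrite !zetaE (linD _ _ (pop_linear _ _ _)) (linZ _ _ (pop_linear _ _ _)).
rewrite -!addrA [RHS]addrCA [LHS]addrC; congr (_ + _).
rewrite (linN _ (pop_linear _ _ _)) (lin_sum _ _ _ (pop_linear _ _ _)).
under eq_bigr => k _.
  rewrite pop_pop (linD _ _ (qop_linear _ _ _)) (linZ _ _ (qop_linear _ _ _)).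
  rewrite qop_pop -addrA; over.
rewrite big_split opprD /=; congr (_ + _).
rewrite big_split opprD /=; congr (_ + _).
  rewrite (bigD1 i) //= eqxx andbT big1 ?addr0 // => k /negbTE ki.
  by rewrite ki andbF scale0r.
rewrite (bigD1 (tilde i)) //= tildeK eqxx andbT big1 ?addr0; last first.
  move=> k ki; rewrite (_ : tilde k == i = false) ?andbF ?mulr0 ?scale0r //.
  by apply: contra_neqF ki => /eqP <-; rewrite tildeK.
rewrite pop_qop_rev rev_ordK scalerA -scaleNr [c == _]eq_sym; congr (_ *: _).
case: eqP => _; last by rewrite !mulr0 mul0r oppr0.
rewrite !mulr1 theta_tilde // sg_rev epsE.
transitivity (pm K G * sg b * th i); first by rewrite !mulNr opprK.
transitivity (sg a * sg a * (pm K G * sg b * th i)); first by rewrite sg_sq mul1r.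
ring.
Qed.

(** The relation F_(-b)(-a) = - eps_ab F_ab, which makes the halved double sum
    in [zetaX] agree with zeta on the F_ab. *)
Lemma zeta_rev a b f : zeta (rev_ord b) (rev_ord a) f = - eps a b *: zeta a b f.
Proof.
rewrite !zetaE scalerDr scalerN scaleNr opprK.
have -> : \sum_k qop (rev_ord b) k (pop (rev_ord a) k f) =
    - eps a b *: \sum_k pop b k (qop a k f).
  rewrite scaler_sumr (reindex_inj (inv_inj (@tildeK n))); apply: eq_bigr => k _.
  rewrite (qop_pop_rev n_even) rev_ordK tildeK (pop_qop_rev (rev_ord a)).
  rewrite rev_ordK tildeK (linZ _ _ (pop_linear _ _ _)) scalerA sg_rev epsE.
  congr (_ *: _); rewrite mulrACA [th _ * _]mulrC theta_mul_tilde //.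
  transitivity (- (pm K G * pm K G) * (sg a * sg b)); first by ring.
  by rewrite pm_sq mulN1r.
have -> : \sum_k qop a k (pop b k f) =
    \sum_k pop b k (qop a k f) + (a == b)%:R * n%:R *: f.
  under eq_bigr => k _ do rewrite qop_pop eqxx andbT.
  by rewrite big_split /= sumr_const card_ord -scaler_nat scalerA mulrC.
rewrite (inj_eq rev_ord_inj) eq_sym scaleNr opprK scalerDr -addrA; congr (_ + _).
rewrite !scalerA -scalerDl; congr (_ *: _).
case: eqP => [->|_]; last by rewrite !mul0r !mulr0 addr0.
rewrite eps_diag !mul1r mulN1r; apply: (mulIf two_neq0).
by rewrite mulrBl divfK // mulr_natr mulr2n addrK.
Qed.

(** Membership in f_m as linear equations on the entries, see [in_fmP]. *)
Definition antifixed (X : 'M[K]_(m + m)) :=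
  forall a b, X a b = - eps a b * X (rev_ord b) (rev_ord a).

(** The oscillator action of a general element of f_m; the sum contains each
    F_ab twice, as F_ab and up to sign as F_(-b)(-a). *)
Definition zetaX (X : 'M[K]_(m + m)) (f : P) : P :=
  2%:R^-1 *: \sum_a \sum_b X a b *: zeta a b f.

Lemma zetaX_linear X : linear (zetaX X).
Proof.
apply: linear_scalef; apply: linear_sumf => a; apply: linear_sumf => b.
by apply: linear_scalef; apply: zeta_linear.
Qed.

Lemma zetaX_linearl f : linear (zetaX^~ f).
Proof.
move=> c X Y; rewrite /zetaX scalerA mulrC -scalerA -scalerDr; congr (_ *: _).
rewrite scaler_sumr -big_split; apply: eq_bigr => a _.
rewrite scaler_sumr -big_split; apply: eq_bigr => b _.
by rewrite !mxE scalerDl scalerA.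
Qed.

Lemma sum_delta (V : lmodType K) (I : finType) (i : I) (F : I -> V) :
  \sum_j (i == j)%:R *: F j = F i.
Proof.
rewrite (bigD1 i) //= eqxx scale1r big1 ?addr0 // => j /negbTE.
by rewrite eq_sym => ->; rewrite scale0r.
Qed.

Lemma half_add (V : lmodType K) (x : V) : 2%:R^-1 *: (x + x) = x.
Proof. by rewrite -mulr2n -scaler_nat scalerA mulVf // scale1r. Qed.

Lemma zetaX_delta a b f : zetaX (delta_mx a b) f = 2%:R^-1 *: zeta a b f.
Proof.
congr (_ *: _).
under eq_bigr => c _ do under eq_bigr => d _ do
  rewrite mxE -mulnb natrM [c == _]eq_sym [d == _]eq_sym -scalerA.
under eq_bigr do rewrite -scaler_sumr sum_delta.
by rewrite sum_delta.
Qed.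

Lemma zetaX_Fmx a b f : zetaX (Fmx K G a b) f = zeta a b f.
Proof.
rewrite (linB _ _ (zetaX_linearl f)) (linZ _ _ (zetaX_linearl f)).
rewrite !zetaX_delta zeta_rev !scalerA mulrAC mulrN eps_sq mulN1r.
by rewrite scaleNr opprK -scalerDr half_add.
Qed.

(** For a fixed second index the q_c transform as the standard basis of the
    vector representation of f_m, and the p_c as the dual basis. *)
Lemma zetaX_pop X c i f : antifixed X ->
  zetaX X (pop c i f) = pop c i (zetaX X f) - \sum_b X c b *: pop b i f.
Proof.
move=> Xs; rewrite (linZ _ _ (pop_linear _ _ _)) (lin_sum _ _ _ (pop_linear _ _ _)).
rewrite -[\sum_b X c b *: _]half_add -scalerBr; congr (_ *: _).
under eq_bigr => a _.
  under eq_bigr do rewrite zeta_pop scalerDr scalerBr -addrA.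
  rewrite big_split /=; over.
rewrite big_split /=; congr (_ + _).
  apply: eq_bigr => a _; rewrite (lin_sum _ _ _ (pop_linear _ _ _)).
  by apply: eq_bigr => b _; rewrite (linZ _ _ (pop_linear _ _ _)).
under eq_bigr do rewrite big_split sumrN /=.
rewrite big_split sumrN /= opprD; congr (- _ + _).
  under eq_bigr => a _.
    under eq_bigr do rewrite scalerA mulrC -scalerA eq_sym.
    rewrite -scaler_sumr; over.
  exact: sum_delta.
rewrite (reindex_inj rev_ord_inj) -sumrN; apply: eq_bigr => a _.
rewrite rev_ordK (reindex_inj rev_ord_inj).
under eq_bigr do rewrite rev_ordK scalerA mulrCA mulrA mulrC -scalerA.
rewrite sum_delta -scaleNr; congr (_ *: _).
by rewrite (Xs c a) eps_rev mulNr opprK.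
Qed.

Lemma zetaX_qop X c j f : antifixed X ->
  zetaX X (qop c j f) = qop c j (zetaX X f) + \sum_a X a c *: qop a j f.
Proof.
move=> Xs; rewrite !(qop_pop_rev n_even c) (linZ _ _ (zetaX_linear X)) zetaX_pop //.
rewrite scalerBr; congr (_ + _).
rewrite (reindex_inj rev_ord_inj) scaler_sumr -sumrN; apply: eq_bigr => a _.
rewrite pop_qop_rev rev_ordK tildeK !scalerA -scaleNr; congr (_ *: _).
rewrite (Xs a c) (epsE K G a c).
transitivity (- (sg a * sg c) * X (rev_ord c) (rev_ord a) * (th j * th j)).
  by ring.
by rewrite theta_sq mulr1.
Qed.

(* The constants n/2 of the Cartan elements cancel between the two sums. *)
Lemma zetaX_zeta X a b f : antifixed X ->
  zetaX X (zeta a b f) = zeta a b (zetaX X f)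
    + \sum_c X c a *: zeta c b f - \sum_c X b c *: zeta a c f.
Proof.
move=> Xs; rewrite !(zetaE a b) (linD _ _ (zetaX_linear X)).
rewrite (linZ _ _ (zetaX_linear X)) (linN _ (zetaX_linear X)).
rewrite (lin_sum _ _ _ (zetaX_linear X)).
under eq_bigr => k _.
  rewrite zetaX_qop // zetaX_pop // (linB _ _ (qop_linear _ _ _)).
  rewrite (lin_sum _ _ _ (qop_linear _ _ _)).
  under [X in _ - X + _]eq_bigr do rewrite (linZ _ _ (qop_linear _ _ _)).
  rewrite -addrA [- _ + _]addrC; over.
rewrite big_split sumrB /= opprD addrAC -!addrA; congr (_ + (_ + _)).
rewrite [X in - (X - _)]exchange_big [X in - (_ - X)]exchange_big /= opprB addrC.
have E1 : \sum_c X c a *: zeta c b f =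
    - (\sum_c \sum_k X c a *: qop c k (pop b k f)) + (X b a * (n%:R / 2%:R)) *: f.
  under eq_bigr do rewrite zetaE scalerDr scalerN scalerA mulrCA -scalerA eq_sym scaler_sumr.
  by rewrite big_split /= sumrN sum_delta.
have E2 : \sum_c X b c *: zeta a c f =
    - (\sum_c \sum_k X b c *: qop a k (pop c k f)) + (X b a * (n%:R / 2%:R)) *: f.
  under eq_bigr do rewrite zetaE scalerDr scalerN scalerA mulrCA -scalerA scaler_sumr.
  by rewrite big_split /= sumrN sum_delta.
by rewrite E1 E2 opprD opprK [X in _ = _ + X]addrC addrA subrK.
Qed.

Lemma zetaX_comm X Y f : antifixed X ->
  zetaX X (zetaX Y f) = zetaX Y (zetaX X f) + zetaX (X *m Y - Y *m X) f.
Proof.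
move=> Xs; rewrite {2 5}/zetaX (linZ _ _ (zetaX_linear X)) -scalerDr.
rewrite (lin_sum _ _ _ (zetaX_linear X)); congr (_ *: _).
under eq_bigr => a _.
  rewrite (lin_sum _ _ _ (zetaX_linear X)).
  under eq_bigr do
    rewrite (linZ _ _ (zetaX_linear X)) zetaX_zeta // -addrA scalerDr scalerBr.
  rewrite big_split sumrB; over.
rewrite big_split sumrB /=; congr (_ + _).
under [RHS]eq_bigr do under eq_bigr do rewrite !mxE scalerBl.
under [RHS]eq_bigr do rewrite sumrB.
rewrite sumrB; congr (_ - _).
  under eq_bigr do under eq_bigr do rewrite scaler_sumr.
  rewrite exchange_big /=.
  under eq_bigr do rewrite exchange_big.
  rewrite exchange_big /=; apply: eq_bigr => c _; apply: eq_bigr => b _.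
  by rewrite scaler_suml; apply: eq_bigr => a _; rewrite scalerA mulrC.
apply: eq_bigr => a _.
under eq_bigr do rewrite scaler_sumr.
rewrite exchange_big /=; apply: eq_bigr => c _.
by rewrite scaler_suml; apply: eq_bigr => b _; rewrite scalerA.
Qed.

End Oscillator.

(** * The Lie algebra f_m and its enveloping algebra *)

Lemma span_closed (K : fieldType) (vT : vectType K) (s : seq vT)
    (Q : vT -> Prop) :
  Q 0 -> (forall c x y, Q x -> Q y -> Q (c *: x + y)) ->
  {in s, forall x, Q x} -> {in <<s>>%VS, forall x, Q x}.
Proof.
move=> Q0 QD Qs v /(@coord_span _ _ _ (in_tuple s)) ->.
apply: (big_ind (fun v => Q v)) => [//|x y Qx Qy|i _].
  by rewrite -[x]scale1r; apply: QD.
by rewrite -[_ *: _]addr0; apply: QD => //; apply/Qs/mem_nth.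
Qed.

Section LieAlgebra.
Variables (K : fieldType) (G : classical_group) (m : nat).
Hypothesis two_neq0 : 2%:R != 0 :> K.
Local Notation eps := (eps K G).
Local Notation Fmx := (@Fmx K G m).
Local Notation antifixed := (@antifixed K G m).
Local Notation fm := (fm K G m).

(** f_m is the eigenspace for -1 of this involutive antiautomorphism. *)
Definition antiinv (M : 'M[K]_(m + m)) : 'M[K]_(m + m) :=
  \matrix_(a, b) (eps a b * M (rev_ord b) (rev_ord a)).

Lemma antiinv_linear : linear antiinv.
Proof.
by move=> c M N; apply/matrixP=> a b; rewrite !mxE mulrDr mulrCA.
Qed.

Lemma antiinvM M N : antiinv (M *m N) = antiinv N *m antiinv M.
Proof.
apply/matrixP=> a b; rewrite !mxE mulr_sumr (reindex_inj rev_ord_inj).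
by apply: eq_bigr => c _; rewrite !mxE mulrACA eps_mul [X in _ * X]mulrC.
Qed.

Lemma antiinv_delta a b : antiinv (delta_mx a b) = eps a b *: delta_mx (rev_ord b) (rev_ord a).
Proof.
apply/matrixP=> c d; rewrite !mxE.
rewrite (can2_eq rev_ordK rev_ordK) [rev_ord c == b](can2_eq rev_ordK rev_ordK).
rewrite andbC; case: andP => [[/eqP-> /eqP->]|_]; last by rewrite !mulr0.
by rewrite eps_rev.
Qed.

Lemma FmxE a b : Fmx a b = delta_mx a b - antiinv (delta_mx a b).
Proof. by rewrite antiinv_delta. Qed.

Lemma antifixedE X : antifixed X <-> antiinv X = - X.
Proof.
split=> [Xs|E]; first by apply/matrixP=> a b; rewrite !mxE (Xs a b) mulNr opprK.
by move=> a b; rewrite mulNr; move/matrixP/(_ a b): E; rewrite !mxE => ->; rewrite opprK.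
Qed.

Lemma antifixedD c X Y : antifixed X -> antifixed Y -> antifixed (c *: X + Y).
Proof.
move=> /antifixedE Xs /antifixedE Ys; apply/antifixedE.
by rewrite antiinv_linear Xs Ys scalerN opprD.
Qed.

Lemma antifixed0 : antifixed 0.
Proof. by move=> a b; rewrite !mxE mulr0. Qed.

Lemma antiinvK M : antiinv (antiinv M) = M.
Proof. by apply/matrixP=> a b; rewrite !mxE eps_rev mulrA eps_sq mul1r !rev_ordK. Qed.

Lemma antifixed_Fmx a b : antifixed (Fmx a b).
Proof. by apply/antifixedE; rewrite FmxE (linB _ _ antiinv_linear) antiinvK opprB. Qed.

Lemma antifixed_sum X : antifixed X -> X = 2%:R^-1 *: \sum_a \sum_b X a b *: Fmx a b.
Proof.
move=> /antifixedE Xs.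
have -> : \sum_a \sum_b X a b *: Fmx a b = X - antiinv X.
  rewrite [in RHS](matrix_sum_delta X) (lin_sum _ _ _ antiinv_linear) -sumrB.
  apply: eq_bigr => a _; rewrite (lin_sum _ _ _ antiinv_linear) -sumrB.
  apply: eq_bigr => b _; rewrite (linZ _ _ antiinv_linear) -scalerBr.
  by rewrite -FmxE.
by rewrite Xs opprK half_add.
Qed.

Lemma memF a b : Fmx a b \in fm.
Proof. by apply/memv_span/mapP; exists (a, b); rewrite ?mem_enum. Qed.

Lemma in_fmP X : reflect (antifixed X) (X \in fm).
Proof.
apply: (iffP idP) => [|Xs].
  apply: span_closed; [exact: antifixed0|exact: antifixedD|].
  by move=> _ /mapP [[a b] _ ->]; apply: antifixed_Fmx.
rewrite (antifixed_sum Xs) memvZ // rpred_sum // => a _; rewrite rpred_sum // => b _.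
exact/memvZ/memF.
Qed.

Lemma antifixed_val (X : subvs_of fm) : antifixed (vsval X).
Proof. exact/in_fmP/subvsP. Qed.

Lemma Fmx_rev a b : Fmx (rev_ord b) (rev_ord a) = - eps a b *: Fmx a b.
Proof.
rewrite /Fmx !rev_ordK eps_rev scalerBr scaleNr scaleNr opprK scalerA eps_sq scale1r.
by rewrite addrC.
Qed.

Lemma antifixed_comm X Y : antifixed X -> antifixed Y -> antifixed (X *m Y - Y *m X).
Proof.
move=> /antifixedE Xs /antifixedE Ys; apply/antifixedE.
by rewrite (linB _ _ antiinv_linear) !antiinvM Xs Ys !mulNmx !mulmxN !opprK opprB.
Qed.

Definition bracket (X Y : subvs_of fm) : subvs_of fm :=
  vsproj fm (vsval X *m vsval Y - vsval Y *m vsval X).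

Lemma bracketE X Y : vsval (bracket X Y) = vsval X *m vsval Y - vsval Y *m vsval X.
Proof. by rewrite vsprojK //; apply/in_fmP/antifixed_comm; apply: antifixed_val. Qed.

Lemma FelE a b : vsval (Fel K G a b) = Fmx a b.
Proof. by rewrite vsprojK ?memF. Qed.

Lemma comm_Fmx X c d : antifixed X ->
  X *m Fmx c d - Fmx c d *m X =
  \sum_a X a c *: Fmx a d - \sum_b X d b *: Fmx c b.
Proof.
move=> /antifixedE Xs.
have E1 : X *m delta_mx c d = \sum_a X a c *: delta_mx a d.
  rewrite {1}[X]matrix_sum_delta mulmx_suml; apply: eq_bigr => a _.
  rewrite mulmx_suml (bigD1 c) //= -scalemxAl mul_delta_mx big1 ?addr0 // => b /negbTE bc.
  by rewrite -scalemxAl mul_delta_mx_cond bc mulr0n scaler0.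
have E2 : delta_mx c d *m X = \sum_b X d b *: delta_mx c b.
  rewrite {1}[X]matrix_sum_delta mulmx_sumr (bigD1 d) //= [X in _ + X]big1 ?addr0.
    rewrite mulmx_sumr; apply: eq_bigr => b _.
    by rewrite -scalemxAr mul_delta_mx.
  move=> a /negbTE ad; rewrite mulmx_sumr big1 // => b _.
  by rewrite -scalemxAr mul_delta_mx_cond eq_sym ad mulr0n scaler0.
under eq_bigr do rewrite FmxE scalerBr -(linZ _ _ antiinv_linear).
under [X in _ = _ - X]eq_bigr do rewrite FmxE scalerBr -(linZ _ _ antiinv_linear).
rewrite !sumrB -!(lin_sum _ _ _ antiinv_linear) -E1 -E2 FmxE !antiinvM Xs.
rewrite mulmxBr mulmxBl mulmxN mulNmx !opprK opprB opprD -!addrA.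
by congr (_ + _); rewrite addrC -addrA.
Qed.

End LieAlgebra.

(** * The commuting actions of f_m and X(g_n) *)

Section Equivariance.
Variables (K : fieldType) (G : classical_group) (m : nat).
Hypothesis two_neq0 : 2%:R != 0 :> K.
Local Notation fm := (fm K G m).
Local Notation U := (env fm).

Let vsval_linear : linear (@vsval _ _ fm).
Proof. by move=> c X Y; rewrite linearP. Qed.

(** The entries of such a matrix span a quotient of the f_m-module of matrices. *)
Definition equivariant (B : 'M[U]_(m + m)) := forall (X : subvs_of fm) c d,
  env_gen X * B c d = B c d * env_gen X
    + \sum_a vsval X a c *: B a d - \sum_b vsval X d b *: B c b.

Lemma equivariant_FU : equivariant (\matrix_(a, b) FU K G a b).
Proof.
move=> X c d; rewrite !mxE.
have := @env_gen_bracket _ _ fm X (Fel K G c d) (bracket X (Fel K G c d)).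
rewrite (bracketE two_neq0) => /(_ erefl) /eqP; rewrite subr_eq => /eqP ->.
rewrite addrC -addrA; congr (_ + _).
have -> : bracket X (Fel K G c d) =
    \sum_a vsval X a c *: Fel K G a d - \sum_b vsval X d b *: Fel K G c b.
  apply: subvs_inj; rewrite (bracketE two_neq0) FelE comm_Fmx.
    rewrite (linB _ _ vsval_linear) !(lin_sum _ _ _ vsval_linear).
    congr (_ - _); apply: eq_bigr => a _;
      by rewrite (linZ _ _ vsval_linear) FelE.
  exact: antifixed_val.
rewrite (linB _ _ (@env_gen_linear _ _ _)) !(lin_sum _ _ _ (@env_gen_linear _ _ _)).
by congr (_ - _); apply: eq_bigr => a _; rewrite mxE (linZ _ _ (@env_gen_linear _ _ _)).
Qed.

Lemma sum_pick (V : lmodType K) (I : finType) (i : I) (F : I -> V) :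
  (forall j, j != i -> F j = 0) -> \sum_j F j = F i.
Proof. by move=> F0; rewrite (bigD1 i) //= big1 ?addr0. Qed.

Lemma equivariant_scalar h : equivariant (h *: (1 : U))%:M.
Proof.
move=> X c d; rewrite !mxE.
rewrite (sum_pick (i := d)); last first.
  by move=> a /negbTE ad; rewrite mxE ad mulr0n scaler0.
rewrite (sum_pick (i := c)); last first.
  by move=> b /negbTE bc; rewrite mxE eq_sym bc mulr0n scaler0.
rewrite !mxE !eqxx !mulr1n addrK mulrnAr mulrnAl; congr (_ *+ _).
by rewrite -env_scalerAr -qring_scalerAl mulr1 mul1r.
Qed.

Lemma equivariantB B C : equivariant B -> equivariant C -> equivariant (B - C).
Proof.
move=> HB HC X c d; rewrite !mxE mulrBr mulrBl HB HC.
under [X in _ = _ + X - _]eq_bigr do rewrite !mxE scalerBr.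
under [X in _ = _ - X]eq_bigr do rewrite !mxE scalerBr.
by rewrite !sumrB !opprD !opprK addrACA [X in X + _ = _]addrACA.
Qed.

Lemma equivariantM B C : equivariant B -> equivariant C -> equivariant (B * C).
Proof.
move=> HB HC X c d; rewrite !mxE mulr_sumr.
transitivity (\sum_e (B c e * C e d * env_gen X
    + (\sum_a vsval X a c *: (B a e * C e d) - \sum_b vsval X d b *: (B c e * C e b))
    + (\sum_a vsval X a e *: (B c e * C a d) - \sum_b vsval X e b *: (B c b * C e d)))).
  apply: eq_bigr => e _.
  rewrite mulrA HB mulrBl mulrDl -[B c e * env_gen X * _]mulrA HC.
  rewrite mulrBr mulrDr mulrA !mulr_suml !mulr_sumr.
  under eq_bigr do rewrite -env_scalerAr.
  under [X in _ - X + _ - _]eq_bigr do rewrite -env_scalerAr.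
  under [X in _ + X - _ = _]eq_bigr do rewrite -qring_scalerAl.
  under [X in _ - X = _]eq_bigr do rewrite -qring_scalerAl.
  rewrite -!addrA; congr (_ + _).
  rewrite addrC -!addrA addrC -!addrA; congr (_ + _).
  by rewrite addrC -!addrA addrCA; congr (_ + (_ + _)).
rewrite !big_split /= !sumrN mulr_suml -!addrA; congr (_ + _).
under [X in _ = X + _]eq_bigr do rewrite mxE scaler_sumr.
under [X in _ = _ - X]eq_bigr do rewrite mxE scaler_sumr.
rewrite exchange_big /= [X in - X]exchange_big /=.
congr (_ + _); rewrite [X in X - _]exchange_big /=.
by rewrite subrr addr0.
Qed.

Lemma equivariantX B r : equivariant B -> equivariant (B ^+ r).
Proof.
move=> HB; elim: r => [|r IH]; last by rewrite exprSr; apply: equivariantM.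
rewrite expr0 -[1]/(1%:M) -[X in X%:M]scale1r; exact: equivariant_scalar.
Qed.

Lemma equivariant_Fseries h r : equivariant (Fseries G m h r).
Proof.
case: r => [|r]; last first.
  by apply/equivariantX/equivariantB; [apply: equivariant_FU|apply: equivariant_scalar].
move=> X c d; rewrite !mxE mulr0 mul0r.
by rewrite !big1 ?addr0 ?subr0 // => a _; rewrite mxE scaler0.
Qed.
End Equivariance.

Section InvariantSum.
Variables (K : fieldType) (N : nat) (T V P : lmodType K) (tn : V -> P -> T).
Hypotheses (tnl : forall g, linear (tn^~ g)) (tnr : forall v, linear (tn v)).
Variables (A : 'I_N -> 'I_N -> V -> V) (p q : 'I_N -> P -> P).
Variables (X : 'M[K]_N) (x : V -> V) (z : P -> P) (tt : T -> T).
Hypotheses (pL : forall c, linear (p c)) (ttL : linear tt).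
Hypothesis tt_tn : forall v g, tt (tn v g) = tn (x v) g + tn v (z g).
Hypothesis xA : forall c d v, x (A c d v) =
  A c d (x v) + \sum_a X a c *: A a d v - \sum_b X d b *: A c b v.
Hypothesis zp : forall c g, z (p c g) = p c (z g) - \sum_b X c b *: p b g.
Hypothesis zq : forall d g, z (q d g) = q d (z g) + \sum_a X a d *: q a g.

(** The rows of A are dual to p and its columns to q, so contracting A with
    p and q commutes with the diagonal action. *)
Lemma invariant_sum v g :
  tt (\sum_c \sum_d tn (A c d v) (p c (q d g))) =
  \sum_c \sum_d tn (A c d (x v)) (p c (q d g))
  + \sum_c \sum_d tn (A c d v) (p c (q d (z g))).
Proof.
pose T4 a b c d := tn (A a b v) (p c (q d g)).
transitivity (\sum_c \sum_d
   ((tn (A c d (x v)) (p c (q d g)) + tn (A c d v) (p c (q d (z g))))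
    + ((\sum_a X a c *: T4 a d c d - \sum_b X c b *: T4 c d b d)
    + (\sum_a X a d *: T4 c d c a - \sum_b X d b *: T4 c b c d)))).
  rewrite (lin_sum _ _ _ ttL); apply: eq_bigr => c _.
  rewrite (lin_sum _ _ _ ttL); apply: eq_bigr => d _.
  rewrite tt_tn xA zp zq (linD _ _ (pL c)) (lin_sum _ _ _ (pL c)).
  under [X in _ + tn _ (_ + X - _)]eq_bigr do rewrite (linZ _ _ (pL c)).
  have L := tnl (p c (q d g)).
  rewrite (linB _ _ L) (linD _ _ L) !(lin_sum _ _ _ L).
  under [X in _ + X - _ + _]eq_bigr do rewrite (linZ _ _ L).
  under [X in _ - X + _]eq_bigr do rewrite (linZ _ _ L).
  have M := tnr (A c d v).
  rewrite (linB _ _ M) (linD _ _ M) !(lin_sum _ _ _ M).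
  under [X in _ + (_ + X - _)]eq_bigr do rewrite (linZ _ _ M).
  under [X in _ + (_ + _ - X)]eq_bigr do rewrite (linZ _ _ M).
  rewrite /T4 -!addrA; congr (_ + _).
  rewrite [X in _ + X = _]addrCA [LHS]addrCA; congr (_ + (_ + _)).
  by rewrite addrC [X in X + _ = _]addrC -addrA.
transitivity (\sum_c \sum_d
   (tn (A c d (x v)) (p c (q d g)) + tn (A c d v) (p c (q d (z g))))
   + ((\sum_c \sum_d \sum_a X a c *: T4 a d c d
       - \sum_c \sum_d \sum_b X c b *: T4 c d b d)
    + (\sum_c \sum_d \sum_a X a d *: T4 c d c a
       - \sum_c \sum_d \sum_b X d b *: T4 c b c d))).
  rewrite -!sumrB -!big_split; apply: eq_bigr => c _.
  by rewrite -!sumrB -!big_split.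
have -> : \sum_c \sum_d \sum_a X a c *: T4 a d c d
        = \sum_c \sum_d \sum_b X c b *: T4 c d b d.
  rewrite exchange_big [RHS]exchange_big; apply: eq_bigr => d _.
  by rewrite exchange_big.
have -> : \sum_c \sum_d \sum_a X a d *: T4 c d c a
        = \sum_c \sum_d \sum_b X d b *: T4 c b c d.
  by apply: eq_bigr => c _; rewrite exchange_big.
rewrite !subrr !addr0 -big_split; apply: eq_bigr => c _; exact: big_split.
Qed.
End InvariantSum.

Lemma add_shuffle (V : zmodType) (a b c d e f : V) :
  a + b + c + (d + (e + f)) = b + d + (c + e) + (a + f).
Proof.
rewrite -!addrA [LHS]addrCA; congr (_ + _).
rewrite [X in _ + X = _]addrCA [LHS]addrCA; congr (_ + _).
by rewrite [LHS]addrCA; congr (_ + _); rewrite [LHS]addrCA.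
Qed.

Section TotalAction.
Variables (K : fieldType) (G : classical_group) (n m : nat).
Hypothesis n_even : G = Symplectic -> ~~ odd n.
Hypothesis two_neq0 : 2%:R != 0 :> K.
Local Notation fm := (fm K G m).
Variable V : env_module fm.
Local Notation pop := (@pop K G m n).
Local Notation qop := (@qop K G m n).
Local Notation zetaX := (@zetaX K G n m).
Local Notation Fm := (@Fm K G m n V).

(** Extends the action of the F_ab by Fm_lie to all of f_m. *)
Definition diag_act (X : subvs_of fm) (t : Fm) : Fm :=
  tmap (env_act (env_gen X)) idfun t + tmap idfun (zetaX (vsval X)) t.

Lemma diag_act_linear X : linear (diag_act X).
Proof.
apply: linear_addf; apply: tmap_is_linear => //; first exact: env_act_linear.
exact: zetaX_linear.
Qed.

Lemma diag_act_tens X v g :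
  diag_act X (tens v g) = tens (env_act (env_gen X) v) g + tens v (zetaX (vsval X) g).
Proof.
rewrite /diag_act !tmap_tens //; [exact: zetaX_linear|exact: env_act_linear].
Qed.

Lemma Fm_lieE a b : @Fm_lie K G m n V a b = diag_act (Fel K G a b).
Proof.
have E : zetaX (vsval (Fel K G a b)) = @zeta K G m n a b.
  by apply/funext => g; rewrite FelE zetaX_Fmx.
by apply/funext => t; rewrite /diag_act E.
Qed.

Lemma Fm_S_tens r i j v g : @Fm_S K G m n V r i j (tens v g) =
  ((r == 0%N) && (i == j))%:R *: tens v g + \sum_c \sum_d
    tens (env_act (Fseries G m (pm K G / 2%:R + m%:R) r c d) v)
         (pop c i (qop d j g)).
Proof.
congr (_ + _); apply: eq_bigr => c _; apply: eq_bigr => d _.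
rewrite tmap_tens //; first exact: env_act_linear.
by apply: linear_comp; [apply: pop_linear|apply: qop_linear].
Qed.

Lemma Fm_S_linear r i j : linear (@Fm_S K G m n V r i j).
Proof.
apply: linear_addf; first exact: linear_scale.
apply: linear_sumf => c; apply: linear_sumf => d; apply: tmap_is_linear.
  exact: env_act_linear.
by apply: linear_comp; [apply: pop_linear|apply: qop_linear].
Qed.

Lemma actB u u' (v : V) : env_act (u - u') v = env_act u v - env_act u' v.
Proof. exact: (linB _ _ (env_act_linearl v)). Qed.

(** The powers of F - h are equivariant, so their contraction with p and q
    commutes with f_m; this makes X(g_n) act on the coinvariants. *)
Lemma diag_act_Fm_S X r i j t :
  diag_act X (Fm_S r i j t) = @Fm_S K G m n V r i j (diag_act X t).
Proof.
move: t; apply: eq_tensor.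
- by apply: linear_comp; [apply: diag_act_linear|apply: Fm_S_linear].
- by apply: linear_comp; [apply: Fm_S_linear|apply: diag_act_linear].
move=> v g.
have E : Fm_S r i j (diag_act X (tens v g)) = _ :=
  etrans (congr1 _ (diag_act_tens X v g)) (etrans (linD _ _ (@Fm_S_linear r i j))
    (congr2 +%R (Fm_S_tens r i j _ _) (Fm_S_tens r i j _ _))).
apply: etrans (esym E).
apply: etrans (congr1 _ (Fm_S_tens r i j v g)) _.
apply: etrans (linD _ _ (diag_act_linear X)) _.
apply: etrans (esym (addrACA _ _ _ _)); congr (_ + _).
  apply: etrans (linZ _ _ (diag_act_linear X)) _.
  by apply: etrans (congr1 _ (diag_act_tens X v g)) _; rewrite scalerDr.
apply: (@invariant_sum K (m + m) Fm V _ (@tens K _ _) _ _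
  (fun c d => env_act (Fseries G m (pm K G / 2%:R + m%:R) r c d))
  (pop^~ i) (qop^~ j) (vsval X) (env_act (env_gen X)) (zetaX (vsval X)) (diag_act X)).
- exact: tens_linearl.
- exact: tens_linearr.
- by move=> c; apply: pop_linear.
- exact: diag_act_linear.
- exact: diag_act_tens.
- move=> c d w; rewrite -!env_actM (equivariant_Fseries two_neq0).
  rewrite actB (linD _ _ (env_act_linearl w)) !(lin_sum _ _ _ (env_act_linearl w)).
  by congr (_ + _ - _); apply: eq_bigr => a _; rewrite (linZ _ _ (env_act_linearl w)).
- by move=> c f; apply: zetaX_pop => //; apply: antifixed_val.
- by move=> c f; apply: zetaX_qop => //; apply: antifixed_val.
Qed.

Lemma diag_act_comm X Y t : diag_act X (diag_act Y t) = diag_act Y (diag_act X t) + diag_act (bracket X Y) t.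
Proof.
move: t; apply: eq_tensor.
- by apply: linear_comp; apply: diag_act_linear.
- apply: linear_addf; last exact: diag_act_linear.
  by apply: linear_comp; apply: diag_act_linear.
move=> v g.
have E Z W : diag_act Z (diag_act W (tens v g)) = _ :=
  etrans (congr1 _ (diag_act_tens W v g)) (etrans (linD _ _ (diag_act_linear Z))
    (congr2 +%R (diag_act_tens Z _ _) (diag_act_tens Z _ _))).
apply: etrans (E X Y) _; apply: etrans (esym (congr2 +%R (E Y X) (diag_act_tens _ _ _))).
have Ev : env_act (env_gen X) (env_act (env_gen Y) v) =
    env_act (env_gen (bracket X Y)) v + env_act (env_gen Y) (env_act (env_gen X) v).
  rewrite -!env_actM; apply: etrans (linD _ _ (env_act_linearl v)).
  congr (env_act _ v); apply/eqP; rewrite -subr_eq; apply/eqP.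
  exact: env_gen_bracket (bracketE two_neq0 X Y).
rewrite Ev (bracketE two_neq0) (zetaX_comm n_even two_neq0 _ _ (antifixed_val two_neq0 X)).
rewrite (linD _ _ (tens_linearl g)) (linD _ _ (tens_linearr v)).
exact: add_shuffle.
Qed.

Lemma diag_act_linearl t : linear (diag_act^~ t).
Proof.
move=> c X Y; move: t; apply: eq_tensor.
- exact: diag_act_linear.
- apply: linear_addf; last exact: diag_act_linear.
  by apply: linear_scalef; apply: diag_act_linear.
move=> v g; apply: etrans (diag_act_tens _ v g) _.
apply: etrans (esym (congr2 (fun x y => c *: x + y) (diag_act_tens X v g) (diag_act_tens Y v g))).
rewrite (env_gen_linear c X Y) (env_act_linearl v) linearP (zetaX_linearl _ g).
apply: etrans (congr2 +%R (tens_linearl g _ _ _) (tens_linearr v _ _ _)) _.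
by rewrite scalerDr; apply: addrACA.
Qed.

Lemma bracket_diag (a b c : 'I_(m + m)) :
  bracket (Fel K G c c) (Fel K G a b) =
  (Fmx K G c c a a - Fmx K G c c b b) *: Fel K G a b.
Proof.
have off i j : i != j -> Fmx K G c c i j = 0.
  move=> ij; rewrite !mxE.
  have N k : (i == k) && (j == k) = false.
    by apply/andP => -[/eqP ik /eqP jk]; rewrite ik jk eqxx in ij.
  by rewrite !N mulr0 subr0.
apply: subvs_inj; rewrite (bracketE two_neq0) !FelE comm_Fmx; last exact: antifixed_Fmx.
rewrite (sum_pick (i := a)); last by move=> i ia; rewrite off // scale0r.
rewrite (sum_pick (i := b)); last by move=> i ib; rewrite off ?scale0r // eq_sym.
by rewrite -scalerBl linearZ /= FelE.
Qed.

Lemma coinv_Fm_S r i j t : coinv_rel t ->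
  lspan (@coinv_rel K G m n V) (Fm_S r i j t).
Proof.
case=> a b {}t ab; rewrite Fm_lieE -diag_act_Fm_S -Fm_lieE.
by apply: lspan_in; apply: coinv_rel_lie.
Qed.

(* Each F_ab is a weight vector, so the Cartan elements preserve n F(V). *)
Lemma coinv_Hop c t : coinv_rel t ->
  lspan (@coinv_rel K G m n V) (Fm_lie c c t).
Proof.
case=> a b {}t ab; rewrite !Fm_lieE diag_act_comm bracket_diag.
rewrite (linZ _ _ (diag_act_linearl t)) -Fm_lieE.
by apply: lspanD; [|apply: lspanZ]; apply: lspan_in; apply: coinv_rel_lie.
Qed.

Lemma Fm_lie_linear a b : linear (@Fm_lie K G m n V a b).
Proof. rewrite Fm_lieE; exact: diag_act_linear. Qed.

Local Notation Q := (quotient (@coinv_rel K G m n V)).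
Local Notation pi := (qproj (@coinv_rel K G m n V)).

Lemma Sop_coinvariants r i j t :
  @Sop _ _ _ (coinvariants n V) r i j (pi t) = pi (Fm_S r i j t).
Proof. by apply: qmapE; [apply: Fm_S_linear|apply: coinv_Fm_S]. Qed.

Lemma Hop_coinvariants a t : @Hop _ _ _ (coinvariants n V) a (pi t) =
  pi (Fm_lie (rshift m a) (rshift m a) t).
Proof. by apply: qmapE; [apply: Fm_lie_linear|apply: coinv_Hop]. Qed.

End TotalAction.

(** * Reduction of words to a highest weight vector *)

(** L is a Lie algebra split by the projection lo into two subalgebras, the range
    n and the kernel b of lo; mu is a character of b, extended by 0 to n, and L
    acts on P by z. If v0 generates the module M and b acts on it by mu, the
    n-coinvariants of M (x) P are spanned by the classes of v0 (x) g. Reducing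
    the words in L accordingly gives a map to P that is defined on all words and
    respects the relations of the enveloping algebra. *)

Section WordFunctional.
Variables (K : fieldType) (L P : lmodType K).
Variables (br : L -> L -> L) (lo : L -> L) (mu : L -> K^o) (z : L -> P -> P).
Hypotheses (brl : forall Y, linear (br^~ Y)) (brr : forall X, linear (br X)).
Hypothesis brC : forall X Y, br X Y = - br Y X.
Hypothesis jacobi : forall X Y Z, br X (br Y Z) = br (br X Y) Z + br Y (br X Z).
Hypotheses (loL : linear lo) (lo_id : forall X, lo (lo X) = lo X).
Hypothesis br_lo : forall X Y, lo (br (lo X) (lo Y)) = br (lo X) (lo Y).
Hypothesis br_hi : forall X Y, lo X = 0 -> lo Y = 0 -> lo (br X Y) = 0.
Hypotheses (muL : linear mu) (mu_lo : forall X, mu (lo X) = 0).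
Hypothesis mu_br : forall X Y, lo X = 0 -> lo Y = 0 -> mu (br X Y) = 0.
Hypotheses (zl : forall g, linear (z^~ g)) (zr : forall X, linear (z X)).
Hypothesis z_br : forall X Y g, z X (z Y g) = z Y (z X g) + z (br X Y) g.

Section Derivation.
Variable U : lmodType K.
Implicit Types (f : seq L -> U) (u v w s : seq L).

(** The value of f on the image of a word under the derivation ad Y. *)
Fixpoint dsum f (Y : L) w : U :=
  if w is a :: w' then f (br Y a :: w') + dsum (fun s => f (a :: s)) Y w' else 0.

Definition multilinear f := forall u v c A B,
  f (u ++ (c *: A + B) :: v) = c *: f (u ++ A :: v) + f (u ++ B :: v).

Lemma eq_dsum f f' Y w :
  (forall s, size s = size w -> f s = f' s) -> dsum f Y w = dsum f' Y w.
Proof.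
elim: w f f' => //= a w IH f f' ff'; rewrite ff' //; congr (_ + _).
by apply: IH => s sw; apply: ff'; rewrite /= sw.
Qed.

Lemma dsum_cat f Y u v : dsum f Y (u ++ v) =
  dsum (fun s => f (s ++ v)) Y u + dsum (fun s => f (u ++ s)) Y v.
Proof. by elim: u f => [|a u IH] f /=; rewrite ?add0r // IH addrA. Qed.

Lemma dsumD f f' Y w : dsum (fun s => f s + f' s) Y w = dsum f Y w + dsum f' Y w.
Proof. by elim: w f f' => [|a w IH] f f' /=; rewrite ?addr0 // IH addrACA. Qed.

Lemma dsumZ c f Y w : dsum (fun s => c *: f s) Y w = c *: dsum f Y w.
Proof. by elim: w f => [|a w IH] f /=; rewrite ?scaler0 // IH scalerDr. Qed.

Lemma dsumN f Y w : dsum (fun s => - f s) Y w = - dsum f Y w.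
Proof.
rewrite -scaleN1r -dsumZ; apply: eq_dsum => s _; by rewrite scaleN1r.
Qed.

Lemma multilinear_cons f a : multilinear f -> multilinear (fun s => f (a :: s)).
Proof. by move=> fM u v c A B; apply: (fM (a :: u)). Qed.

Lemma multilinear_head f c A B w : multilinear f ->
  f ((c *: A + B) :: w) = c *: f (A :: w) + f (B :: w).
Proof. by move=> fM; apply: (fM [::]). Qed.

Lemma multilinear_dsum f Y : multilinear f -> multilinear (dsum f Y).
Proof.
move=> fM u v c A B; rewrite !dsum_cat /= scalerDr addrACA; congr (_ + _).
  by rewrite -dsumZ -dsumD; apply: eq_dsum => s _; apply: fM.
rewrite brr fM scalerDr addrACA; congr (_ + _).
by rewrite -dsumZ -dsumD; apply: eq_dsum => s _; apply: fM.
Qed.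

Lemma dsum_linearl f w : multilinear f -> linear (fun Y => dsum f Y w).
Proof.
elim: w f => [|a w IH] f fM c Y Y' /=; first by rewrite scaler0 addr0.
rewrite brl multilinear_head // scalerDr addrACA; congr (_ + _).
exact/IH/multilinear_cons.
Qed.

(** The derivations ad X and ad Y commute up to ad of the bracket; on functionals
    their order is reversed. *)
Lemma dsum_comm f X Y w : multilinear f ->
  dsum (dsum f Y) X w = dsum (dsum f X) Y w + dsum f (br Y X) w.
Proof.
elim: w f => [|a w IH] f fM /=; first by rewrite addr0.
have E : f (br Y (br X a) :: w) =
    f (br (br Y X) a :: w) + f (br X (br Y a) :: w).
  by rewrite jacobi -[X in f ((X + _) :: w)]scale1r multilinear_head // scale1r.
rewrite E !dsumD (IH _ (multilinear_cons a fM)); exact: add_shuffle.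
Qed.

(** Compatibility with the relations of the enveloping algebra, for the sake
    of an induction restricted to those with a short left factor. *)
Definition lie_compatible n f := forall u v A B, (size u <= n)%N ->
  f (u ++ [:: A, B & v]) = f (u ++ [:: B, A & v]) + f (u ++ br A B :: v).

Lemma lie_compatible_dsum n f Y : multilinear f ->
  lie_compatible n f -> lie_compatible n (dsum f Y).
Proof.
move=> fM fR u v A B un; rewrite !dsum_cat /=.
have E1 : dsum (fun s => f (s ++ [:: A, B & v])) Y u =
    dsum (fun s => f (s ++ [:: B, A & v])) Y u
    + dsum (fun s => f (s ++ br A B :: v)) Y u.
  by rewrite -dsumD; apply: eq_dsum => s su; apply: fR; rewrite su.
have E2 : dsum (fun s => f (u ++ [:: A, B & s])) Y v =
    dsum (fun s => f (u ++ [:: B, A & s])) Y v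
    + dsum (fun s => f (u ++ br A B :: s)) Y v.
  by rewrite -dsumD; apply: eq_dsum => s _; apply: fR.
rewrite E1 E2 (fR u v (br Y A) B) // (fR u v A (br Y B)) //.
have -> : f (u ++ br Y (br A B) :: v) =
    f (u ++ br (br Y A) B :: v) + f (u ++ br A (br Y B) :: v).
  by rewrite jacobi -[X in f (u ++ (X + _) :: v)]scale1r fM scale1r.
by rewrite [LHS](AC (2*(2*(2*2))) ((1*(5*(3*7)))*(2*((4*6)*8)))).
Qed.
End Derivation.

(* On words longer than k the value is 0, which keeps word_rec k multilinear. *)
Fixpoint word_rec k (w : seq L) (g : P) : P :=
  match w, k with
  | [::], _ => g
  | Z :: w', k'.+1 => - word_rec k' w' (z (lo Z) g) + mu Z *: word_rec k' w' g
                      + dsum (fun s => word_rec k' s g) (Z - lo Z) w'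
  | _, 0%N => 0
  end.

(** The functional attached to the decomposition of L into the range and the
    kernel of lo: a leading letter in the range acts on P through - z, one in
    the kernel is moved to the right end of the word, where it acts by mu. *)
Definition word_act : seq L -> P -> P := locked (fun w => word_rec (size w) w).

Lemma word_actE w : word_act w = word_rec (size w) w.
Proof. by rewrite /word_act -lock. Qed.

Lemma word_act_nil g : word_act [::] g = g.
Proof. by rewrite word_actE. Qed.

Lemma word_rec_size k w : (size w <= k)%N -> word_rec k w = word_act w.
Proof.
have stable : forall j v, (size v <= j)%N -> word_rec j.+1 v = word_rec j v.
  elim=> [|j IH] [|Z v] //= sv; apply/funext => g; rewrite -!IH //.
  by congr (_ + _); apply: eq_dsum => s sv'; rewrite -IH // sv'.
rewrite word_actE => /subnK <-; elim: (k - size w)%N => // d IH.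
by rewrite addSn stable ?leq_addl.
Qed.

Lemma word_act_cons Z w g : word_act (Z :: w) g =
  - word_act w (z (lo Z) g) + mu Z *: word_act w g
  + dsum (word_act^~ g) (Z - lo Z) w.
Proof.
rewrite word_actE /= -word_actE; congr (_ + _); apply: eq_dsum => s sw.
by rewrite word_rec_size ?sw.
Qed.

Lemma word_rec_linear k w : linear (word_rec k w).
Proof.
move: w; elim: k => [|k IH] [|Z v] c g g' //=; first by rewrite scaler0 addr0.
  rewrite zr !IH.
  have -> : dsum (word_rec k ^~ (c *: g + g')) (Z - lo Z) v =
      c *: dsum (word_rec k ^~ g) (Z - lo Z) v + dsum (word_rec k ^~ g') (Z - lo Z) v.
    by rewrite -dsumZ -dsumD; apply: eq_dsum => s _; apply: IH.
  rewrite !scalerDr opprD scalerN [mu Z *: (c *: _)]scalerA mulrC -scalerA.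
  by rewrite [LHS](AC ((2*2)*2) ((1*3*5)*(2*4*6))).
Qed.

Lemma word_act_linear w : linear (word_act w).
Proof. by rewrite word_actE; apply: word_rec_linear. Qed.

Lemma word_act_multilinear g : multilinear (word_act^~ g).
Proof.
have recM k : forall g, multilinear (word_rec k ^~ g).
  elim: k => [|k IH] {}g [|Z u] v c A B /=; rewrite ?scaler0 ?addr0 //.
    rewrite loL zl (word_rec_linear k v) muL.
    have -> : c *: A + B - (c *: lo A + lo B) = c *: (A - lo A) + (B - lo B).
      by rewrite scalerBr opprD addrACA.
    rewrite (dsum_linearl _ (IH g)) scalerDl !scalerDr opprD scalerN -scalerA.
    by rewrite [LHS](AC ((2*2)*2) ((1*3*5)*(2*4*6))).
  rewrite !IH.
  rewrite (multilinear_dsum _ (IH g)) !scalerDr opprD scalerN.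
  rewrite [mu Z *: (c *: _)]scalerA mulrC -scalerA.
  by rewrite [LHS](AC ((2*2)*2) ((1*3*5)*(2*4*6))).
move=> u v c A B /=.
have E X : word_act (u ++ X :: v) = word_rec (size u + (size v).+1) (u ++ X :: v).
  by rewrite word_rec_size // size_cat.
by rewrite !E; apply: recM.
Qed.

(** A letter of the Borel subalgebra at the right end acts by mu. *)
Lemma word_act_rcons w Y g : lo Y = 0 ->
  word_act (rcons w Y) g = mu Y *: word_act w g.
Proof.
elim: {w}(size w) {-2}w (leqnn (size w)) Y g => [|k IH] [|Z w] //= sw Y g Y0.
- by rewrite word_act_cons Y0 (lin0 (zl _)) !word_act_nil oppr0 addr0 add0r.
- by rewrite word_act_cons Y0 (lin0 (zl _)) !word_act_nil oppr0 addr0 add0r.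
rewrite !word_act_cons !IH // -cats1 dsum_cat /= addr0.
have hi0 X : lo (X - lo X) = 0 by rewrite (linB _ _ loL) lo_id subrr.
have -> : dsum (fun s => word_act (s ++ [:: Y]) g) (Z - lo Z) w =
    mu Y *: dsum (word_act^~ g) (Z - lo Z) w.
  by rewrite -dsumZ; apply: eq_dsum => s ss; rewrite cats1 IH ?ss.
rewrite cats1 IH ?br_hi // mu_br // scale0r addr0.
by rewrite !scalerDr scalerN; congr (_ + _ + _); rewrite !scalerA mulrC.
Qed.

Lemma lo_hi X : lo (X - lo X) = 0.
Proof. by rewrite (linB _ _ loL) lo_id subrr. Qed.

Lemma word_act_lo X w g : lo X = X -> word_act (X :: w) g = - word_act w (z X g).
Proof.
move=> XE; have mu0 : mu X = 0 by rewrite -XE mu_lo.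
rewrite word_act_cons XE mu0 scale0r addr0 subrr.
by rewrite (lin0 (dsum_linearl _ (word_act_multilinear g))) addr0.
Qed.

Lemma word_act_hi Y w g : lo Y = 0 ->
  word_act (Y :: w) g = mu Y *: word_act w g + dsum (word_act^~ g) Y w.
Proof.
move=> Y0; rewrite word_act_cons Y0 (lin0 (zl g)).
by rewrite (lin0 (word_act_linear w)) oppr0 add0r subr0.
Qed.

(** By bilinearity and antisymmetry A and B may be taken in n or in b. Two letters
    of n are the representation property of z, two letters of b combine the
    Jacobi identity with the fact that mu is a character, and in the mixed case
    the bracket is what moving the letter of b to the right produces. *)
Lemma word_act_head A B v g :
  word_act [:: A, B & v] g = word_act [:: B, A & v] g + word_act (br A B :: v) g.
Proof.
have actM := word_act_multilinear.
pose D X Y := word_act [:: X, Y & v] g - word_act [:: Y, X & v] g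
   - word_act (br X Y :: v) g.
suff D0 : D A B = 0.
  by move/eqP: D0; rewrite /D subr_eq0 subr_eq addrC => /eqP.
have DDl X X' Y : D (X + X') Y = D X Y + D X' Y.
  rewrite /D (linD _ _ (brl Y)) -[X in X + X']scale1r -[br X Y]scale1r.
  rewrite (actM g [::] [:: Y & v]) (actM g [:: Y] v) (actM g [::] v) !scale1r.
  by rewrite !opprD [LHS](AC ((2*2)*2) ((1*3*5)*(2*4*6))).
have DC X Y : D Y X = - D X Y.
  have headL : linear (fun Z => word_act (Z :: v) g).
    by move=> c Z Z'; apply: (actM g [::] v).
  have headN : word_act (- br X Y :: v) g = - word_act (br X Y :: v) g := linN _ headL.
  rewrite /D (brC Y X) headN !opprD !opprK.
  by congr (_ + _); apply: addrC.
have lolo X Y : lo X = X -> lo Y = Y -> D X Y = 0.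
  move=> XE YE; have BE : lo (br X Y) = br X Y by have := br_lo X Y; rewrite XE YE.
  rewrite /D !word_act_lo // !opprK (z_br X Y) (linD _ _ (word_act_linear _)).
  by rewrite opprD addrA subrr add0r addNr.
have hilo X Y : lo X = 0 -> lo Y = Y -> D X Y = 0.
  move=> X0 YE.
  rewrite /D word_act_hi // word_act_lo // [word_act [:: Y, _ & _] _]word_act_lo //.
  rewrite word_act_hi //= opprK scalerN.
  have -> : dsum (fun s => word_act (Y :: s) g) X v =
      - dsum (word_act ^~ (z Y g)) X v.
    by rewrite -dsumN; apply: eq_dsum => s _; rewrite word_act_lo.
  rewrite [LHS](AC (1*2*2*1) ((1*4)*(2*6)*(3*5))) /=.
  by rewrite addNr subrr addNr !addr0.
have hihi X Y : lo X = 0 -> lo Y = 0 -> D X Y = 0.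
  move=> X0 Y0; have E Z W : lo Z = 0 -> lo W = 0 -> word_act [:: Z, W & v] g =
      mu Z *: (mu W *: word_act v g + dsum (word_act^~ g) W v)
      + (word_act (br Z W :: v) g + (mu W *: dsum (word_act^~ g) Z v
         + dsum (dsum (word_act^~ g) W) Z v)).
    move=> Z0 W0; rewrite word_act_hi // word_act_hi //=; congr (_ + (_ + _)).
    rewrite -dsumZ -dsumD; apply: eq_dsum => s _; exact: word_act_hi.
  have E1 : word_act (br Y X :: v) g = dsum (word_act^~ g) (br Y X) v.
    by rewrite word_act_hi ?br_hi // mu_br // scale0r add0r.
  rewrite /D !E // E1 (dsum_comm X Y v (actM g)) !scalerDr !scalerA [mu Y * _]mulrC.
  rewrite !opprD [LHS](AC (2*(1*(1*2))*(2*(1*(1*1)))*1) 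
     ((1*7)*(2*10)*(3*12)*(4*8)*(5*11)*(6*9))) /=.
  by rewrite !subrr !addr0.
have loD X Y : lo X = X -> D X Y = 0.
  move=> XE; rewrite -[Y](subrK (lo Y)) DC DDl.
  by rewrite hilo ?lo_hi // lolo ?lo_id // addr0 oppr0.
rewrite -[A](subrK (lo A)) DDl [X in _ + X]loD ?lo_id // addr0.
rewrite -[B](subrK (lo B)) DC DDl [X in _ + X]loD ?lo_id // addr0.
by rewrite hihi ?lo_hi // oppr0.
Qed.

(** A letter before the relation is removed by the recursion, whose three terms
    respect the relation by induction. *)
Lemma word_act_compatible n g : lie_compatible n (word_act^~ g).
Proof.
elim: n g => [|n IH] g [|Z u] v A B //=; try by rewrite word_act_head.
rewrite ltnS => un; rewrite !word_act_cons 2!(IH _ u v A B un) scalerDr.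
rewrite (lie_compatible_dsum _ (word_act_multilinear g) (IH g)) // opprD.
by rewrite [LHS](AC ((2*2)*2) ((1*3*5)*(2*4*6))).
Qed.

Section Coinvariants.
Variables (M Q : lmodType K) (act : L -> M -> M) (v0 : M) (pt : M -> P -> Q).
Hypotheses (actl : forall v, linear (act^~ v)) (actr : forall X, linear (act X)).
Hypothesis act_br : forall X Y v, act X (act Y v) = act Y (act X v) + act (br X Y) v.
Hypothesis act_v0 : forall Y, lo Y = 0 -> act Y v0 = mu Y *: v0.
Hypotheses (ptl : forall g, linear (pt^~ g)) (ptr : forall v, linear (pt v)).
Hypothesis pt_lo : forall X v g, lo X = X -> pt (act X v) g = - pt v (z X g).

Definition word_vec (w : seq L) : M := foldr act v0 w.

Lemma act_word_vec Y w :
  act Y (word_vec w) = dsum word_vec Y w + foldr act (act Y v0) w.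
Proof.
elim: w => [|a w IH] /=; first by rewrite add0r.
rewrite act_br IH (linD _ _ (actr a)) addrC -addrA; congr (_ + (_ + _)).
elim: w {IH} (word_vec) => [|b w IH] f /=; first exact: lin0.
by rewrite (linD _ _ (actr a)) (IH (fun s => f (b :: s))).
Qed.

(** The map pt identifies the n-coinvariants; the recursion for [word_act] is
    the one satisfied by the classes of the vectors of words. *)
Lemma pt_word_vec w g : pt (word_vec w) g = pt v0 (word_act w g).
Proof.
elim: {w}(size w) {-2}w (leqnn (size w)) g => [|k IH] [|Z w] //= sw g;
  try by rewrite word_act_nil.
have -> : act Z (word_vec w) = act (lo Z) (word_vec w) + act (Z - lo Z) (word_vec w).
  by rewrite -(linD _ _ (actl _)) addrC subrK.
rewrite (linD _ _ (ptl g)) (pt_lo _ _ (lo_id Z)) act_word_vec (act_v0 (lo_hi Z)).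
have -> : foldr act (mu (Z - lo Z) *: v0) w = mu Z *: word_vec w.
  rewrite (linB _ _ muL) mu_lo subr0 /word_vec.
  by elim: (w) => //= a u ->; rewrite (linZ _ _ (actr a)).
rewrite (linD _ _ (ptl g)) (linZ _ _ (ptl g)) !IH // word_act_cons.
rewrite !(linD _ _ (ptr v0)) (linN _ (ptr v0)) (linZ _ _ (ptr v0)) -addrA.
congr (_ + _); rewrite addrC; congr (_ + _).
have E : forall f (f' : seq L -> P) u, (forall s, size s = size u ->
    pt (f s) g = pt v0 (f' s)) -> pt (dsum f (Z - lo Z) u) g = pt v0 (dsum f' (Z - lo Z) u).
  move=> f f' u; elim: u f f' => [|a u IHu] f f' ff' /=.
    by rewrite (lin0 (ptl g)) (lin0 (ptr v0)).
  rewrite (linD _ _ (ptl g)) (linD _ _ (ptr v0)) ff' //; congr (_ + _).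
  by apply: IHu => s su; apply: ff'; rewrite /= su.
by apply: E => s su; rewrite IH ?su.
Qed.
End Coinvariants.

End WordFunctional.

(** * The triangular decomposition of f_m *)

Section Triangular.
Variables (K : fieldType) (G : classical_group) (m : nat).
Hypothesis two_neq0 : 2%:R != 0 :> K.
Local Notation fm := (fm K G m).
Local Notation L := (subvs_of fm).
Local Notation M := 'M[K]_(m + m).

Definition mask (r : rel 'I_(m + m)) (A : M) : M :=
  \matrix_(a, b) (if r a b then A a b else 0).

Lemma mask_linear r : linear (mask r).
Proof.
move=> c A B; apply/matrixP=> a b; rewrite !mxE.
by case: ifP => _; rewrite ?mulr0 ?addr0.
Qed.

Definition rev_stable (r : rel 'I_(m + m)) :=
  forall a b, r (rev_ord b) (rev_ord a) = r a b.

Lemma antifixed_mask r A : rev_stable r -> antifixed G A -> antifixed G (mask r A).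
Proof.
move=> rs As a b; rewrite !mxE rs; case: ifP => _; last by rewrite mulr0.
exact: As.
Qed.

Lemma rev_ltn (a b : 'I_(m + m)) : (rev_ord b < rev_ord a)%N = (a < b)%N.
Proof. by rewrite /= ltn_sub2lE ?ltnS. Qed.

Definition gto : rel 'I_(m + m) := fun a b => (b < a)%N.
Definition lto : rel 'I_(m + m) := fun a b => (a < b)%N.

Lemma rev_stable_gto : rev_stable gto.
Proof. by move=> a b; apply: rev_ltn. Qed.

Lemma rev_stable_lto : rev_stable lto.
Proof. by move=> a b; apply: rev_ltn. Qed.

Lemma rev_stable_eq : rev_stable (fun a b => a == b).
Proof. by move=> a b; rewrite (inj_eq rev_ord_inj) eq_sym. Qed.

Lemma mask_lto_nprime A : antifixed G A -> mask lto A \in nprime K G m.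
Proof.
move=> As; rewrite (antifixed_sum two_neq0 (antifixed_mask rev_stable_lto As)).
rewrite memvZ // rpred_sum // => a _; rewrite rpred_sum // => b _.
rewrite mxE /lto; case: ifP => ab; last by rewrite scale0r mem0v.
apply/memvZ/memv_span/mapP; exists (a, b) => //.
by rewrite mem_enum.
Qed.

Lemma mask_eq_cartan A : antifixed G A -> mask (fun a b => a == b) A \in cartan K G m.
Proof.
move=> As; rewrite (antifixed_sum two_neq0 (antifixed_mask rev_stable_eq As)).
rewrite memvZ // rpred_sum // => a _; rewrite rpred_sum // => b _.
rewrite mxE; case: eqP => [<-|_]; last by rewrite scale0r mem0v.
have FC c : Fmx K G (lshift m c) (lshift m c) \in cartan K G m.
  by apply/memv_span/mapP; exists c => //; rewrite mem_enum.
apply: memvZ; case: (split_ordP a) => c ->; first exact: FC.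
by rewrite -[rshift m c]rev_ordK Fmx_rev memvZ // rev_rshift FC.
Qed.

Definition strictly_upper (A : M) := forall a b : 'I_(m + m), (b <= a)%N -> A a b = 0.
Definition upper (A : M) := forall a b : 'I_(m + m), (b < a)%N -> A a b = 0.
Definition diagonal (A : M) := forall a b : 'I_(m + m), a != b -> A a b = 0.

Lemma nprime_upper A : A \in nprime K G m -> strictly_upper A.
Proof.
apply: span_closed => [a b _|c x y xu yu a b ba|]; first by rewrite mxE.
  by rewrite !mxE xu // yu // mulr0 addr0.
move=> _ /mapP [[a b] + ->] c d dc; rewrite mem_enum inE /= => ab.
have N1 : (c == a) && (d == b) = false.
  by apply/andP => -[/eqP ca /eqP db]; move: dc; rewrite ca db leqNgt ab.
have N2 : (c == rev_ord b) && (d == rev_ord a) = false.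
  apply/andP => -[/eqP cb /eqP da]; move: dc.
  by rewrite cb da leqNgt rev_ltn ab.
by rewrite !mxE N1 N2 mulr0 subr0.
Qed.

Lemma cartan_diagonal A : A \in cartan K G m -> diagonal A.
Proof.
apply: span_closed => [a b _|c x y xd yd a b ab|]; first by rewrite mxE.
  by rewrite !mxE xd // yd // mulr0 addr0.
move=> _ /mapP [c _ ->] a b ab.
have N k : (a == k) && (b == k) = false.
  by apply/andP => -[/eqP ak /eqP bk]; rewrite ak bk eqxx in ab.
by rewrite !mxE !N mulr0 subr0.
Qed.

Definition low (X : L) : L := vsproj fm (mask gto (vsval X)).

Lemma lowE X : vsval (low X) = mask gto (vsval X).
Proof.
rewrite vsprojK //; apply/(in_fmP G two_neq0)/antifixed_mask; first exact: rev_stable_gto.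
exact: antifixed_val.
Qed.

Lemma low_linear : linear low.
Proof. by move=> c X Y; apply: subvs_inj; rewrite lowE !linearP /= !lowE mask_linear. Qed.

Lemma low_low X : low (low X) = low X.
Proof.
by apply: subvs_inj; rewrite !lowE; apply/matrixP=> a b; rewrite !mxE; case: (gto a b).
Qed.

Lemma low_eq0 X : low X = 0 <-> upper (vsval X).
Proof.
split=> [/(congr1 vsval)|u].
  by rewrite lowE linear0 => /matrixP E a b ab; move: (E a b); rewrite !mxE /gto ab.
apply: subvs_inj; rewrite lowE linear0; apply/matrixP=> a b; rewrite !mxE /gto.
by case: ifP => // /u.
Qed.

Lemma low_id (X : L) : (forall a b : 'I_(m + m), (a <= b)%N -> vsval X a b = 0) -> low X = X.
Proof.
move=> X0; apply: subvs_inj; rewrite lowE; apply/matrixP=> a b; rewrite !mxE /gto.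
by case: ltnP => // /X0 ->.
Qed.

Lemma bracket_low X Y : low (bracket (low X) (low Y)) = bracket (low X) (low Y).
Proof.
have E (A B : M) (a b : 'I_(m + m)) : (a <= b)%N -> (mask gto A *m mask gto B) a b = 0.
  move=> ab; rewrite mxE big1 // => c _; rewrite !mxE /gto.
  case: ltnP => ca; last by rewrite mul0r.
  case: ltnP => bc; last by rewrite mulr0.
  by move: (leq_trans (ltn_trans bc ca) ab); rewrite ltnn.
apply: low_id => a b ab.
by rewrite (bracketE two_neq0) !lowE [LHS]mxE [X in _ + X]mxE !E // subr0.
Qed.

Lemma upperM A B : upper A -> upper B -> upper (A *m B).
Proof.
move=> Au Bu a b ba; rewrite mxE big1 // => c _.
case: (ltnP c a) => ca; first by rewrite Au ?mul0r.
by rewrite Bu ?mulr0 // (leq_trans ba).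
Qed.

Lemma bracket_upper X Y : low X = 0 -> low Y = 0 -> low (bracket X Y) = 0.
Proof.
move=> /low_eq0 Xu /low_eq0 Yu; apply/low_eq0 => a b ab.
by rewrite (bracketE two_neq0) [LHS]mxE [X in _ + X]mxE !upperM // subr0.
Qed.

Lemma upper_diag A B (a : 'I_(m + m)) : upper A -> upper B ->
  (A *m B) a a = A a a * B a a.
Proof.
move=> Au Bu; rewrite mxE (bigD1 a) //= big1 ?addr0 // => c ca.
case: (ltngtP c a) => [lt|gt|/val_inj E]; last by rewrite E eqxx in ca.
  by rewrite Au ?mul0r.
by rewrite Bu ?mulr0.
Qed.

Variable mu : weight K G m.

(** The extension of the weight to f_m by 0 on the root vectors. *)
Definition weight_ext (X : L) : K^o :=
  mu (vsproj (cartan K G m) (mask (fun a b => a == b) (vsval X))).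

Lemma weight_ext_linear : linear weight_ext.
Proof. by move=> c X Y; rewrite /weight_ext linearP /= mask_linear !linearP. Qed.

Lemma weight_ext_diag0 (X : L) : (forall a, vsval X a a = 0) -> weight_ext X = 0.
Proof.
move=> X0; rewrite /weight_ext (_ : mask _ _ = 0) ?linear0 //.
by apply/matrixP=> a b; rewrite !mxE; case: eqP => // <-.
Qed.

Lemma weight_ext_low X : weight_ext (low X) = 0.
Proof.
by apply: weight_ext_diag0 => a; rewrite lowE mxE /gto ltnn.
Qed.

Lemma weight_ext_bracket X Y : low X = 0 -> low Y = 0 -> weight_ext (bracket X Y) = 0.
Proof.
move=> /low_eq0 Xu /low_eq0 Yu; apply: weight_ext_diag0 => a.
by rewrite (bracketE two_neq0) [LHS]mxE [X in _ + X]mxE !upper_diag // mulrC subrr.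
Qed.

Lemma weight_ext_cartan (X : L) (H : subvs_of (cartan K G m)) :
  vsval X = vsval H -> weight_ext X = mu H.
Proof.
move=> E; rewrite /weight_ext E; congr (mu _); apply: subvs_inj.
rewrite (_ : mask _ _ = vsval H) ?vsvalK //.
apply/matrixP=> a b; rewrite mxE; case: eqP => // /eqP ab.
by rewrite (cartan_diagonal (subvsP H)).
Qed.

Lemma bracket_linearl Y : linear (@bracket K G m ^~ Y).
Proof.
move=> c X X'; rewrite /bracket -linearP; congr (vsproj _ _).
by rewrite linearP /= mulmxDl mulmxDr -scalemxAl -scalemxAr scalerBr opprD addrACA.
Qed.

Lemma bracketC X Y : bracket X Y = - @bracket K G m Y X.
Proof. by rewrite /bracket -[RHS]linearN opprB. Qed.

Lemma bracket_linearr X : linear (@bracket K G m X).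
Proof.
by move=> c Y Y'; rewrite ![bracket X _]bracketC bracket_linearl opprD scalerN.
Qed.

Lemma bracket_jacobi X Y Z : bracket X (bracket Y Z) =
  bracket (bracket X Y) Z + @bracket K G m Y (bracket X Z).
Proof.
apply: subvs_inj; rewrite linearD /= !(bracketE two_neq0).
rewrite !mulmxBl !mulmxBr !mulmxA.
rewrite !opprB [RHS](AC (2*2*(2*2)) ((1*8)*(3*6)*((2*5)*(4*7)))) /=.
by rewrite !addNr !addr0.
Qed.

End Triangular.

Lemma lin_sub3_eq0 (K : fieldType) (U V : lmodType K) (f : U -> V) x y z :
  linear f -> f x = f y + f z -> f (x - y - z) = 0.
Proof. by move=> fL E; rewrite !(linB _ _ fL) E addrAC addrK subrr. Qed.

(** * The coinvariants of a Verma module as a polynomial ring *)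

Section Verma.
Variables (K : fieldType) (G : classical_group) (n m : nat).
Hypothesis n_even : G = Symplectic -> ~~ odd n.
Hypothesis two_neq0 : 2%:R != 0 :> K.
Local Notation fm := (fm K G m).
Local Notation L := (subvs_of fm).
Local Notation P := (polymn K m n).
Local Notation zX := (@zetaX K G n m).
Variable mu : weight K G m.

Local Notation act_word := (word_act (@bracket K G m) (@low K G m)
  (weight_ext mu) (fun X : L => zX (vsval X))).

Lemma zetaX_vall (g : P) : linear (fun X : L => zX (vsval X) g).
Proof. by move=> c X Y; rewrite linearP /= zetaX_linearl. Qed.

Lemma zetaX_bracket (X Y : L) (g : P) : zX (vsval X) (zX (vsval Y) g) =
  zX (vsval Y) (zX (vsval X) g) + zX (vsval (bracket X Y)) g.
Proof.
by rewrite (bracketE two_neq0) -zetaX_comm //; apply: antifixed_val.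
Qed.

Let brl := @bracket_linearl K G m.
Let brr := @bracket_linearr K G m.
Let loL := @low_linear K G m two_neq0.
Let lo_id := @low_low K G m two_neq0.
Let br_lo := @bracket_low K G m two_neq0.
Let br_hi := @bracket_upper K G m two_neq0.
Let muL := weight_ext_linear mu.
Let mu_lo := weight_ext_low two_neq0 mu.
Let mu_br := weight_ext_bracket two_neq0 mu.
Let zl := zetaX_vall.
Let zr (X : L) : linear (zX (vsval X)).
Proof. exact: zetaX_linear. Qed.

Let act_word_linear w : linear (act_word w).
Proof. exact: word_act_linear. Qed.
Let actM g : multilinear (act_word^~ g).
Proof. exact: word_act_multilinear. Qed.
Let act_compat k g : lie_compatible (@bracket K G m) k (act_word^~ g).
Proof.
apply: word_act_compatible => //; [exact: bracketC|exact: bracket_jacobi|exact: zetaX_bracket].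
Qed.

(** Linear extension of the reduction of words to the tensor algebra of f_m. *)
Definition free_act (x : lie_free fm) (g : P) : P :=
  free_lift (fun w : {fmonom L} => act_word w g) x.

Lemma free_act_linearl g : linear (free_act^~ g).
Proof. exact: free_lift_linear. Qed.

Lemma free_act_linear x : linear (free_act x).
Proof.
apply: linear_sumf => w; apply: linear_scalef; exact: act_word_linear.
Qed.

Lemma free_actU (w : {fmonom L}) g : free_act << w >> g = act_word w g.
Proof. exact: free_liftU. Qed.

Lemma fmmul_cat (u v : {fmonom L}) : fmmul u v = u ++ v :> seq L.
Proof. exact: fmM. Qed.

Lemma malgUU (u v : {fmonom L}) : << u >> * << v >> = << fmmul u v >> :> lie_free fm.
Proof. by rewrite malgM_def fgmulUU mulr1. Qed.

Lemma lie_free_scalerAr c (x y : lie_free fm) : c *: (x * y) = x * (c *: y).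
Proof.
rewrite [RHS](malgMEw (fsubset_refl _) (monalg.msuppZ_le c y)) malgME scaler_sumr.
apply: eq_bigr => k _; rewrite scaler_sumr; apply: eq_bigr => l _.
by rewrite -malgUZ monalg.mcoeffZ mulrCA.
Qed.

Lemma free_act_rel a r b g : env_rel r -> free_act (a * r * b) g = 0.
Proof.
move=> rr.
have L1 : linear (fun a : lie_free fm => free_act (a * r * b) g).
  by move=> c x y; rewrite !mulrDl -!scalerAl free_act_linearl.
apply: (eq_free L1 (@linear_cst0 _ _ _)) => u {L1}.
have L2 : linear (fun b : lie_free fm => free_act (<< u >> * r * b) g).
  by move=> c x y; rewrite !mulrDr -lie_free_scalerAr free_act_linearl.
apply: (eq_free L2 (@linear_cst0 _ _ _)) => v {L2}.
have [F [FL FU FE]] : exists F : lie_free fm -> P, [/\ linear F,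
    forall w : {fmonom L}, F << w >> = act_word (u ++ w ++ v) g &
    forall x, F x = free_act (<< u >> * x * << v >>) g].
  exists (fun x => free_act (<< u >> * x * << v >>) g); split=> // [c x y|w].
    by rewrite mulrDr mulrDl -lie_free_scalerAr -scalerAl free_act_linearl.
  by rewrite !malgUU free_actU !fmmul_cat catA.
have F1 X : F (lie_var X) = act_word (u ++ X :: v) g.
  by rewrite /lie_var FU fmuE.
have F2 X Y : F (lie_var X * lie_var Y) = act_word (u ++ [:: X, Y & v]) g.
  by rewrite /lie_var malgUU FU fmmul_cat !fmuE.
rewrite -FE; case: rr => [c X Y|X Y Z ZE].
  apply: (lin_sub3_eq0 FL); apply: etrans (F1 _) _; apply: esym.
  apply: etrans (congr2 +%R (linZ c (lie_var X) FL) (F1 Y)) _.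
  by rewrite F1; apply: esym; apply: actM.
apply: (lin_sub3_eq0 FL); apply: etrans (F2 X Y) _; apply: esym.
apply: etrans (congr2 +%R (F2 Y X) (F1 Z)) _; apply: esym.
have -> : Z = bracket X Y by apply: subvs_inj; rewrite bracketE.
exact: (@act_compat (size u) g u v X Y (leqnn _)).
Qed.

Definition env_functional (u : env fm) (g : P) : P :=
  qlift (free_act^~ g) u.

Let Uproj := qring_proj (@env_rel K (m + m) fm).

Lemma env_functionalE x g : env_functional (Uproj x) g = free_act x g.
Proof.
apply: qliftE; first exact: free_act_linearl.
by move=> _ [a [r [b [rr ->]]]]; apply: free_act_rel.
Qed.

Lemma env_functional_linearl g : linear (env_functional^~ g).
Proof.
apply: qlift_linear; first exact: free_act_linearl.
by move=> _ [a [r [b [rr ->]]]]; apply: free_act_rel.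
Qed.

Lemma env_functional_linear u : linear (env_functional u).
Proof. exact: free_act_linear. Qed.

Lemma Uproj1 : Uproj 1 = 1.
Proof. exact: qproj_one. Qed.

Lemma UprojM x y : Uproj (x * y) = Uproj x * Uproj y.
Proof. exact: qring_projM. Qed.

Lemma Uproj_linear : linear Uproj.
Proof. by move=> c x y; rewrite /Uproj qring_projD qring_projZ. Qed.

Lemma env_ind (Q : env fm -> Prop) : (forall x, Q (Uproj x)) -> forall u, Q u.
Proof. exact: quot_ind. Qed.

Lemma free_act_low X x g : low X = X ->
  free_act (lie_var X * x) g = - free_act x (zX (vsval X) g).
Proof.
move=> XE; move: x; apply: eq_free.
- by move=> c x y; rewrite mulrDr -lie_free_scalerAr; apply: free_act_linearl.
- by apply: linear_oppf; apply: free_act_linearl.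
move=> w; apply: etrans (congr1 (free_act^~ g) (malgUU (fmu X) w)) _.
apply: etrans (free_actU _ _) _; apply: etrans _ (esym (congr1 -%R (free_actU _ _))).
by rewrite fmmul_cat fmuE; apply: word_act_lo.
Qed.

Lemma free_act_upper X x g : low X = 0 ->
  free_act (x * lie_var X) g = weight_ext mu X *: free_act x g.
Proof.
move=> X0; move: x; apply: eq_free.
- by move=> c x y; rewrite mulrDl -scalerAl; apply: free_act_linearl.
- by apply: linear_scalef; apply: free_act_linearl.
move=> w; apply: etrans (congr1 (free_act^~ g) (malgUU w (fmu X))) _.
apply: etrans (free_actU _ _) _.
apply: etrans _ (esym (congr1 ( *:%R _) (free_actU _ _))).
by rewrite fmmul_cat fmuE cats1; apply: word_act_rcons.
Qed.

Local Notation Mv := (verma mu).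

Definition verma_act (t : Mv) (g : P) : P := qlift (env_functional^~ g) t.

Lemma nprime_low (X : L) : vsval X \in nprime K G m ->
  low X = 0 /\ weight_ext mu X = 0.
Proof.
move=> /nprime_upper Xu; split; first by apply/low_eq0 => // a b /ltnW; apply: Xu.
by apply: weight_ext_diag0 => a; rewrite Xu.
Qed.

Lemma verma_cartan_low (X : L) (H : subvs_of (cartan K G m)) :
  vsval X = vsval H -> low X = 0.
Proof.
move=> XH; apply/low_eq0 => // a b ba; rewrite XH.
by rewrite (cartan_diagonal (subvsP H)) // neq_ltn ba orbT.
Qed.

Lemma verma_act_rel y g : left_multiples (verma_rel mu) y -> env_functional y g = 0.
Proof.
case=> u [y' [yr ->]]; elim/env_ind: u => x; case: yr => [X /nprime_low [X0 mu0]|X H XH].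
  by rewrite -UprojM env_functionalE free_act_upper // mu0 scale0r.
have X0 := verma_cartan_low XH.
rewrite mulrBr -env_scalerAr mulr1 -UprojM.
apply: etrans (linB _ _ (env_functional_linearl g)) _.
rewrite (linZ _ _ (env_functional_linearl g)) !env_functionalE free_act_upper //.
by rewrite (weight_ext_cartan mu XH) subrr.
Qed.

Lemma verma_act_linearl g : linear (verma_act^~ g).
Proof.
by apply: qlift_linear; [apply: env_functional_linearl|move=> y; apply: verma_act_rel].
Qed.

Lemma verma_act_linear t : linear (verma_act t).
Proof. exact: env_functional_linear. Qed.

Local Notation Vproj x := (qproj (left_multiples (verma_rel mu)) (Uproj x)).

Lemma verma_actE x g : verma_act (Vproj x) g = free_act x g.
Proof.
rewrite /verma_act qliftE ?env_functionalE //; first exact: env_functional_linearl.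
by move=> y; apply: verma_act_rel.
Qed.

Lemma verma_ind (Q : Mv -> Prop) : (forall x, Q (Vproj x)) -> forall t, Q t.
Proof. by move=> H; apply: quot_ind; apply: env_ind. Qed.

Lemma env_gen_Vproj X x : env_act (env_gen X) (Vproj x : Mv) = Vproj (lie_var X * x).
Proof. by rewrite [LHS]lq_actE UprojM. Qed.

Lemma verma_act_low X t g : low X = X ->
  verma_act (env_act (env_gen X) t) g = - verma_act t (zX (vsval X) g).
Proof.
move=> XE; elim/verma_ind: t => x.
by rewrite env_gen_Vproj !verma_actE free_act_low.
Qed.

Definition verma_top : Mv := Vproj 1.

Lemma verma_top_weight X : low X = 0 ->
  env_act (env_gen X) verma_top = weight_ext mu X *: verma_top.
Proof.
move=> X0; rewrite /verma_top env_gen_Vproj mulr1.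
have A : antifixed G (vsval X) by apply: antifixed_val.
have DX := mask_eq_cartan two_neq0 A; have NX := mask_lto_nprime two_neq0 A.
pose D : L := vsproj fm (mask (fun a b => a == b) (vsval X)).
pose N : L := vsproj fm (mask (@lto m) (vsval X)).
have DE : vsval D = mask (fun a b => a == b) (vsval X).
  by apply/vsprojK/(in_fmP G two_neq0)/antifixed_mask => //; apply: rev_stable_eq.
have NE : vsval N = mask (@lto m) (vsval X).
  by apply/vsprojK/(in_fmP G two_neq0)/antifixed_mask => //; apply: rev_stable_lto.
have XE : X = D + N.
  apply: subvs_inj; rewrite linearD /= DE NE; apply/matrixP=> a b; rewrite !mxE /lto.
  move/(low_eq0 two_neq0): X0 => Xu.
  case: (ltngtP a b) => [ab|ba|/val_inj ->]; rewrite ?eqxx ?addr0 //.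
    by rewrite -val_eqE /= ltn_eqF // add0r.
  by rewrite -val_eqE /= gtn_eqF // Xu.
pose pr : env fm -> quotient (left_multiples (verma_rel mu)) := qproj _.
have prL : linear pr := @qproj_is_linear _ _ _.
suff E : pr (env_gen X) = pr ((weight_ext mu X : K) *: (1 : env fm)).
  exact: etrans E (etrans (linZ _ _ prL) (congr1 (fun y => _ *: pr y) (esym Uproj1))).
apply/qprojP; rewrite XE -[D]scale1r (env_gen_linear 1 D N) !scale1r addrAC.
have gen y : verma_rel mu y -> lspan (left_multiples (verma_rel mu)) y.
  by move=> yr; apply: lspan_in; exists 1, y; rewrite mul1r.
apply: lspanD; apply: gen; last by apply: verma_nprime; rewrite NE.
pose H := vsproj (cartan K G m) (mask (fun a b => a == b) (vsval X)).
have DH : vsval D = vsval H by rewrite DE vsprojK.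
rewrite (_ : weight_ext mu (D + N) = mu H); last by rewrite -XE.
exact: verma_cartan.
Qed.

Local Notation F := (@Fm K G m n Mv).
Local Notation pi := (qproj (@coinv_rel K G m n Mv)).

Definition coinv_of (f : P) : coinvariants n Mv := pi (tens verma_top f).

Lemma coinv_of_linear : linear coinv_of.
Proof.
exact: (linear_comp (@qproj_is_linear _ _ _) (tens_linearr verma_top)).
Qed.

Definition coinv_lift : F -> P := tlift verma_act.

Lemma coinv_lift_linear : linear coinv_lift.
Proof.
by apply: tlift_linear; [apply: verma_act_linearl|apply: verma_act_linear].
Qed.

Lemma coinv_lift_tens t g : coinv_lift (tens t g) = verma_act t g.
Proof.
by apply: tlift_tens; [apply: verma_act_linearl|apply: verma_act_linear].
Qed.

Lemma low_Fel (a b : 'I_(m + m)) : (b < a)%N -> low (Fel K G a b) = Fel K G a b.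
Proof.
move=> ba; apply: low_id => // c d cd; rewrite FelE.
have N1 : (c == a) && (d == b) = false.
  by apply/andP => -[/eqP ca /eqP db]; move: cd; rewrite ca db leqNgt ba.
have N2 : (c == rev_ord b) && (d == rev_ord a) = false.
  apply/andP => -[/eqP cb /eqP da]; move: cd.
  by rewrite cb da leqNgt rev_ltn ba.
by rewrite !mxE N1 N2 mulr0 subr0.
Qed.

Lemma coinv_lift_low X t : low X = X -> coinv_lift (diag_act X t) = 0.
Proof.
move=> XE; move: t; apply: eq_tensor => [||t g].
- by apply: linear_comp; [apply: coinv_lift_linear|apply: diag_act_linear].
- exact: linear_cst0.
apply: etrans (congr1 _ (diag_act_tens two_neq0 X t g)) _.
apply: etrans (linD _ _ coinv_lift_linear) _.
apply: etrans (congr2 +%R (coinv_lift_tens _ _) (coinv_lift_tens _ _)) _.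
by rewrite verma_act_low // addNr.
Qed.

Lemma coinv_lift_rel t : coinv_rel t -> coinv_lift t = 0.
Proof. by case=> a b {}t ba; rewrite Fm_lieE // coinv_lift_low // low_Fel. Qed.

(** The reduction of words kills n F_m(M_mu) and therefore inverts [coinv_of]. *)
Definition poly_of (q : coinvariants n Mv) : P := qlift coinv_lift q.

Lemma poly_of_linear : linear poly_of.
Proof. exact: qlift_linear coinv_lift_linear coinv_lift_rel. Qed.

Lemma poly_ofE t : poly_of (pi t) = coinv_lift t.
Proof. exact: qliftE coinv_lift_linear coinv_lift_rel t. Qed.

Lemma coinv_ofK : cancel coinv_of poly_of.
Proof.
move=> f; rewrite /coinv_of poly_ofE coinv_lift_tens verma_actE.
have -> : (1 : lie_free fm) = << fmone L >> by [].
rewrite free_actU fmoneE; exact: word_act_nil.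
Qed.

Lemma pi_low X t g : low X = X ->
  pi (tens (env_act (env_gen X) t) g) = - pi (tens t (zX (vsval X) g)).
Proof.
move=> XE; apply/eqP; rewrite -addr_eq0; apply/eqP.
apply: etrans (esym (linD _ _ (@qproj_is_linear _ _ _))) _.
apply: etrans (congr1 pi (esym (diag_act_tens two_neq0 X t g))) _.
apply/qproj0P; move: (tens t g) => s.
have -> : X = 2%:R^-1 *: \sum_a \sum_b (vsval X : 'M[K]_(m + m)) a b *: Fel K G a b.
  apply: subvs_inj; rewrite linearZ linear_sum /=.
  rewrite [LHS](antifixed_sum two_neq0 (antifixed_val two_neq0 X)); congr (_ *: _).
  apply: eq_bigr => a _; rewrite linear_sum; apply: eq_bigr => b _.
  by rewrite linearZ /= FelE.
rewrite (linZ _ _ (diag_act_linearl two_neq0 s)); apply: lspanZ.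
rewrite (lin_sum _ _ _ (diag_act_linearl two_neq0 s)).
apply: (big_ind (lspan (@coinv_rel K G m n Mv))) => [||a _].
- exact: lspan0.
- exact: lspanD.
rewrite (lin_sum _ _ _ (diag_act_linearl two_neq0 s)).
apply: (big_ind (lspan (@coinv_rel K G m n Mv))) => [||b _].
- exact: lspan0.
- exact: lspanD.
rewrite (linZ _ _ (diag_act_linearl two_neq0 s)); case: (ltnP b a) => ba.
  by apply/lspanZ/lspan_in; rewrite -Fm_lieE //; apply: coinv_rel_lie.
rewrite (_ : (vsval X : 'M[K]_(m + m)) a b = 0); last first.
  by rewrite -XE lowE // mxE /gto ltnNge ba.
rewrite scale0r; exact: lspan0.
Qed.

Let gen_act X (t : Mv) : Mv := env_act (env_gen X) t.

Lemma Vproj_word (w : {fmonom L}) : Vproj << w >> = word_vec gen_act verma_top w.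
Proof.
case: w => w /=; elim: w => [|X w IH].
  by rewrite /= /verma_top -fmoneE.
rewrite /= -IH /gen_act env_gen_Vproj malgUU; congr (Vproj << _ >>).
by apply: val_inj; rewrite /= fmmul_cat fmuE.
Qed.

Lemma coinv_of_surj t g : pi (tens t g) = coinv_of (verma_act t g).
Proof.
elim/verma_ind: t => x; move: x; apply: eq_free.
- move=> c x y.
  by rewrite Uproj_linear !(qproj_is_linear, tens_linearl g).
- move=> c x y.
  by rewrite Uproj_linear (qproj_is_linear (left_multiples _)) (verma_act_linearl g) coinv_of_linear.
move=> w; rewrite verma_actE free_actU Vproj_word.
apply: (@pt_word_vec K L P _ _ _ _ loL lo_id muL mu_lo Mv _ gen_act verma_top
  (fun t f => pi (tens t f))).
- by move=> v c X Y; rewrite /gen_act env_gen_linear env_act_linearl.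
- by move=> X; apply: env_act_linear.
- move=> X Y v; rewrite /gen_act -!env_actM.
  apply: etrans _ (linD _ _ (env_act_linearl v)).
  congr (env_act _ v); apply/eqP; rewrite addrC -subr_eq; apply/eqP.
  exact: env_gen_bracket (bracketE two_neq0 X Y).
- exact: verma_top_weight.
- move=> f; exact: (linear_comp (@qproj_is_linear _ _ _) (tens_linearl f)).
- move=> v; exact: (linear_comp (@qproj_is_linear _ _ _) (tens_linearr v)).
- exact: pi_low.
Qed.

Lemma poly_ofK : cancel poly_of coinv_of.
Proof.
apply: quot_ind; apply: eq_tensor => [c x y|c x y|t g].
- rewrite (qproj_is_linear (@coinv_rel K G m n Mv)) poly_of_linear.
  exact: coinv_of_linear.
- exact: qproj_is_linear.
by rewrite poly_ofE coinv_lift_tens coinv_of_surj.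
Qed.

End Verma.

(** * Matrices of power series of operators *)

Lemma sum_antidiagonals (V : zmodType) (F : nat -> nat -> V) r :
  \sum_(s < r.+1) \sum_(t < (r - s).+1) F s t =
  \sum_(u < r.+1) \sum_(s < u.+1) F s (u - s)%N.
Proof.
elim: r => [|r IH]; first by rewrite !big_ord1.
rewrite [RHS]big_ord_recr /= -IH [LHS]big_ord_recr /= subnn big_ord1.
rewrite [X in _ = _ + X]big_ord_recr /= subnn addrA; congr (_ + _).
rewrite -big_split; apply: eq_bigr => s _.
by rewrite subSn ?big_ord_recr // -ltnS.
Qed.

(** A matrix of power series in 1/u with operators as coefficients is a function
    A for which A r i j is the coefficient of u^(-r) in the (i, j) entry. *)
Section OperatorSeries.
Variables (K : fieldType) (n : nat) (V : lmodType K).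
Local Notation ser := (nat -> 'I_n -> 'I_n -> V -> V).
Implicit Types (A B C : ser).

Definition lin_ser A := forall r i j, linear (A r i j).

Definition mulT A B : ser := fun r i j w =>
  \sum_(s < r.+1) \sum_k A s i k (B (r - s)%N k j w).

Definition oneT : ser := fun r i j w => ((r == 0%N) && (i == j))%:R *: w.

Lemma oneT_linear : lin_ser oneT.
Proof. move=> r i j; exact: linear_scale. Qed.

Lemma mulT_linear A B : lin_ser A -> lin_ser B -> lin_ser (mulT A B).
Proof.
move=> AL BL r i j; apply: linear_sumf => s; apply: linear_sumf => k.
exact: linear_comp.
Qed.

Lemma eq_ser A B : (forall r i j w, A r i j w = B r i j w) -> A = B.
Proof.
move=> AB; apply/funext => r; apply/funext => i; apply/funext => j.
by apply/funext => w.
Qed.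

Lemma mulTA A B C : lin_ser A -> mulT A (mulT B C) = mulT (mulT A B) C.
Proof.
move=> AL; apply: eq_ser => r i j w; rewrite /mulT.
under eq_bigr => s _ do under eq_bigr => k _ do
  rewrite (lin_sum _ _ _ (AL _ _ _)).
under eq_bigr do rewrite exchange_big /=.
pose F s t := \sum_k \sum_l A s i k (B t k l (C (r - (s + t))%N l j w)).
transitivity (\sum_(s < r.+1) \sum_(t < (r - s).+1) F s t).
  apply: eq_bigr => s _; apply: eq_bigr => t _; apply: eq_bigr => k _.
  by rewrite (lin_sum _ _ _ (AL _ _ _)); apply: eq_bigr => l _; rewrite subnDA.
rewrite sum_antidiagonals; apply: eq_bigr => u _.
rewrite [RHS]exchange_big /=; apply: eq_bigr => s _; rewrite /F exchange_big /=.
by apply: eq_bigr => l _; rewrite subnKC // -ltnS.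
Qed.

Lemma mul1T A : mulT oneT A = A.
Proof.
apply: eq_ser => r i j w; rewrite /mulT /oneT big_ord_recl /= [X in _ + X]big1 ?addr0; last first.
  by move=> s _; apply: big1 => k _; rewrite scale0r.
rewrite subn0 (bigD1 i) //= eqxx scale1r big1 ?addr0 // => k /negbTE.
by rewrite eq_sym => ->; rewrite scale0r.
Qed.

Lemma mulT1 A : lin_ser A -> mulT A oneT = A.
Proof.
move=> AL; apply: eq_ser => r i j w; rewrite /mulT /oneT big_ord_recr /=.
rewrite [X in X + _]big1 ?add0r; last first.
  move=> s _; apply: big1 => k _.
  by rewrite subn_eq0 leqNgt ltn_ord scale0r (lin0 (AL _ _ _)).
rewrite subnn (bigD1 j) //= eqxx scale1r big1 ?addr0 // => k /negbTE kj.
by rewrite kj scale0r (lin0 (AL _ _ _)).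
Qed.

Definition prodT (F : nat -> ser) k : ser :=
  iteri k (fun j A => mulT A (F j)) oneT.

Lemma prodT_linear F k : (forall j, lin_ser (F j)) -> lin_ser (prodT F k).
Proof.
by move=> FL; elim: k => [|k IH]; [apply: oneT_linear|apply: mulT_linear].
Qed.

Lemma prodT_add F a b : (forall j, lin_ser (F j)) ->
  prodT F (a + b) = mulT (prodT F a) (prodT (fun j => F (a + j)%N) b).
Proof.
move=> FL; elim: b => [|b IH]; first by rewrite addn0 mulT1 //; apply: prodT_linear.
by rewrite addnS /= IH -mulTA //; apply: prodT_linear.
Qed.

Lemma prodT_recl F k : (forall j, lin_ser (F j)) ->
  prodT F k.+1 = mulT (F 0%N) (prodT (fun j => F j.+1) k).
Proof. by move=> FL; rewrite -addn1 addnC prodT_add //= mul1T. Qed.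

Lemma eq_prodT F F' k : (forall j, (j < k)%N -> F j = F' j) -> prodT F k = prodT F' k.
Proof.
elim: k => //= k IH FF'; rewrite FF' // IH // => j jk.
by apply: FF'; rewrite ltnS ltnW.
Qed.

End OperatorSeries.

(** * The product formula on the highest weight vector *)

(** Here F e d c b is the (c, b) entry of the matrix F_ed, the operators E e d and
    A r c d are the actions on V of F_ed and of the (c, d) entry of the matrix
    (F - h)^r, and pt v g is the class of v (x) g. *)
Section RowRecursion.
Variables (K : fieldType) (N n : nat) (V P Q : lmodType K) (pt : V -> P -> Q).
Hypotheses (ptl : forall g, linear (pt^~ g)) (ptr : forall v, linear (pt v)).
Variables (E : 'I_N -> 'I_N -> V -> V) (A : nat -> 'I_N -> 'I_N -> V -> V).
Variables (p q : 'I_N -> 'I_n -> P -> P) (zeta : 'I_N -> 'I_N -> P -> P).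
Variables (F : 'I_N -> 'I_N -> 'M[K]_N) (h : K) (wt : 'I_N -> K) (v : V).
Hypotheses (AL : forall r c d, linear (A r c d)) (pL : forall c i, linear (p c i)).
Hypothesis qL : forall c i, linear (q c i).
Hypothesis A0 : forall c d w, A 0 c d w = (c == d)%:R *: w.
Hypothesis AS : forall r c d w,
  A r.+1 c d w = \sum_e A r c e (E e d w - (h * (e == d)%:R) *: w).
Hypothesis EA : forall e d r c f w, E e d (A r c f w) = A r c f (E e d w)
  + \sum_a F e d a c *: A r a f w - \sum_b F e d f b *: A r c b w.
Hypothesis E_low : forall (e d : 'I_N) w g, (d < e)%N -> pt (E e d w) g = - pt w (zeta e d g).
Hypothesis E_up : forall e d : 'I_N, (e < d)%N -> E e d v = 0.
Hypothesis E_diag : forall d, E d d v = wt d *: v.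
Hypothesis zeta_p : forall e d c i g,
  zeta e d (p c i g) = p c i (zeta e d g) - \sum_b F e d c b *: p b i g.
Hypothesis zeta_pq : forall e d g, e != d ->
  zeta e d g = - \sum_k q e k (p d k g).
Hypothesis F_row : forall e d b, b != d -> F e d e b = 0.

(** Entry d of the row vector p (F - h)^r, applied to v. *)
Definition row_vec r d i g : Q := \sum_c pt (A r c d v) (p c i g).

Lemma row_vec_linear r d i : linear (row_vec r d i).
Proof.
by apply: linear_sumf => c; apply: (linear_comp (ptr _)); apply: pL.
Qed.

Lemma row_vec0 d i g : row_vec 0 d i g = pt v (p d i g).
Proof.
rewrite /row_vec (bigD1 d) //= A0 eqxx scale1r big1 ?addr0 // => c /negbTE cd.
by rewrite A0 cd scale0r (lin0 (ptl _)).
Qed.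

(** Modulo the lower triangular F_ed, an entry F_ed with e > d acts as q_e p_d
    on the polynomials; the commutators of F_ed with (F - h)^r and with p cancel
    up to a shift of the weight. *)
Lemma row_vecS r d i g : row_vec r.+1 d i g =
  (wt d + \sum_(e : 'I_N | (d < e)%N) F e d e d - h) *: row_vec r d i g
  + \sum_(e : 'I_N | (d < e)%N) \sum_k row_vec r e i (q e k (p d k g)).
Proof.
pose Y e := \sum_c pt (A r c e (E e d v)) (p c i g).
have Ylt (e : 'I_N) : (e < d)%N -> Y e = 0.
  by move=> ed; rewrite /Y big1 // => c _; rewrite E_up // (lin0 (AL _ _ _)) (lin0 (ptl _)).
have Yd : Y d = wt d *: row_vec r d i g.
  rewrite /Y /row_vec scaler_sumr; apply: eq_bigr => c _.
  by rewrite E_diag (linZ _ _ (AL _ _ _)) (linZ _ _ (ptl _)).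
have Ygt (e : 'I_N) : (d < e)%N ->
    Y e = F e d e d *: row_vec r d i g + \sum_k row_vec r e i (q e k (p d k g)).
  move=> de.
  have ed : e != d by rewrite -val_eqE /= gtn_eqF.
  pose T a b c := pt (A r a b v) (p c i g).
  transitivity (\sum_c (pt (A r c e v) (p c i (- zeta e d g))
      + (\sum_b F e d c b *: T c e b - \sum_a F e d a c *: T a e c
         + \sum_b F e d e b *: T c b c))).
    apply: eq_bigr => c _.
    have -> : A r c e (E e d v) = E e d (A r c e v)
        - (\sum_a F e d a c *: A r a e v - \sum_b F e d e b *: A r c b v).
      by rewrite EA -[X in _ = X - _]addrA addrK.
    rewrite !(linB _ _ (ptl _)) E_low // zeta_p (linB _ _ (ptr _)) !(lin_sum _ _ _ (ptl _)).
    rewrite (lin_sum _ _ _ (ptr _)) !(linN _ (pL c i)) (linN _ (ptr _)).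
    under eq_bigr do rewrite (linZ _ _ (ptr _)).
    under [X in _ - (X - _)]eq_bigr do rewrite (linZ _ _ (ptl _)).
    under [X in _ - (_ - X)]eq_bigr do rewrite (linZ _ _ (ptl _)).
    by rewrite !opprD !opprK -!addrA.
  rewrite !big_split sumrN /=.
  have -> : \sum_c \sum_b F e d c b *: T c e b = \sum_c \sum_a F e d a c *: T a e c.
    exact: exchange_big.
  rewrite subrr add0r addrC; congr (_ + _).
    rewrite exchange_big (bigD1 d) //= [X in _ + X]big1 ?addr0.
      by rewrite -scaler_sumr.
    by move=> b bd; rewrite big1 // => c _; rewrite F_row // scale0r.
  rewrite zeta_pq // opprK -/(row_vec r e i _) (lin_sum _ _ _ (row_vec_linear r e i)).
  by [].
rewrite /row_vec; under eq_bigr do rewrite AS (lin_sum _ _ _ (ptl _)).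
rewrite exchange_big /=.
transitivity (\sum_e (Y e - (h * (e == d)%:R) *: row_vec r e i g)).
  apply: eq_bigr => e _; rewrite /row_vec scaler_sumr -sumrB; apply: eq_bigr => c _.
  by rewrite (linB _ _ (AL _ _ _)) (linZ _ _ (AL _ _ _)) (linB _ _ (ptl _)) (linZ _ _ (ptl _)).
rewrite sumrB [X in _ - X](bigD1 d) //= eqxx mulr1 [X in _ - (_ + X)]big1 ?addr0; last first.
  by move=> e /negbTE ed; rewrite ed mulr0 scale0r.
rewrite (bigID (fun e : 'I_N => d < e)%N) /=.
under eq_bigr => e de do rewrite Ygt //.
rewrite big_split /=.
rewrite [X in _ + X - _](bigD1 d) ?ltnn //= Yd [X in _ + (_ + X)]big1 ?addr0; last first.
  move=> e /andP[]; rewrite -leqNgt leq_eqVlt val_eqE => /orP[/eqP ->|/Ylt //].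
  by rewrite eqxx.
rewrite -scaler_suml scalerBl scalerDl -/(row_vec r d i g).
by rewrite [LHS](AC (2*1*1) (3*1*4*2)) /=.
Qed.

Definition shifted_weight d : K :=
  wt d + \sum_(e : 'I_N | (d < e)%N) F e d e d - h.

(** 1 + p_d q_d / (u - c), where c is the shifted weight of d. *)
Definition factor d : nat -> 'I_n -> 'I_n -> P -> P := fun r i j g =>
  if r is r'.+1 then shifted_weight d ^+ r' *: p d i (q d j g)
  else (i == j)%:R *: g.

(* The factors in decreasing order of d; d = N - j.+1 never defaults. *)
Definition rev_factor (j : nat) : nat -> 'I_n -> 'I_n -> P -> P :=
  oapp factor (@oneT K n P) (insub (N - j.+1)%N).

Lemma rev_factor_linear j : lin_ser (rev_factor j).
Proof.
rewrite /rev_factor; case: insub => [d|] /=; last exact: oneT_linear.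
case=> [|r] i k; first exact: linear_scale.
by apply: linear_scalef; apply: linear_comp.
Qed.

(** The geometric series of the row recursion multiplies out: the part of
    1 + p (u + h - F)^-1 q with column index at least N - k is a product. *)
Lemma row_vec_prod k r i j g : (k <= N)%N ->
  pt v (prodT rev_factor k r i j g) =
  ((r == 0%N) && (i == j))%:R *: pt v g
  + (if r is r'.+1 then \sum_(e : 'I_N | (N - k <= e)%N) row_vec r' e i (q e j g)
     else 0).
Proof.
elim: k r i j g => [|k IH] r i j g kN.
  rewrite /= /oneT (linZ _ _ (ptr v)) subn0.
  case: r => [|r]; rewrite ?addr0 // big_pred0 ?addr0 // => e.
  by rewrite leqNgt ltn_ord.
have PL := prodT_linear k rev_factor_linear.
have dN : (N - k.+1 < N)%N by rewrite ltn_subrL /= (leq_ltn_trans _ kN).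
pose d := Ordinal dN.
have Fd : rev_factor k = factor d by rewrite /rev_factor insubT.
have gtd (e : 'I_N) : (N - k <= e)%N = (d < e)%N by rewrite /= subnSK.
have rowE s g' : row_vec s d i g' =
    \sum_(t < s.+1) shifted_weight d ^+ (s - t)
      *: \sum_l pt v (prodT rev_factor k t i l (p d l g')).
  elim: s => [|s IHs].
    rewrite big_ord1 expr0 scale1r (bigD1 i) //= big1 ?addr0.
      by rewrite IH ?(ltnW kN) //= eqxx scale1r addr0 row_vec0.
    move=> l /negbTE li; rewrite IH ?(ltnW kN) //=.
    by rewrite eq_sym li scale0r addr0.
  rewrite row_vecS -/(shifted_weight d) IHs [RHS]big_ord_recr /= subnn expr0 scale1r.
  congr (_ + _).
    rewrite scaler_sumr; apply: eq_bigr => t _.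
    by rewrite scalerA -exprS subSn // -ltnS.
  rewrite exchange_big /=; apply: eq_bigr => l _; rewrite IH ?(ltnW kN) //=.
  by rewrite scale0r add0r; apply: eq_bigl => e; rewrite gtd.
rewrite /= Fd /mulT; case: r => [|r].
  rewrite big_ord1 (lin_sum _ _ _ (ptr v)) (bigD1 j) //= big1 ?addr0.
    by rewrite eqxx scale1r IH ?(ltnW kN) //= addr0.
  by move=> l /negbTE lj; rewrite lj scale0r (lin0 (PL _ _ _)) (lin0 (ptr v)).
rewrite big_ord_recr /= subnn (linD _ _ (ptr v)) scale0r add0r.
have -> : pt v (\sum_l prodT rev_factor k r.+1 i l (factor d 0 l j g)) =
    pt v (prodT rev_factor k r.+1 i j g).
  rewrite (lin_sum _ _ _ (ptr v)) (bigD1 j) //= eqxx scale1r big1 ?addr0 //.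
  by move=> l /negbTE lj; rewrite lj scale0r (lin0 (PL _ _ _)) (lin0 (ptr v)).
rewrite IH ?(ltnW kN) //= scale0r add0r [RHS](bigD1 d) //= rowE; congr (_ + _).
  rewrite (lin_sum _ _ _ (ptr v)); apply: eq_bigr => t _.
  rewrite (lin_sum _ _ _ (ptr v)) scaler_sumr; apply: eq_bigr => l _.
  have tr : (t <= r)%N by rewrite -ltnS.
  by rewrite subSn //= (linZ _ _ (PL _ _ _)) (linZ _ _ (ptr v)).
apply: eq_bigl => e; rewrite gtd andbC -val_eqE /= ltn_neqAle eq_sym.
by [].
Qed.
End RowRecursion.

(** * The action of S(u) on the coinvariants *)

Section CoinvariantAction.
Variables (K : fieldType) (G : classical_group) (n m : nat).
Hypothesis n_even : G = Symplectic -> ~~ odd n.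
Hypothesis two_neq0 : 2%:R != 0 :> K.
Local Notation fm := (fm K G m).
Local Notation P := (polymn K m n).
Local Notation pop := (@pop K G m n).
Local Notation qop := (@qop K G m n).
Local Notation zeta := (@zeta K G m n).
Local Notation Fmx := (@Fmx K G m).
Variable mu : weight K G m.
Local Notation N := (m + m)%N.
Local Notation h := (pm K G / 2%:R + m%:R).
Local Notation Mv := (verma mu).
Local Notation pt := (fun (t : Mv) (g : P) => qproj (@coinv_rel K G m n Mv) (tens t g)).
Local Notation top := (verma_top mu).

Let Amat : 'M[env fm]_N := \matrix_(a, b) FU K G a b - (h *: (1 : env fm))%:M.
Let A r c d : Mv -> Mv := env_act ((Amat ^+ r) c d).
Let E e d : Mv -> Mv := env_act (FU K G e d).
Let wt (d : 'I_N) : K := weight_ext mu (Fel K G d d).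

Lemma low_Fel_upper (e d : 'I_N) : (e <= d)%N -> low (Fel K G e d) = 0.
Proof.
move=> ed; apply/low_eq0 => // a b ba; rewrite FelE.
have N1 : (a == e) && (b == d) = false.
  by apply/andP => -[/eqP ae /eqP bd]; move: ba; rewrite ae bd ltnNge ed.
have N2 : (a == rev_ord d) && (b == rev_ord e) = false.
  by apply/andP => -[/eqP ae /eqP bd]; move: ba; rewrite ae bd rev_ltn ltnNge ed.
by rewrite !mxE N1 N2 mulr0 subr0.
Qed.

Lemma weight_ext_off (e d : 'I_N) : (e < d)%N -> weight_ext mu (Fel K G e d) = 0.
Proof.
move=> ed; apply: weight_ext_diag0 => a; rewrite FelE.
have Nk (k l : 'I_N) : k != l -> (a == k) && (a == l) = false.
  by move=> kl; apply/andP => -[/eqP ak /eqP al]; rewrite -ak -al eqxx in kl.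
have ed' : e != d by rewrite -val_eqE /= ltn_eqF.
by rewrite !mxE !Nk ?mulr0 ?subr0 // (inj_eq rev_ord_inj) eq_sym.
Qed.

Lemma env_act_bool (b : bool) (w : Mv) : env_act (b%:R : env fm) w = b%:R *: w.
Proof.
case: b; first by rewrite env_act1 scale1r.
by rewrite scale0r (lin0 (env_act_linearl w)).
Qed.

Let ptl g : linear (pt^~ g).
Proof. exact: (linear_comp (@qproj_is_linear _ _ _) (tens_linearl g)). Qed.

Let ptr t : linear (pt t).
Proof. exact: (linear_comp (@qproj_is_linear _ _ _) (tens_linearr t)). Qed.

Let AL r c d : linear (A r c d).
Proof. exact: env_act_linear. Qed.

Let A0 c d w : A 0 c d w = (c == d)%:R *: w.
Proof. by rewrite /A expr0 mxE env_act_bool. Qed.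

Let AS r c d w :
  A r.+1 c d w = \sum_e A r c e (E e d w - (h * (e == d)%:R) *: w).
Proof.
rewrite /A exprSr mxE (lin_sum _ _ _ (env_act_linearl w)); apply: eq_bigr => e _.
rewrite env_actM; congr (env_act _ _); rewrite !mxE.
apply: etrans (linB _ _ (env_act_linearl w)) _; congr (_ - _).
case: (e == d); last by rewrite mulr0 scale0r (lin0 (env_act_linearl w)).
by rewrite mulr1 (linZ _ _ (env_act_linearl w)) env_act1.
Qed.

Let EA e d r c f w : E e d (A r c f w) = A r c f (E e d w)
  + \sum_a Fmx e d a c *: A r a f w - \sum_b Fmx e d f b *: A r c b w.
Proof.
have EQ : equivariant Amat.
  by apply: equivariantB; [apply: equivariant_FU|apply: equivariant_scalar].
rewrite /E /A -!env_actM (equivariantX r EQ) FelE.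
apply: etrans (linB _ _ (env_act_linearl w)) _.
rewrite (linD _ _ (env_act_linearl w)) !(lin_sum _ _ _ (env_act_linearl w)).
by congr (_ + _ - _); apply: eq_bigr => a _; rewrite (linZ _ _ (env_act_linearl w)).
Qed.

Let E_low (e d : 'I_N) w g : (d < e)%N -> pt (E e d w) g = - pt w (zeta e d g).
Proof.
move=> de; have := pi_low n_even two_neq0 w g (low_Fel G two_neq0 de).
by rewrite FelE zetaX_Fmx.
Qed.

Let E_up (e d : 'I_N) : (e < d)%N -> E e d top = 0.
Proof.
move=> ed; rewrite /E /FU verma_top_weight ?low_Fel_upper ?(ltnW ed) //.
by rewrite weight_ext_off // scale0r.
Qed.

Let E_diag d : E d d top = wt d *: top.
Proof. by rewrite /E /FU verma_top_weight ?low_Fel_upper. Qed.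

Let zeta_p e d c i g :
  zeta e d (pop c i g) = pop c i (zeta e d g) - \sum_b Fmx e d c b *: pop b i g.
Proof.
have /= := zetaX_pop n_even two_neq0 c i g (@antifixed_Fmx K G m e d).
by rewrite !zetaX_Fmx.
Qed.

Let zeta_pq e d g : e != d -> zeta e d g = - \sum_k qop e k (pop d k g).
Proof. by move=> /negbTE ed; rewrite zetaE // ed mul0r scale0r addr0. Qed.

Let F_row e d b : b != d -> Fmx e d e b = 0.
Proof.
move=> /negbTE bd; rewrite !mxE bd andbF sub0r.
rewrite (_ : _ && _ = false) ?mulr0 ?oppr0 //.
by apply/andP => -[/eqP -> /eqP E1]; rewrite E1 rev_ordK eqxx in bd.
Qed.

Local Notation prod_ser := (prodT (rev_factor pop qop Fmx h wt) N).

Lemma Sop_coinv_of r i j f :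
  @Sop _ _ _ (coinvariants n Mv) r i j (coinv_of mu f) = coinv_of mu (prod_ser r i j f).
Proof.
have qpL : linear (qproj (@coinv_rel K G m n Mv)) by apply: qproj_is_linear.
have R : pt top (prod_ser r i j f) = _ := row_vec_prod ptl ptr AL
  (@pop_linear K G n m) (@qop_linear K G n m) A0 AS EA E_low E_up E_diag
  zeta_p zeta_pq F_row r i j f (leqnn N).
apply: etrans _ (esym R).
apply: etrans (Sop_coinvariants n_even two_neq0 r i j (tens top f)) _.
apply: etrans (congr1 _ (Fm_S_tens r i j top f)) _.
apply: etrans (linD _ _ qpL) _; congr (_ + _); first exact: (linZ _ _ qpL).
rewrite (lin_sum _ _ _ qpL).
under eq_bigr do rewrite (lin_sum _ _ _ qpL).
case: r {R} => [|r].
  rewrite big1 // => c _; rewrite big1 // => d _.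
  rewrite mxE (lin0 (env_act_linearl top)) (lin0 (tens_linearl _)).
  exact: lin0.
rewrite [LHS]exchange_big.
rewrite subnn.
apply: eq_bigr => d _.
apply: eq_bigr => c _.
have FE : Fseries G m h r.+1 c d = (Amat ^+ r) c d by [].
by rewrite FE.
Qed.

Lemma Hop_coinv_of a f :
  @Hop _ _ _ (coinvariants n Mv) a (coinv_of mu f) =
  coinv_of mu (wt (rshift m a) *: f + zeta (rshift m a) (rshift m a) f).
Proof.
have qpL : linear (qproj (@coinv_rel K G m n Mv)) by apply: qproj_is_linear.
apply: etrans (Hop_coinvariants n_even two_neq0 a (tens top f)) _.
rewrite Fm_lieE //; apply: etrans (congr1 _ (diag_act_tens two_neq0 _ top f)) _.
apply: etrans (linD _ _ qpL) _; apply: etrans _ (esym (linD _ _ (ptr top))).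
have Z : zetaX G (vsval (Fel K G (rshift m a) (rshift m a))) f =
    zeta (rshift m a) (rshift m a) f by rewrite FelE zetaX_Fmx.
apply: (congr2 +%R) (congr1 (pt top) Z).
apply: etrans (congr1 (pt^~ f) (E_diag (rshift m a))) _.
exact: etrans (linZ _ _ (ptl f)) (esym (linZ _ _ (ptr top))).
Qed.

Lemma weight_ext_lshift a : wt (lshift m a) = wlabel mu a.
Proof.
rewrite /wt /wlabel; apply: weight_ext_cartan => //.
rewrite FelE vsprojK //; apply/memv_span/mapP; exists a => //.
by rewrite mem_enum.
Qed.

Lemma weight_ext_rshift a : wt (rshift m a) = - wlabel mu (rev_ord a).
Proof.
rewrite -weight_ext_lshift /wt -(linN _ (weight_ext_linear mu)).
congr (weight_ext mu _); apply: subvs_inj.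
rewrite linearN /= !FelE -[rshift m a]rev_ordK Fmx_rev eps_diag scaleN1r.
by rewrite rev_rshift.
Qed.

(** The shift counts the e > d, except that e = - d contributes 1 + 1 for
    sp_2m, where F_(-d)d is twice a matrix unit, and 0 for so_2m. *)
Lemma shifted_weightE d : shifted_weight Fmx h wt d =
  wt d + (N - d.+1)%:R + (if (d < m)%N then pm K G else 0) - h.
Proof.
rewrite /shifted_weight -!addrA; congr (_ + _); rewrite addrA; congr (_ - _).
have diag (e : 'I_N) : (d < e)%N -> Fmx e d e d = 1 + pm K G * (e == rev_ord d)%:R.
  move=> de; rewrite !mxE !eqxx /= -[d == _](inj_eq rev_ord_inj) rev_ordK.
  rewrite [rev_ord d == e]eq_sym andbb.
  case: eqP => [->|_]; last by rewrite !mulr0 subr0 addr0.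
  by rewrite eps_rev_self !mulr1 opprK.
rewrite (eq_bigr _ diag) big_split /=; congr (_ + _).
  transitivity ((\sum_(e < N | (d < e)%N) 1)%N%:R : K); first by rewrite natr_sum.
  congr (_%:R); rewrite -[RHS]muln1 -(sum_nat_const_nat d.+1 N 1).
  by rewrite (big_geq_mkord d.+1 N predT).
have revd : (d < rev_ord d)%N = (d < m)%N by rewrite /=; lia.
rewrite big_mkcond (bigD1 (rev_ord d)) //= [X in _ + X]big1 ?addr0.
  by rewrite -[(N - d.+1)%N]/(nat_of_ord (rev_ord d)) revd eqxx mulr1.
by move=> e /negbTE ->; rewrite mulr0 if_same.
Qed.
End CoinvariantAction.

(** * The RTT relation and the reflection equation *)

Lemma rtt_arith (V : zmodType) (a a' b b' c d : V) :
  (a - a' - (b - b') = c - d) <-> (a - b - c = a' - b' - d).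
Proof.
have E : a - b - c - (a' - b' - d) = a - a' - (b - b') - (c - d).
  rewrite !opprD !opprK [LHS](AC (2*1*(2*1)) (1*4*(2*5)*(3*6))) /=.
  by [].
by split=> /eqP; rewrite -subr_eq0 => /eqP H; apply/eqP; rewrite -subr_eq0 -?E ?H // E H.
Qed.

Lemma rtt_arith_opp (V : zmodType) (a a' b b' c d : V) :
  a - a' - (b - b') = d - c -> - a + b - c = - a' + b' - d.
Proof.
move/rtt_arith => E; have -> : - a + b = - (a - b) by rewrite opprB addrC.
have -> : - a' + b' = - (a' - b') by rewrite opprB addrC.
have -> : a - b = a' - b' - c + d by rewrite -E subrK.
by rewrite !opprD !opprK [LHS]addrAC addrK.
Qed.

Section MatrixSeries.
Variables (K : fieldType) (G : classical_group) (n : nat) (V : lmodType K).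
Hypothesis n_even : G = Symplectic -> ~~ odd n.
Local Notation I2 := ('I_n * 'I_n)%type.
Local Notation mxs := (nat -> nat -> I2 -> I2 -> V -> V).
Local Notation ser := (nat -> 'I_n -> 'I_n -> V -> V).
Local Notation mul := (@mxseries_mul K n V).
Local Notation S1 := (@S1_series K n V).
Local Notation S2 := (@S2_series K n V).
Local Notation R := (@R_series K n V).
Local Notation R' := (@R'_series K G n V).
Local Notation th := (theta K G).
Implicit Types (A B C : ser) (X Y Z : mxs).

Definition lin_mxs X := forall r s x y, linear (X r s x y).

Lemma eq_mxs X Y : (forall r s x y w, X r s x y w = Y r s x y w) -> X = Y.
Proof.
move=> XY; apply/funext => r; apply/funext => s; apply/funext => x.
by apply/funext => y; apply/funext => w.
Qed.

Lemma mul_linear X Y : lin_mxs X -> lin_mxs Y -> lin_mxs (mul X Y).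
Proof.
move=> XL YL r s x y; apply: linear_sumf => r1; apply: linear_sumf => s1.
apply: linear_sumf => z; exact: linear_comp.
Qed.

Lemma mulA X Y Z : lin_mxs X -> mul X (mul Y Z) = mul (mul X Y) Z.
Proof.
move=> XL; apply: eq_mxs => r s x y w; rewrite /mxseries_mul.
pose H r1 r2 s1 s2 := \sum_z \sum_z' X r1 s1 x z
  (Y r2 s2 z z' (Z (r - (r1 + r2))%N (s - (s1 + s2))%N z' y w)).
transitivity (\sum_(r1 < r.+1) \sum_(r2 < (r - r1).+1)
    \sum_(s1 < s.+1) \sum_(s2 < (s - s1).+1) H r1 r2 s1 s2).
  apply: eq_bigr => r1 _; rewrite [RHS]exchange_big; apply: eq_bigr => s1 _ /=.
  under eq_bigr do rewrite (lin_sum _ _ _ (XL _ _ _ _)).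
  rewrite exchange_big; apply: eq_bigr => r2 _ /=.
  under eq_bigr do rewrite (lin_sum _ _ _ (XL _ _ _ _)).
  rewrite exchange_big; apply: eq_bigr => s2 _ /=; apply: eq_bigr => z _.
  rewrite (lin_sum _ _ _ (XL _ _ _ _)); apply: eq_bigr => z' _.
  by rewrite !subnDA.
rewrite (sum_antidiagonals (fun r1 r2 => \sum_(s1 < s.+1) \sum_(s2 < (s - s1).+1) H r1 r2 s1 s2)).
apply: eq_bigr => u _.
under eq_bigr => r1 _ do rewrite (sum_antidiagonals (H r1 (u - r1)%N)).
rewrite exchange_big; apply: eq_bigr => v _ /=.
transitivity (\sum_(r1 < u.+1) \sum_(s1 < v.+1) \sum_z' \sum_z X r1 s1 x z
  (Y (u - r1)%N (v - s1)%N z z' (Z (r - u)%N (s - v)%N z' y w))).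
  apply: eq_bigr => r1 _; apply: eq_bigr => s1 _; rewrite /H exchange_big /=.
  apply: eq_bigr => z' _; apply: eq_bigr => z _.
  by rewrite !subnKC // -ltnS.
under [LHS]eq_bigr do rewrite exchange_big.
by rewrite [LHS]exchange_big.
Qed.

Lemma S1_linear A : lin_ser A -> lin_mxs (S1 A).
Proof. by move=> AL r s x y; apply: linear_scalef. Qed.

Lemma S2_linear A : lin_ser A -> lin_mxs (S2 A).
Proof. by move=> AL r s x y; apply: linear_scalef. Qed.

Lemma R_linear : lin_mxs R.
Proof.
move=> [|[|r]] [|[|s]] x y; try exact: linear_cst0; exact: linear_scale.
Qed.

Lemma R'_linear : lin_mxs R'.
Proof.
move=> [|[|r]] [|[|s]] x y; try exact: linear_cst0; exact: linear_scale.
Qed.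

Lemma sum_pairs (f : I2 -> V) : \sum_z f z = \sum_a \sum_b f (a, b).
Proof. by rewrite pair_bigA; apply: eq_bigr => -[]. Qed.

Lemma mul_S1l A Y r s x y w : lin_ser A ->
  mul (S1 A) Y r s x y w =
  \sum_(r1 < r.+1) \sum_k A r1 x.1 k (Y (r - r1)%N s (k, x.2) y w).
Proof.
move=> AL; apply: eq_bigr => r1 _; rewrite big_ord_recl /= [X in _ + X]big1 ?addr0.
  rewrite sum_pairs; apply: eq_bigr => a _; rewrite /S1_series /= subn0.
  exact: (sum_delta x.2 (fun b => A r1 x.1 a (Y (r - r1)%N s (a, b) y w))).
by move=> s1 _; apply: big1 => z _; rewrite /S1_series /= scale0r.
Qed.

Lemma mul_S2l A Y r s x y w : lin_ser A ->
  mul (S2 A) Y r s x y w =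
  \sum_(s1 < s.+1) \sum_k A s1 x.2 k (Y r (s - s1)%N (x.1, k) y w).
Proof.
move=> AL; rewrite /mxseries_mul big_ord_recl /= [X in _ + X]big1 ?addr0.
  apply: eq_bigr => s1 _; rewrite sum_pairs exchange_big; apply: eq_bigr => b _.
  rewrite /S2_series /= subn0.
  exact: (sum_delta x.1 (fun a => A s1 x.2 b (Y r (s - s1)%N (a, b) y w))).
move=> r1 _; apply: big1 => s1 _; apply: big1 => z _.
by rewrite /S2_series /= scale0r.
Qed.

Lemma S1M A B : lin_ser A -> S1 (mulT A B) = mul (S1 A) (S1 B).
Proof.
move=> AL; apply: eq_mxs => r s x y w; rewrite mul_S1l // /S1_series /mulT.
rewrite scaler_sumr; apply: eq_bigr => r1 _; rewrite scaler_sumr.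
by apply: eq_bigr => k _; rewrite (linZ _ _ (AL _ _ _)).
Qed.

Lemma S2M A B : lin_ser A -> S2 (mulT A B) = mul (S2 A) (S2 B).
Proof.
move=> AL; apply: eq_mxs => r s x y w; rewrite mul_S2l // /S2_series /mulT.
rewrite scaler_sumr; apply: eq_bigr => r1 _; rewrite scaler_sumr.
by apply: eq_bigr => k _; rewrite (linZ _ _ (AL _ _ _)).
Qed.

Lemma mul_S1S2 A B r s x y w : lin_ser A ->
  mul (S1 A) (S2 B) r s x y w = A r x.1 y.1 (B s x.2 y.2 w).
Proof.
move=> AL; rewrite mul_S1l // big_ord_recr /= big1 ?add0r; last first.
  move=> r1 _; apply: big1 => k _; rewrite /S2_series /= subn_eq0 leqNgt ltn_ord /=.
  by rewrite scale0r (lin0 (AL _ _ _)).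
rewrite subnn /S2_series /= (bigD1 y.1) //= eqxx scale1r big1 ?addr0 // => k /negbTE ky.
by rewrite ky scale0r (lin0 (AL _ _ _)).
Qed.

Lemma mul_S2S1 A B r s x y w : lin_ser B ->
  mul (S2 B) (S1 A) r s x y w = B s x.2 y.2 (A r x.1 y.1 w).
Proof.
move=> BL; rewrite mul_S2l // big_ord_recr /= big1 ?add0r; last first.
  move=> r1 _; apply: big1 => k _; rewrite /S1_series /= subn_eq0 leqNgt ltn_ord /=.
  by rewrite scale0r (lin0 (BL _ _ _)).
rewrite subnn /S1_series /= (bigD1 y.2) //= eqxx scale1r big1 ?addr0 // => k /negbTE ky.
by rewrite ky scale0r (lin0 (BL _ _ _)).
Qed.

(** Multiplication by u^(-1) and by v^(-1). *)
Definition sh1 X : mxs := fun r s => if r is r'.+1 then X r' s else fun _ _ _ => 0.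
Definition sh2 X : mxs := fun r s => if s is s'.+1 then X r s' else fun _ _ _ => 0.

Lemma sum_corner (f : nat -> nat -> V) r s :
  f 0%N 0%N = 0 -> (forall r1 s1, f r1.+2 s1 = 0) -> (forall r1 s1, f r1 s1.+2 = 0) ->
  \sum_(r1 < r.+1) \sum_(s1 < s.+1) f r1 s1 =
  (if s is _.+1 then f 0%N 1%N else 0) + (if r is _.+1 then f 1%N 0%N else 0)
  + (if r is _.+1 then if s is _.+1 then f 1%N 1%N else 0 else 0).
Proof.
move=> f00 fr fs.
have inner k : (forall s1, f k s1.+2 = 0) ->
    \sum_(s1 < s.+1) f k s1 = f k 0%N + (if s is _.+1 then f k 1%N else 0).
  move=> fk; rewrite big_ord_recl; congr (_ + _).
  case: s => [|s]; first by rewrite big_ord0.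
  by rewrite big_ord_recl big1 ?addr0 // => s1 _; apply: fk.
rewrite big_ord_recl inner // f00 add0r -addrA; congr (_ + _).
case: r => [|r]; first by rewrite big_ord0 addr0.
rewrite big_ord_recl /= (inner 1%N) // big1 ?addr0 // => r1 _.
by apply: big1 => s1 _; apply: fr.
Qed.

Section Scalar.
Variable q : nat -> nat -> I2 -> I2 -> K.
Hypotheses (q00 : forall x y, q 0 0 x y = 0).
Hypotheses (qr : forall r s x y, q r.+2 s x y = 0) (qs : forall r s x y, q r s.+2 x y = 0).

Lemma mul_scalarl X r s x y w :
  mul (fun r s x y w => q r s x y *: w) X r s x y w =
  \sum_z q 0 1 x z *: sh2 X r s z y w + \sum_z q 1 0 x z *: sh1 X r s z y w
  + \sum_z q 1 1 x z *: sh1 (sh2 X) r s z y w.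
Proof.
rewrite /mxseries_mul (sum_corner r s (f := fun r1 s1 => \sum_z q r1 s1 x z *:
  X (r - r1)%N (s - s1)%N z y w)); first last.
- by move=> r1 s1; apply: big1 => z _; rewrite qs scale0r.
- by move=> r1 s1; apply: big1 => z _; rewrite qr scale0r.
- by apply: big1 => z _; rewrite q00 scale0r.
congr (_ + _ + _).
- case: s => [|s]; first by rewrite big1 // => z _; rewrite scaler0.
  by apply: eq_bigr => z _; rewrite /= subn0 subn1.
- case: r => [|r]; first by rewrite big1 // => z _; rewrite scaler0.
  by apply: eq_bigr => z _; rewrite /= subn0 subn1.
case: r => [|r]; first by rewrite big1 // => z _; rewrite scaler0.
case: s => [|s]; first by rewrite big1 // => z _; rewrite scaler0.
by apply: eq_bigr => z _; rewrite /= !subn1.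
Qed.

Lemma mul_scalarr X r s x y w : lin_mxs X ->
  mul X (fun r s x y w => q r s x y *: w) r s x y w =
  \sum_z q 0 1 z y *: sh2 X r s x z w + \sum_z q 1 0 z y *: sh1 X r s x z w
  + \sum_z q 1 1 z y *: sh1 (sh2 X) r s x z w.
Proof.
move=> XL.
transitivity (\sum_(r1 < r.+1) \sum_(s1 < s.+1) \sum_z q r1 s1 z y *:
    X (r - r1)%N (s - s1)%N x z w).
  rewrite /mxseries_mul (reindex_inj rev_ord_inj); apply: eq_bigr => r1 _.
  rewrite (reindex_inj rev_ord_inj); apply: eq_bigr => s1 _; apply: eq_bigr => z _.
  rewrite /= !subSS (linZ _ _ (XL _ _ _ _)) !subKn ?leq_ord ?subnn //.
rewrite (sum_corner r s (f := fun r1 s1 => \sum_z q r1 s1 z y *: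
  X (r - r1)%N (s - s1)%N x z w)); first last.
- by move=> r1 s1; apply: big1 => z _; rewrite qs scale0r.
- by move=> r1 s1; apply: big1 => z _; rewrite qr scale0r.
- by apply: big1 => z _; rewrite q00 scale0r.
congr (_ + _ + _).
- case: s => [|s]; first by rewrite big1 // => z _; rewrite scaler0.
  by apply: eq_bigr => z _; rewrite /= subn0 subn1.
- case: r => [|r]; first by rewrite big1 // => z _; rewrite scaler0.
  by apply: eq_bigr => z _; rewrite /= subn0 subn1.
case: r => [|r]; first by rewrite big1 // => z _; rewrite scaler0.
case: s => [|s]; first by rewrite big1 // => z _; rewrite scaler0.
by apply: eq_bigr => z _; rewrite /= !subn1.
Qed.
End Scalar.

Definition swap (x : I2) : I2 := (x.2, x.1).

Lemma flip_mxE (x y : I2) : flip_mx K x y = (swap x == y)%:R.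
Proof.
rewrite /flip_mx; case: x y => [x1 x2] [y1 y2] /=.
rewrite (bigD1 x1) //= [X in _ + X]big1 ?addr0; last first.
  move=> i /negbTE ix; apply: big1 => j _.
  by rewrite !mxE [x1 == i]eq_sym ix mul0r.
rewrite (bigD1 y1) //= [X in _ + X]big1 ?addr0; last first.
  by move=> j /negbTE jy; rewrite !mxE [y1 == j]eq_sym jy andbF mul0r.
by rewrite !mxE !eqxx mul1r /swap xpair_eqE [y2 == _]eq_sym.
Qed.

Lemma flip'_mxE (x y : I2) : flip'_mx K G x y =
  th x.1 * th y.1 * ((x.2 == tilde x.1) && (y.2 == tilde y.1))%:R.
Proof.
rewrite /flip'_mx; case: x y => [x1 x2] [y1 y2] /=.
rewrite (bigD1 x1) //= [X in _ + X]big1 ?addr0; last first.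
  move=> i /negbTE ix; apply: big1 => j _.
  by rewrite !mxE [x1 == i]eq_sym ix mul0r mulr0.
rewrite (bigD1 y1) //= [X in _ + X]big1 ?addr0; last first.
  by move=> j /negbTE jy; rewrite !mxE [y1 == j]eq_sym jy andbF mul0r mulr0.
by rewrite !mxE !eqxx mul1r.
Qed.

Lemma sum_eqx (f : I2 -> V) x : \sum_z (x == z)%:R *: f z = f x.
Proof. exact: (sum_delta x f). Qed.

Let Rcoef r s (x y : I2) : K := match r, s with 0%N, 1%N => (x == y)%:R
  | 1%N, 0%N => - (x == y)%:R | 1%N, 1%N => - flip_mx K x y | _, _ => 0 end.

Let R'coef r s (x y : I2) : K := match r, s with 0%N, 1%N => - (x == y)%:R
  | 1%N, 0%N => - (x == y)%:R | 1%N, 1%N => - flip'_mx K G x y | _, _ => 0 end.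

Let RE : R = fun r s x y w => Rcoef r s x y *: w.
Proof. by apply: eq_mxs => -[|[|r1]] [|[|s1]] x1 y1 w1 //=; rewrite scale0r. Qed.

Let R'E : R' = fun r s x y w => R'coef r s x y *: w.
Proof. by apply: eq_mxs => -[|[|r1]] [|[|s1]] x1 y1 w1 //=; rewrite scale0r. Qed.

Let sum_neqx (f : I2 -> V) x : \sum_z - (x == z)%:R *: f z = - f x.
Proof. by rewrite -(sum_eqx f x) -sumrN; apply: eq_bigr => z _; rewrite scaleNr. Qed.

Let sum_neqy (f : I2 -> V) y : \sum_z - (z == y)%:R *: f z = - f y.
Proof. by rewrite -sum_neqx; apply: eq_bigr => z _; rewrite eq_sym. Qed.

Lemma mul_Rl X r s x y w : mul R X r s x y w =
  sh2 X r s x y w - sh1 X r s x y w - sh1 (sh2 X) r s (swap x) y w.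
Proof.
rewrite RE mul_scalarl //; try by move=> [|[|?]].
rewrite /= sum_eqx sum_neqx; congr (_ + _).
by under eq_bigr do rewrite flip_mxE; rewrite sum_neqx.
Qed.

Lemma mul_Rr X r s x y w : lin_mxs X -> mul X R r s x y w =
  sh2 X r s x y w - sh1 X r s x y w - sh1 (sh2 X) r s x (swap y) w.
Proof.
move=> XL; rewrite RE mul_scalarr //; try by move=> [|[|?]].
rewrite /= sum_neqy; congr (_ + _ + _).
  rewrite -(sum_eqx (fun z => sh2 X r s x z w) y).
  by apply: eq_bigr => z _; rewrite eq_sym.
rewrite -(sum_neqy (fun z => sh1 (sh2 X) r s x z w) (swap y)).
apply: eq_bigr => -[z1 z2] _; rewrite flip_mxE /swap; case: y => y1 y2 /=.
by rewrite !xpair_eqE andbC.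
Qed.

Lemma mul_R'l X r s x y w : mul R' X r s x y w =
  - sh2 X r s x y w - sh1 X r s x y w
  - \sum_z flip'_mx K G x z *: sh1 (sh2 X) r s z y w.
Proof.
rewrite R'E mul_scalarl //; try by move=> [|[|?]].
rewrite /= !sum_neqx; congr (_ + _).
by rewrite -sumrN; apply: eq_bigr => z _; rewrite scaleNr.
Qed.

Lemma sum_flip' (f : I2 -> V) x : \sum_z flip'_mx K G x z *: f z =
  (x.2 == tilde x.1)%:R *: \sum_j (th x.1 * th j) *: f (j, tilde j).
Proof.
rewrite sum_pairs scaler_sumr; apply: eq_bigr => j _.
rewrite (bigD1 (tilde j)) //= big1 ?addr0.
  by rewrite flip'_mxE eqxx andbT mulrC scalerA.
by move=> k /negbTE kj; rewrite flip'_mxE /= kj andbF mulr0 scale0r.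
Qed.

Lemma flip'_swap x y : flip'_mx K G (swap x) y = flip'_mx K G x (swap y).
Proof.
rewrite !flip'_mxE; case: x y => [x1 x2] [y1 y2] /=.
have tE (a b : 'I_n) : (a == tilde b) = (b == tilde a).
  by rewrite eq_sym (inv_eq (@tildeK n)).
rewrite (tE x1) (tE y2); case: eqP => [->|_]; last by rewrite !mulr0.
case: eqP => [->|_]; last by rewrite !mulr0.
by rewrite !mulr1 !theta_tilde // mulrACA pm_sq mul1r.
Qed.

(** Exchanging the two tensor factors multiplies the rows and the columns of the
    twisted flip by the same sign. *)
Lemma mul_RR' : mul R R' = mul R' R.
Proof.
apply: eq_mxs => r s x y w; rewrite mul_Rl mul_R'l.
have S0 : \sum_z flip'_mx K G x z *: (0 : V) = 0.
  by rewrite big1 // => z _; rewrite scaler0.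
have Sd : \sum_z flip'_mx K G x z *: ((z == y)%:R *: w) = flip'_mx K G x y *: w.
  rewrite -(sum_eqx (fun z => flip'_mx K G x z *: w) y).
  by apply: eq_bigr => z _; rewrite !scalerA eq_sym mulrC.
have SdN : \sum_z flip'_mx K G x z *: (- (z == y)%:R *: w) = - flip'_mx K G x y *: w.
  by rewrite scaleNr -Sd -sumrN; apply: eq_bigr => z _; rewrite scaleNr scalerN.
have Sf : \sum_z flip'_mx K G x z *: (- flip_mx K z y *: w) = - flip'_mx K G x (swap y) *: w.
  transitivity (\sum_z (swap y == z)%:R *: (- flip'_mx K G x z *: w)); last exact: sum_eqx.
  apply: eq_bigr => -[z1 z2] _; rewrite flip_mxE !scalerA; congr (_ *: _).
  case: (y) => y1 y2; rewrite /swap !xpair_eqE /= [y1 == _]eq_sym [y2 == _]eq_sym andbC.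
  by rewrite mulrN mulrN mulrC.
case: r => [|[|[|r]]]; case: s => [|[|[|s]]];
  rewrite /= ?S0 ?Sf ?Sd ?SdN ?flip_mxE ?flip'_swap ?subr0 ?sub0r ?addr0 ?add0r
   ?oppr0 ?scaleNr ?opprK ?subrr ?addNr ?add0r //; exact: addrC.
Qed.

Definition shT A : ser := fun r => if r is r'.+1 then A r' else fun _ _ _ => 0.

Lemma mul_R'S2 B r s x y w : mul R' (S2 B) r s x y w =
  match r with
  | 0%N => - ((x.1 == y.1)%:R *: shT B s x.2 y.2 w)
  | 1%N => - ((x.1 == y.1)%:R *: B s x.2 y.2 w)
           - ((x.1 == tilde x.2)%:R * (th x.1 * th y.1)) *: shT B s (tilde y.1) y.2 w
  | _ => 0
  end.
Proof.
rewrite mul_R'l sum_flip' /S2_series.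
case: r => [|[|r]] /=; last first.
- case: s => [|s] /=; rewrite ?scale0r ?oppr0 ?addr0 ?add0r // big1 ?scaler0 ?oppr0 //.
  + by move=> j _; rewrite scaler0.
  + by move=> j _; rewrite scale0r scaler0.
- have S0 : (x.2 == tilde x.1) = (x.1 == tilde x.2) by rewrite eq_sym (inv_eq (@tildeK n)).
  rewrite S0; case: s => [|s] /=.
    by rewrite oppr0 add0r big1 ?scaler0 // => j _; rewrite scaler0.
  rewrite scale0r oppr0 add0r (bigD1 y.1) //= eqxx scale1r big1 ?addr0 ?scalerA //.
  by move=> j /negbTE jy; rewrite jy scale0r scaler0.
case: s => [|s] /=; rewrite ?scaler0 ?oppr0 ?addr0 ?add0r ?subr0 // big1 ?scaler0 ?oppr0 ?subr0 ?addr0 //;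
  by move=> j _; rewrite scaler0.
Qed.

Lemma mul_R'S1 A r s x y w : mul R' (S1 A) r s x y w =
  match s with
  | 0%N => - ((x.2 == y.2)%:R *: shT A r x.1 y.1 w)
  | 1%N => - ((x.2 == y.2)%:R *: A r x.1 y.1 w)
           - ((x.2 == tilde x.1)%:R * (th x.1 * th (tilde y.2))) *: shT A r (tilde y.2) y.1 w
  | _ => 0
  end.
Proof.
rewrite mul_R'l sum_flip' /S1_series.
case: s => [|[|s]] /=; last first.
- case: r => [|r] /=; rewrite ?scale0r ?oppr0 ?addr0 ?add0r // big1 ?scaler0 ?oppr0 //.
  + by move=> j _; rewrite scaler0.
  + by move=> j _; rewrite scale0r scaler0.
- case: r => [|r] /=.
    rewrite big1 ?scaler0 ?subr0 //; last by move=> j _; rewrite scaler0.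
  rewrite scale0r subr0 (bigD1 (tilde y.2)) //= tildeK eqxx scale1r.
  rewrite big1 ?addr0 ?scalerA // => j jy.
  rewrite (_ : tilde j == y.2 = false) ?scale0r ?scaler0 //.
  by apply: contra_neqF jy => /eqP <-; rewrite tildeK.
case: r => [|r] /=; rewrite ?scaler0 ?oppr0 ?addr0 ?add0r ?subr0 // big1 ?scaler0 ?oppr0 ?subr0 ?addr0 //;
  by move=> j _; rewrite scaler0.
Qed.

Lemma mul_S1R'S2 A B r s x y w : lin_ser A ->
  mul (S1 A) (mul R' (S2 B)) r s x y w =
  - A r x.1 y.1 (shT B s x.2 y.2 w) - shT A r x.1 y.1 (B s x.2 y.2 w)
  - (th (tilde x.2) * th y.1) *: shT A r x.1 (tilde x.2) (shT B s (tilde y.1) y.2 w).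
Proof.
move=> AL; rewrite mul_S1l //.
have pick (f : 'I_n -> V) (a : 'I_n) r1 :
   \sum_k A r1 x.1 k (((k == a)%:R) *: f k) = A r1 x.1 a (f a).
  rewrite (bigD1 a) //= eqxx scale1r big1 ?addr0 // => k /negbTE ka.
  by rewrite ka scale0r (lin0 (AL _ _ _)).
have t0 : \sum_k A r x.1 k (mul R' (S2 B) 0 s (k, x.2) y w) = - A r x.1 y.1 (shT B s x.2 y.2 w).
  under eq_bigr do rewrite mul_R'S2 /= (linN _ (AL _ _ _)).
  by rewrite sumrN pick.
have t1 r1 : \sum_k A r1 x.1 k (mul R' (S2 B) 1 s (k, x.2) y w) =
    - A r1 x.1 y.1 (B s x.2 y.2 w)
    - (th (tilde x.2) * th y.1) *: A r1 x.1 (tilde x.2) (shT B s (tilde y.1) y.2 w).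
  under eq_bigr do rewrite mul_R'S2 /= (linB _ _ (AL _ _ _)) (linN _ (AL _ _ _)) -scalerA.
  rewrite sumrB sumrN pick // (pick (fun k => (th k * th y.1) *: _)) //.
  by rewrite (linZ _ _ (AL _ _ _)).
rewrite big_ord_recr /= subnn t0.
case: r {t0} => [|r]; first by rewrite big_ord0 add0r /= scaler0 oppr0 !addr0.
rewrite big_ord_recr /= subSn // subnn t1 big1 ?add0r.
  by rewrite [LHS]addrC -addrA.
move=> r1 _; apply: big1 => k _.
have -> : (r.+1 - r1 = (r - r1.+1).+2)%N.
  by have := ltn_ord r1; lia.
by rewrite mul_R'S2 (lin0 (AL _ _ _)).
Qed.

Lemma mul_S2R'S1 A B r s x y w : lin_ser B ->
  mul (S2 B) (mul R' (S1 A)) r s x y w =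
  - shT B s x.2 y.2 (A r x.1 y.1 w) - B s x.2 y.2 (shT A r x.1 y.1 w)
  - (th x.1 * th (tilde y.2)) *: shT B s x.2 (tilde x.1) (shT A r (tilde y.2) y.1 w).
Proof.
move=> BL; rewrite mul_S2l //.
have pick (f : 'I_n -> V) (a : 'I_n) s1 :
   \sum_k B s1 x.2 k (((k == a)%:R) *: f k) = B s1 x.2 a (f a).
  rewrite (bigD1 a) //= eqxx scale1r big1 ?addr0 // => k /negbTE ka.
  by rewrite ka scale0r (lin0 (BL _ _ _)).
have t0 : \sum_k B s x.2 k (mul R' (S1 A) r 0 (x.1, k) y w) = - B s x.2 y.2 (shT A r x.1 y.1 w).
  under eq_bigr do rewrite mul_R'S1 /= (linN _ (BL _ _ _)).
  by rewrite sumrN pick.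
have t1 s1 : \sum_k B s1 x.2 k (mul R' (S1 A) r 1 (x.1, k) y w) =
    - B s1 x.2 y.2 (A r x.1 y.1 w)
    - (th x.1 * th (tilde y.2)) *: B s1 x.2 (tilde x.1) (shT A r (tilde y.2) y.1 w).
  under eq_bigr do rewrite mul_R'S1 /= (linB _ _ (BL _ _ _)) (linN _ (BL _ _ _)) -scalerA.
  rewrite sumrB sumrN pick // (pick (fun k => (th x.1 * th (tilde y.2)) *: _)) //.
  by rewrite (linZ _ _ (BL _ _ _)).
rewrite big_ord_recr /= subnn t0.
case: s {t0} => [|s]; first by rewrite big_ord0 /= scaler0 oppr0 addr0 !add0r.
rewrite big_ord_recr /= subSn // subnn t1 big1 ?add0r; last first.
  move=> s1 _; apply: big1 => k _.
  have -> : (s.+1 - s1 = (s - s1.+1).+2)%N by have := ltn_ord s1; lia.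
  by rewrite mul_R'S1 (lin0 (BL _ _ _)).
by rewrite addrAC.
Qed.

(** The relations of Y(gl_n), in terms of coefficients. *)
Definition rtt A := forall r s i j k l w,
  A r.+1 i j (A s k l w) - A s k l (A r.+1 i j w)
  - (A r i j (A s.+1 k l w) - A s.+1 k l (A r i j w))
  = A r k j (A s i l w) - A s k j (A r i l w).

Definition unital A := forall i j w, A 0%N i j w = (i == j)%:R *: w.

Lemma unital_comm A B s i j k l w : unital A -> lin_ser B ->
  A 0%N i j (B s k l w) = B s k l (A 0%N i j w).
Proof. by move=> A1 BL; rewrite !A1 (linZ _ _ (BL _ _ _)). Qed.

(** R T_1 T_2 = T_2 T_1 R is divided by u v to become an identity of power
    series; the coefficients not covered by [rtt] hold as T(u) begins with 1. *)
Lemma rtt_mxs A : lin_ser A -> unital A ->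
  rtt A <-> mul R (mul (S1 A) (S2 A)) = mul (S2 A) (mul (S1 A) R).
Proof.
move=> AL A1; have L1 := S1_linear AL; have L2 := S2_linear AL.
have E r s x y w : mul (S2 A) (mul (S1 A) R) r s x y w =
    sh2 (mul (S2 A) (S1 A)) r s x y w - sh1 (mul (S2 A) (S1 A)) r s x y w
    - sh1 (sh2 (mul (S2 A) (S1 A))) r s x (swap y) w.
  by rewrite mulA // mul_Rr //; apply: mul_linear.
split=> [Ar|Ar r s i j k l w].
  apply: eq_mxs => r s x y w; rewrite E mul_Rl.
  case: r => [|r]; case: s => [|s] //=.
  - by rewrite mul_S1S2 // mul_S2S1 // (unital_comm _ _ _ _ _ _ A1 AL).
  - by rewrite mul_S1S2 // mul_S2S1 // (unital_comm _ _ _ _ _ _ A1 AL).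
  rewrite !mul_S1S2 // !mul_S2S1 // /swap /=.
  by apply/rtt_arith; apply: Ar.
have := congr1 (fun X : mxs => X r.+1 s.+1 (i, k) (j, l) w) Ar.
rewrite E mul_Rl /= !mul_S1S2 // !mul_S2S1 // /swap /=.
by move/rtt_arith.
Qed.

(** Exchanging u and v reverses the products on the right hand side; this is the
    form of the relation that survives transposition. *)
Lemma rtt_sym A : rtt A -> forall r s i j k l w,
  A r.+1 i j (A s k l w) - A s k l (A r.+1 i j w)
  - (A r i j (A s.+1 k l w) - A s.+1 k l (A r i j w))
  = A s i l (A r k j w) - A r i l (A s k j w).
Proof.
move=> Ar r s i j k l w; rewrite -(Ar s r k l i j w).
by rewrite !opprB addrC.
Qed.

(** T'(-u), the transpose for the form that G_n preserves, at - u. *)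
Definition dualT A : ser := fun r i j w =>
  ((-1) ^+ r * th i * th j) *: A r (tilde j) (tilde i) w.

Lemma dualT_linear A : lin_ser A -> lin_ser (dualT A).
Proof. by move=> AL r i j; apply: linear_scalef. Qed.

Lemma dualT_unital A : unital A -> unital (dualT A).
Proof.
move=> A1 i j w; rewrite /dualT A1 scalerA expr0 mul1r (inj_eq (inv_inj (@tildeK n))).
by rewrite eq_sym; case: eqP => [->|_]; rewrite ?theta_sq ?mul1r ?mulr0.
Qed.

Lemma dualT_rtt A : lin_ser A -> rtt A -> rtt (dualT A).
Proof.
move=> AL /rtt_sym Ar r s i j k l w; rewrite /dualT.
rewrite !(linZ _ _ (AL _ _ _)) !scalerA.
pose c := (-1) ^+ r * (-1) ^+ s * (th i * th j * (th k * th l)).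
have := congr1 ( *:%R (- c)) (Ar r s (tilde j) (tilde i) (tilde l) (tilde k) w).
rewrite !scalerBr => E; apply: etrans (etrans _ E) _.
  by congr (_ *: _ - _ *: _ - (_ *: _ - _ *: _)); rewrite ?exprS /c; ring.
rewrite !scaleNr opprK addrC.
by congr (_ *: _ - _ *: _); rewrite /c; ring.
Qed.

Lemma mulT_unital A B : unital A -> unital B -> unital (mulT A B).
Proof.
move=> A1 B1 i j w; rewrite /mulT big_ord1.
rewrite (bigD1 j) //= big1 ?addr0; last first.
  move=> k /negbTE kj; rewrite subnn B1 kj scale0r A1 scaler0 //.
by rewrite subnn B1 eqxx scale1r A1.
Qed.

(** The comultiplication multiplies two matrices with commuting entries, and R
    passes through their factors in turn. *)
Lemma mulT_rtt A B : lin_ser A -> lin_ser B -> unital A -> unital B ->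
  (forall r s i j k l w, A r i j (B s k l w) = B s k l (A r i j w)) ->
  rtt A -> rtt B -> rtt (mulT A B).
Proof.
move=> AL BL A1 B1 AB /(rtt_mxs AL A1) RA /(rtt_mxs BL B1) RB.
have [LA1 LA2] := (S1_linear AL, S2_linear AL).
have [LB1 LB2] := (S1_linear BL, S2_linear BL).
have LR := R_linear.
apply/rtt_mxs; [exact: mulT_linear|exact: mulT_unital|].
rewrite !S1M // !S2M // -!mulA //.
have C1 Z : mul (S1 B) (mul (S2 A) Z) = mul (S2 A) (mul (S1 B) Z).
  rewrite !mulA //; congr (mul _ _); apply: eq_mxs => r s x y w.
  by rewrite mul_S1S2 // mul_S2S1 // AB.
have C2 Z : mul (S1 A) (mul (S2 B) Z) = mul (S2 B) (mul (S1 A) Z).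
  rewrite !mulA //; congr (mul _ _); apply: eq_mxs => r s x y w.
  by rewrite mul_S1S2 // mul_S2S1 // AB.
have RAZ Z : mul R (mul (S1 A) (mul (S2 A) Z)) = mul (S2 A) (mul (S1 A) (mul R Z)).
  have := congr1 (mul^~ Z) RA; rewrite -!mulA //; exact: mul_linear.
by rewrite C1 RAZ RB C2.
Qed.

(** Transposing one tensor factor turns the RTT relation into a relation between
    T(u) and T'(-v) with R' in place of R, transposing both gives the RTT
    relation of T'(-u). With these, and as R and R' commute, the factors of
    S_1 = T'_1 T_1 and S_2 = T'_2 T_2 are moved past each other one at a time. *)
Lemma reflection A : lin_ser A -> unital A -> rtt A ->
  X_relations G (mulT (dualT A) A).
Proof.
move=> AL A1 Ar; have PL := dualT_linear AL; have P1 := dualT_unital A1.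
have Pr := dualT_rtt AL Ar.
have [LA1 LA2] := (S1_linear AL, S2_linear AL).
have [LP1 LP2] := (S1_linear PL, S2_linear PL).
have LR := R_linear; have LR' := R'_linear.
have RTT := (rtt_mxs AL A1).1 Ar; have RPP := (rtt_mxs PL P1).1 Pr.
have As := rtt_sym Ar.
have thM (i : 'I_n) : th i * th (tilde i) = pm K G by rewrite theta_mul_tilde.
have AP : mul (S1 A) (mul R' (S2 (dualT A))) = mul (S2 (dualT A)) (mul R' (S1 A)).
  apply: eq_mxs => r s x y w; rewrite mul_S1R'S2 // mul_S2R'S1 //.
  case: r => [|r]; case: s => [|s]; rewrite /= ?scaler0 ?(lin0 (AL _ _ _)) ?(lin0 (PL _ _ _)) ?scaler0 //.
  - by rewrite (unital_comm _ _ _ _ _ _ A1 PL).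
  - by rewrite -(unital_comm _ _ _ _ _ _ P1 AL).
  rewrite /dualT; case: x y => [i k] [j l] /=.
  rewrite !tildeK !(linZ _ _ (AL _ _ _)) !scalerA.
  pose c := (-1) ^+ s * th k * th l.
  have -> : (-1) ^+ s.+1 * th k * th l = - c by rewrite exprS /c; ring.
  have -> : th (tilde k) * th j * ((-1) ^+ s * th (tilde j) * th l) = c.
    transitivity ((-1) ^+ s * (th j * th (tilde j)) * (th (tilde k) * th l)); first by ring.
    rewrite thM theta_tilde //; transitivity (pm K G * pm K G * c); first by rewrite /c; ring.
    by rewrite pm_sq mul1r.
  have -> : th i * th (tilde l) * ((-1) ^+ s * th k * th (tilde i)) = c.
    transitivity ((-1) ^+ s * (th i * th (tilde i)) * (th k * th (tilde l))); first by ring.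
    rewrite thM theta_tilde //; transitivity (pm K G * pm K G * c); first by rewrite /c; ring.
    by rewrite pm_sq mul1r.
  rewrite -/c !scaleNr !opprK; apply: rtt_arith_opp.
  by rewrite -!scalerBr; congr (_ *: _); apply: As.
have PA : mul (S1 (dualT A)) (mul R' (S2 A)) = mul (S2 A) (mul R' (S1 (dualT A))).
  apply: eq_mxs => r s x y w; rewrite mul_S1R'S2 // mul_S2R'S1 //.
  case: r => [|r]; case: s => [|s]; rewrite /= ?scaler0 ?(lin0 (AL _ _ _)) ?(lin0 (PL _ _ _)) ?scaler0 //.
  - by rewrite (unital_comm _ _ _ _ _ _ P1 AL).
  - by rewrite -(unital_comm _ _ _ _ _ _ A1 PL).
  rewrite /dualT; case: x y => [i k] [j l] /=.
  rewrite !tildeK !(linZ _ _ (AL _ _ _)) !scalerA.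
  pose c := (-1) ^+ r * th i * th j.
  have -> : (-1) ^+ r.+1 * th i * th j = - c by rewrite exprS /c; ring.
  have -> : th (tilde k) * th j * ((-1) ^+ r * th i * th (tilde k)) = c.
    transitivity (th (tilde k) * th (tilde k) * c); first by rewrite /c; ring.
    by rewrite theta_sq mul1r.
  have -> : th i * th (tilde l) * ((-1) ^+ r * th (tilde l) * th j) = c.
    transitivity (th (tilde l) * th (tilde l) * c); first by rewrite /c; ring.
    by rewrite theta_sq mul1r.
  rewrite -/c !scaleNr !opprK; apply/rtt_arith.
  by rewrite -!scalerBr; congr (_ *: _); apply: Ar.
move=> r s x y w; rewrite !S1M // !S2M //.
congr (_ r s x y w); rewrite -!mulA //.
have APZ Z : mul (S1 A) (mul R' (mul (S2 (dualT A)) Z)) =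
             mul (S2 (dualT A)) (mul R' (mul (S1 A) Z)).
  by have := congr1 (mul^~ Z) AP; rewrite -!mulA //; apply: mul_linear.
have PAZ Z : mul (S1 (dualT A)) (mul R' (mul (S2 A) Z)) =
             mul (S2 A) (mul R' (mul (S1 (dualT A)) Z)).
  by have := congr1 (mul^~ Z) PA; rewrite -!mulA //; apply: mul_linear.
have RPPZ Z : mul R (mul (S1 (dualT A)) (mul (S2 (dualT A)) Z)) =
              mul (S2 (dualT A)) (mul (S1 (dualT A)) (mul R Z)).
  by have := congr1 (mul^~ Z) RPP; rewrite -!mulA //; apply: mul_linear.
have RRZ Z : mul R (mul R' Z) = mul R' (mul R Z) by rewrite !mulA // mul_RR'.
by rewrite APZ RPPZ RRZ RTT PAZ.
Qed.

Definition scalT (f : series K) : ser := fun r i j w => (f r * (i == j)%:R) *: w.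

Lemma scalT_linear f : lin_ser (scalT f).
Proof. by move=> r i j; apply: linear_scale. Qed.

Lemma mul_scalTl f A r i j w :
  mulT (scalT f) A r i j w = \sum_(s < r.+1) f s *: A (r - s)%N i j w.
Proof.
apply: eq_bigr => s _; rewrite -[RHS](sum_delta i (fun k => f s *: A (r - s)%N k j w)).
by apply: eq_bigr => k _; rewrite /scalT scalerA mulrC.
Qed.

Lemma S_twistE f A : S_twist f A = mulT (scalT f) A.
Proof.
apply: eq_ser => r i j w; rewrite mul_scalTl //.
Qed.

Lemma S1_scalT_central f X : lin_mxs X -> mul X (S1 (scalT f)) = mul (S1 (scalT f)) X.
Proof.
move=> XL; apply: eq_mxs => r s [i k] y w; rewrite mul_S1l //; last exact: scalT_linear.
transitivity (\sum_(r1 < r.+1) f r1 *: X (r - r1)%N s (i, k) y w); last first.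
  apply: eq_bigr => r1 _; rewrite -(sum_delta i (fun l => f r1 *: X (r - r1)%N s (l, k) y w)).
  by apply: eq_bigr => l _; rewrite /scalT scalerA mulrC.
rewrite /mxseries_mul (reindex_inj rev_ord_inj); apply: eq_bigr => r1 _.
rewrite big_ord_recr /= big1 ?add0r.
  rewrite subnn subSS subKn ?leq_ord // (bigD1 y) //= big1 ?addr0.
    by rewrite /S1_series /= eqxx scale1r /scalT eqxx mulr1 (linZ _ _ (XL _ _ _ _)).
  move=> z; rewrite /S1_series /scalT; case: z y => [z1 z2] [y1 y2] /=.
  rewrite xpair_eqE negb_and scalerA; case: eqVneq => /= _; case: eqVneq => //= _ _;
  by rewrite ?mulr0 ?mul0r scale0r (lin0 (XL _ _ _ _)).
move=> s1 _; apply: big1 => z _; rewrite /S1_series subn_eq0 leqNgt ltn_ord /=.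
by rewrite scale0r (lin0 (XL _ _ _ _)).
Qed.

Lemma S2_scalT_central f X : lin_mxs X -> mul X (S2 (scalT f)) = mul (S2 (scalT f)) X.
Proof.
move=> XL; apply: eq_mxs => r s [i k] y w; rewrite mul_S2l //; last exact: scalT_linear.
transitivity (\sum_(s1 < s.+1) f s1 *: X r (s - s1)%N (i, k) y w); last first.
  apply: eq_bigr => s1 _; rewrite -(sum_delta k (fun l => f s1 *: X r (s - s1)%N (i, l) y w)).
  by apply: eq_bigr => l _; rewrite /scalT scalerA mulrC.
rewrite /mxseries_mul big_ord_recr /= big1 ?add0r.
  rewrite (reindex_inj rev_ord_inj); apply: eq_bigr => s1 _ /=.
  rewrite subnn subSS subKn ?leq_ord // (bigD1 y) //= big1 ?addr0.
    by rewrite /S2_series /= eqxx scale1r /scalT eqxx mulr1 (linZ _ _ (XL _ _ _ _)).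
  move=> z; rewrite /S2_series /scalT; case: z y => [z1 z2] [y1 y2] /=.
  rewrite xpair_eqE negb_and scalerA; case: eqVneq => /= _; case: eqVneq => //= _ _;
  by rewrite ?mulr0 ?mul0r ?mulr1 ?scale0r (lin0 (XL _ _ _ _)).
move=> r1 _; apply: big1 => s1 _; apply: big1 => z _.
rewrite /S2_series subn_eq0 leqNgt ltn_ord /=.
by rewrite scale0r (lin0 (XL _ _ _ _)).
Qed.

Lemma X_relations_twist f A : lin_ser A -> X_relations G A ->
  X_relations G (S_twist f A).
Proof.
move=> AL XA; have FL := scalT_linear f; have LR := R_linear; have LR' := R'_linear.
have [LA1 LA2] := (S1_linear AL, S2_linear AL).
have [LF1 LF2] := (S1_linear FL, S2_linear FL).
have F1 X Z : lin_mxs X -> mul X (mul (S1 (scalT f)) Z) = mul (S1 (scalT f)) (mul X Z).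
  by move=> XL; rewrite !mulA // S1_scalT_central.
have F2 X Z : lin_mxs X -> mul X (mul (S2 (scalT f)) Z) = mul (S2 (scalT f)) (mul X Z).
  by move=> XL; rewrite !mulA // S2_scalT_central.
move=> r s x y w; rewrite S_twistE !S1M // !S2M //.
congr (_ r s x y w); rewrite -!mulA //.
rewrite (F1 R) // (F2 R') // (F2 (S1 A)) // (F2 R) //.
rewrite (F1 R') // (F1 (S2 A)) // (F2 (S1 (scalT f))) //; congr (mul _ (mul _ _)).
by apply: eq_mxs => r1 s1 x1 y1 w1; apply: XA.
Qed.
End MatrixSeries.

(** * Tensor products of oscillator modules as polynomial rings *)

Section MonomialLift.
Variables (K : fieldType) (N : nat) (U : lmodType K) (h : 'X_{1..N} -> U).

Definition mlift (f : mpoly N K) : U := \sum_(e <- msupp f) f@_e *: h e.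

Lemma mliftEw (D : seq 'X_{1..N}) (f : mpoly N K) :
  uniq D -> {subset msupp f <= D} -> mlift f = \sum_(e <- D) f@_e *: h e.
Proof.
move=> uD sD; rewrite (bigID (mem (msupp f))) /= [X in _ + X]big1 ?addr0.
  rewrite -big_filter; apply: perm_big; apply: uniq_perm.
  - exact: msupp_uniq.
  - exact: filter_uniq.
  by move=> e; rewrite mem_filter; case ef: (e \in msupp f) => //=; rewrite sD.
by move=> e /memN_msupp_eq0 ->; rewrite scale0r.
Qed.

Lemma mlift_linear : linear mlift.
Proof.
move=> c f g; pose D := undup (msupp f ++ msupp g ++ msupp (c *: f + g)).
have uD : uniq D by apply: undup_uniq.
rewrite !(mliftEw uD); try by move=> e ef; rewrite mem_undup !mem_cat ef ?orbT.
rewrite scaler_sumr -big_split; apply: eq_bigr => e _.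
by rewrite mcoeffD mcoeffZ scalerDl scalerA.
Qed.

Lemma mlift_X e : mlift 'X_[e] = h e.
Proof. by rewrite /mlift msuppX big_seq1 mcoeffX eqxx scale1r. Qed.

Lemma eq_on_monomials (f g : mpoly N K -> U) : linear f -> linear g ->
  (forall e, f 'X_[e] = g 'X_[e]) -> f =1 g.
Proof.
move=> fL gL fg p; rewrite [p]mpolyE !lin_sum //; apply: eq_bigr => e _.
by rewrite !linZ // fg.
Qed.
End MonomialLift.

Lemma poly_degreeE (K : fieldType) n :
  @poly_degree K n = mlift (fun e => (mdeg e)%:R *: 'X_[e]).
Proof.
apply/funext => f; apply: eq_bigr => e _; rewrite scalerA mulrC.
by [].
Qed.

Lemma poly_degree_euler (K : fieldType) n (f : mpoly n K) :
  poly_degree f = \sum_i 'X_i * f^`M(i).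
Proof.
rewrite poly_degreeE; move: f; apply: eq_on_monomials; first exact: mlift_linear.
  by apply: linear_sumf => i c f g; rewrite mderiv_is_linear mulrDr scalerAr.
move=> e; rewrite mlift_X mdegE natr_sum scaler_suml; apply: eq_bigr => i _.
rewrite mderivX -scalerAr -mpolyXD; case: (eqVneq (e i) 0%N) => [->|ei].
  by rewrite !scale0r.
congr (_ *: 'X_[_]); apply/mnmP => j; rewrite mnmDE mnmBE mnm1E.
by case: eqP => [<-|_]; rewrite ?subn0 // subnKC // lt0n.
Qed.

Section Rows.
Variables (K : fieldType) (n m : nat).
Local Notation P := (polymn K m n).
Local Notation idx := (@mxvec_index m n).

(** The exponents of a monomial in the variables x_ai are m rows of n. *)
Definition row_mnm (c : 'I_m) (e : 'X_{1..m * n}) : 'X_{1..n} :=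
  [multinom e (idx c i) | i < n].

Definition place (c : 'I_m) (e : 'X_{1..n}) : 'X_{1..m * n} :=
  (\sum_i U_(idx c i) *+ e i)%MM.

Lemma placeE c e d j : place c e (idx d j) = ((d == c) * e j)%N.
Proof.
rewrite /place mnm_sumE (bigD1 j) //= big1 ?addn0; last first.
  by move=> i /negbTE ij; rewrite mulmnE mnm1E mxvec_index_eq ij andbF mul0n.
by rewrite mulmnE mnm1E mxvec_index_eq eqxx andbT eq_sym mulnC mulnC.
Qed.

Lemma mnm_rowsP (e e' : 'X_{1..m * n}) :
  (forall c, row_mnm c e = row_mnm c e') -> e = e'.
Proof.
move=> ee; apply/mnmP => k; case/mxvec_indexP: k => c i.
by have := congr1 (fun u : 'X_{1..n} => u i) (ee c); rewrite !mnmE.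
Qed.

(** Polynomials in x_1, ..., x_n as polynomials in the variables of one row. *)
Definition emb (c : 'I_m) : mpoly n K -> P := mlift (fun e => 'X_[place c e]).

Lemma emb_linear c : linear (emb c).
Proof. exact: mlift_linear. Qed.

Lemma emb_mon c e : emb c 'X_[e] = 'X_[place c e].
Proof. exact: mlift_X. Qed.

Lemma dop_emb c j p : dop c j (emb c p) = emb c p^`M(j).
Proof.
move: p; apply: eq_on_monomials.
- by apply: linear_comp; [apply: dop_linear|apply: emb_linear].
- by apply: (linear_comp (f := fun p : mpoly n K => p^`M(j)));
    [apply: emb_linear|apply: mderiv_is_linear].
move=> e; rewrite mderivX emb_mon /dop mderivX placeE eqxx mul1n.
rewrite (linZ _ _ (emb_linear c)) emb_mon.
congr (_ *: 'X_[_]); apply/mnmP => k; case/mxvec_indexP: k => d i.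
rewrite mnmBE mnm1E !placeE mxvec_index_eq mnmBE mnm1E [c == d]eq_sym.
by case: (d == c); rewrite ?mul1n ?mul0n.
Qed.

Lemma dop_emb_neq c d j p : d != c -> dop d j (emb c p) = 0.
Proof.
move=> /negbTE dc; move: p; apply: eq_on_monomials.
- by apply: linear_comp; [apply: dop_linear|apply: emb_linear].
- exact: linear_cst0.
by move=> e; rewrite emb_mon /dop mderivX placeE dc scale0r.
Qed.

Lemma emb_X c i p : emb c ('X_i * p) = xop c i (emb c p).
Proof.
move: p; apply: eq_on_monomials.
- apply: linear_comp; first exact: emb_linear.
  by move=> k f g; rewrite mulrDr scalerAr.
- by apply: linear_comp; [apply: xop_linear|apply: emb_linear].
move=> e; rewrite -mpolyXD !emb_mon /xop -mpolyXD.
congr 'X_[_]; apply/mnmP => k; case/mxvec_indexP: k => d j.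
rewrite mnmDE mnm1E !placeE mxvec_index_eq mnmDE mnm1E [c == d]eq_sym.
by case: (d == c); rewrite ?mul1n ?mul0n.
Qed.

(** The series of operators by which T(u) acts on the polynomials in the
    variables of row c, inside the polynomials in all the variables. *)
Definition lax (c : 'I_m) (z : K) (r : nat) (i j : 'I_n) (g : P) : P :=
  (series1 K r * (i == j)%:R) *: g + series_inv (- z) r *: xop c i (dop c j g).

Lemma lax_linear c z : lin_ser (lax c z).
Proof.
move=> r i j; apply: linear_addf; first exact: linear_scale.
by apply: linear_scalef; apply: linear_comp; [apply: xop_linear|apply: dop_linear].
Qed.

Lemma lax_unital c z : unital (lax c z).
Proof. by move=> i j w; rewrite /lax mul1r scale0r addr0. Qed.

Lemma xop_dop_comm c d i j k l w : xop c i (dop c j (xop d k (dop d l w))) -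
    xop d k (dop d l (xop c i (dop c j w))) =
  ((c == d) && (j == k))%:R *: xop c i (dop d l w)
  - ((c == d) && (i == l))%:R *: xop d k (dop c j w) :> P.
Proof.
rewrite !dop_xop !(linD _ _ (xop_linear _ _)) !(linZ _ _ (xop_linear _ _)).
rewrite [d == c]eq_sym [l == i]eq_sym xop_comm [dop c j (dop d l w)]dop_comm.
by rewrite opprD addrACA subrr add0r.
Qed.

Let lax_lax c d z z' r s i j k l w :
  lax c z r i j (lax d z' s k l w) =
  (series1 K r * (i == j)%:R * (series1 K s * (k == l)%:R)) *: w
  + (series1 K r * (i == j)%:R * series_inv (- z') s) *: xop d k (dop d l w)
  + (series_inv (- z) r * (series1 K s * (k == l)%:R)) *: xop c i (dop c j w)
  + (series_inv (- z) r * series_inv (- z') s) *: xop c i (dop c j (xop d k (dop d l w))).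
Proof.
rewrite /lax (linD _ _ (dop_linear _ _)) (linD _ _ (xop_linear _ _)).
rewrite !(linZ _ _ (dop_linear _ _)) !(linZ _ _ (xop_linear _ _)).
by rewrite !scalerDr !scalerA !addrA.
Qed.

Let lax_bracket c d z z' r s i j k l w :
  lax c z r i j (lax d z' s k l w) - lax d z' s k l (lax c z r i j w) =
  (series_inv (- z) r * series_inv (- z') s) *:
    (((c == d) && (j == k))%:R *: xop c i (dop d l w)
     - ((c == d) && (i == l))%:R *: xop d k (dop c j w)).
Proof.
rewrite -xop_dop_comm scalerBr !lax_lax.
set X := xop c i (dop c j (xop _ _ _)); set Y := xop d k (dop d l (xop _ _ _)).
rewrite ![series_inv (- z') s * _]mulrC ![series1 K s * _ * _]mulrC.
by rewrite [X in _ - (X + _)]addrAC opprD addrACA subrr add0r.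
Qed.

Lemma lax_comm c d z z' r s i j k l w : c != d ->
  lax c z r i j (lax d z' s k l w) = lax d z' s k l (lax c z r i j w).
Proof.
move=> /negbTE cd; apply/eqP; rewrite -subr_eq0 lax_bracket cd !scale0r subrr.
by rewrite scaler0.
Qed.

(** The operators x_ci d_cj satisfy the relations of the matrix units E_ij of
    gl_n, and T(u) = 1 + E / (u - z) is the evaluation homomorphism. *)
Lemma lax_rtt c z : rtt (lax c z).
Proof.
move=> r s i j k l w; have B r1 s1 := lax_bracket c c z z r1 s1 i j k l w.
apply: etrans (congr2 (fun x y => x - y) (B r.+1 s) (B r s.+1)) _.
rewrite -scalerBl eqxx /=.
rewrite (lax_lax c c z z r s k j i l w) (lax_lax c c z z s r k j i l w).
set X := xop c i _; set Y := xop c k (dop c j w).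
set Z := xop c k (dop c j (xop _ _ _)).
transitivity ((series1 K r * series_inv (- z) s - series1 K s * series_inv (- z) r) *:
    ((j == k)%:R *: X - (i == l)%:R *: Y)).
  congr (_ *: _); case: r s {B} => [|r] [|s]; rewrite /series1 /series_inv /= ?opprK ?exprS ?expr0; ring.
rewrite scalerBr !scalerA [k == j]eq_sym -scaleNr !opprD.
rewrite [RHS](AC (4*4) (1*5*(2*6)*(3*7)*(4*8))) /= -!scalerBl.
rewrite [X in _ = X *: w + _ + _ + _](_ : _ = 0); last by ring.
rewrite [X in _ = _ + X *: Z](_ : _ = 0); last by ring.
by rewrite !scale0r add0r addr0; congr (_ *: _ + _ *: _); ring.
Qed.

Definition free_of c (g : P) := forall j, dop c j g = 0.

Lemma dop_embM c j p g : free_of c g -> dop c j (emb c p * g) = emb c p^`M(j) * g.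
Proof.
by move=> gc; rewrite {1}/dop mderivM -!/(dop _ _ _) dop_emb gc mulr0 addr0.
Qed.

Lemma dop_embM_neq c d j p g : d != c -> dop d j (emb c p * g) = emb c p * dop d j g.
Proof.
by move=> dc; rewrite {1}/dop mderivM -!/(dop _ _ _) dop_emb_neq // mul0r add0r.
Qed.

Lemma xop_embM c d i p g : xop d i (emb c p * g) = emb c p * xop d i g.
Proof. exact: mulrCA. Qed.

Lemma xop_dop_embM c i j p g : free_of c g ->
  xop c i (dop c j (emb c p * g)) = emb c ('X_i * p^`M(j)) * g.
Proof. by move=> gc; rewrite dop_embM // emb_X /xop mulrA. Qed.

(** Derivatives in the variables of row c see only the first factor. *)
Lemma lax_embM c z r i j p g : free_of c g ->
  lax c z r i j (emb c p * g) = emb c (@Top _ _ (P_module n z) r i j p) * g.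
Proof.
move=> gc; rewrite /lax xop_dop_embM // (linD _ _ (emb_linear c)).
by rewrite !(linZ _ _ (emb_linear c)) mulrDl !scalerAl.
Qed.

Lemma lax_embM_neq c d z r i j p g : d != c ->
  lax d z r i j (emb c p * g) = emb c p * lax d z r i j g.
Proof.
move=> dc; rewrite /lax dop_embM_neq // xop_embM mulrDr.
by rewrite !scalerAr.
Qed.

Lemma free_of1 c : free_of c 1.
Proof. by move=> j; rewrite /dop -mpolyC1 mderivC. Qed.

Lemma free_of_embM c d p g : c != d -> free_of c g -> free_of c (emb d p * g).
Proof. by move=> cd gc j; rewrite dop_embM_neq // gc mulr0. Qed.
End Rows.

(** Tensors become products when the factor with parameter z a is realized in the
    variables of [row a]. *)
Section TensorModule.
Variables (K : fieldType) (n m : nat) (z : nat -> K) (row : nat -> 'I_m) (top : nat).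
Hypothesis row_inj : {in [pred a | a <= top]%N &, injective row}.
Local Notation P := (polymn K m n).
Local Notation PT := (P_tensor n z).

Fixpoint tens_poly k : PT k -> P :=
  match k return PT k -> P with
  | 0%N => emb (row 0%N)
  | k'.+1 => tlift (fun (p : P_module n (z k'.+1)) (s : PT k') =>
                      emb (row k'.+1) p * tens_poly s)
  end.
Arguments tens_poly : clear implicits.

Lemma mulP_linearr (q : P) : linear ( *%R q).
Proof. by move=> c f g; rewrite mulrDr scalerAr. Qed.

Lemma mulP_linearl (q : P) : linear (fun f : P => f * q).
Proof. by move=> c f g; rewrite mulrDl scalerAl. Qed.

Lemma tens_poly_linear k : linear (tens_poly k).
Proof.
elim: k => [|k IH]; first exact: emb_linear.
apply: tlift_linear => [s|p].
  exact: (linear_comp (mulP_linearl _) (emb_linear _)).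
exact: (linear_comp (mulP_linearr _) IH).
Qed.

Lemma tens_polyS k p s : tens_poly k.+1 (tens p s) = emb (row k.+1) p * tens_poly k s.
Proof.
apply: tlift_tens => [s'|p'].
  exact: (linear_comp (mulP_linearl _) (emb_linear _)).
exact: (linear_comp (mulP_linearr _) (@tens_poly_linear k)).
Qed.

Lemma row_neq a b : (a <= top)%N -> (b <= top)%N -> a != b -> row a != row b.
Proof. by move=> at_ bt; apply: contra_neq; apply: row_inj. Qed.

Lemma tens_poly_free k a t : (k < a <= top)%N -> free_of (row a) (tens_poly k t).
Proof.
elim: k t => [|k IH] t /andP[ka at_] j.
  apply: dop_emb_neq; apply: row_neq => //; lia.
move: t; apply: eq_tensor; [|exact: linear_cst0|].
  exact: (linear_comp (dop_linear _ _) (@tens_poly_linear k.+1)).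
move=> p s; rewrite tens_polyS; apply: free_of_embM; first by apply: row_neq => //; lia.
by apply: IH; lia.
Qed.

(** The iterated comultiplication of T(u). *)
Fixpoint monodromy k : nat -> 'I_n -> 'I_n -> P -> P :=
  if k is k'.+1 then mulT (lax (row k) (z k)) (monodromy k')
  else lax (row 0%N) (z 0%N).

Lemma monodromy_linear k : lin_ser (monodromy k).
Proof.
by elim: k => [|k IH]; [|apply: mulT_linear => //]; apply: lax_linear.
Qed.

Lemma monodromy_unital k : unital (monodromy k).
Proof.
by elim: k => [|k IH]; [|apply: mulT_unital => //]; apply: lax_unital.
Qed.

Lemma mulT_comm (H : P -> P) (A B : nat -> 'I_n -> 'I_n -> P -> P) : linear H ->
  (forall r i j w, H (A r i j w) = A r i j (H w)) ->
  (forall r i j w, H (B r i j w) = B r i j (H w)) ->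
  forall r i j w, H (mulT A B r i j w) = mulT A B r i j (H w).
Proof.
move=> HL HA HB r i j w; rewrite (lin_sum _ _ _ HL).
apply: eq_bigr => s _; rewrite (lin_sum _ _ _ HL); apply: eq_bigr => k _.
by rewrite HA HB.
Qed.

Lemma lax_monodromy_comm k a z' r s i j k' l w : (k < a <= top)%N ->
  lax (row a) z' r i j (monodromy k s k' l w) = monodromy k s k' l (lax (row a) z' r i j w).
Proof.
elim: k r s i j k' l w => [|k IH] r s i j k' l w /andP[ka at_].
  by apply: lax_comm; apply: row_neq => //; lia.
apply: mulT_comm; first exact: lax_linear.
  by move=> *; apply: lax_comm; apply: row_neq => //; lia.
by move=> *; apply: IH; lia.
Qed.

Lemma monodromy_rtt k : (k <= top)%N -> rtt (monodromy k).
Proof.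
elim: k => [|k IH] kt; first exact: lax_rtt.
apply: mulT_rtt.
- exact: lax_linear.
- exact: monodromy_linear.
- exact: lax_unital.
- exact: monodromy_unital.
- by move=> *; apply: lax_monodromy_comm; rewrite leqnn.
- exact: lax_rtt.
by apply: IH; apply: ltnW.
Qed.

Lemma monodromy_embM k a r i j p g : (k < a <= top)%N ->
  monodromy k r i j (emb (row a) p * g) = emb (row a) p * monodromy k r i j g.
Proof.
elim: k r i j g => [|k IH] r i j g /andP[ka at_].
  by apply: lax_embM_neq; apply: row_neq => //; lia.
rewrite /= /mulT mulr_sumr; apply: eq_bigr => s _; rewrite mulr_sumr.
apply: eq_bigr => l _; rewrite IH; last by lia.
by apply: lax_embM_neq; apply: row_neq => //; lia.
Qed.

Lemma Top_P_linear z' r i j : linear (@Top K n (P_module n z') r i j).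
Proof.
apply: linear_addf; first exact: linear_scale.
apply: linear_scalef => c f g; rewrite mderiv_is_linear mulrDr scalerAr.
by [].
Qed.

Lemma Top_linear k r i j : linear (@Top K n (PT k) r i j).
Proof.
elim: k r i j => [|k IH] r i j; first exact: Top_P_linear.
apply: linear_sumf => s; apply: linear_sumf => l.
by apply: tmap_is_linear; [apply: Top_P_linear|apply: IH].
Qed.

Lemma Top_tens k r i j p s : @Top K n (PT k.+1) r i j (tens p s) =
  \sum_(t < r.+1) \sum_l tens (@Top K n (P_module n (z k.+1)) t i l p)
                              (@Top K n (PT k) (r - t)%N l j s).
Proof.
apply: eq_bigr => t _; apply: eq_bigr => l _.
by apply: tmap_tens; [apply: Top_P_linear|apply: Top_linear].
Qed.

Lemma tens_poly_Top k r i j t : (k <= top)%N ->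
  tens_poly k (Top r i j t) = monodromy k r i j (tens_poly k t).
Proof.
elim: k r i j t => [|k IH] r i j t kt.
  have := @lax_embM K n m (row 0%N) (z 0%N) r i j t 1 (free_of1 _ _).
  by rewrite !mulr1.
move: t; apply: eq_tensor.
- exact: (linear_comp (@tens_poly_linear k.+1) (@Top_linear k.+1 r i j)).
- exact: (linear_comp (@monodromy_linear k.+1 r i j) (@tens_poly_linear k.+1)).
move=> p s.
apply: etrans (congr1 _ (Top_tens r i j p s)) _.
apply: etrans (lin_sum _ _ _ (@tens_poly_linear k.+1)) _.
rewrite tens_polyS /= /mulT; apply: eq_bigr => u _.
apply: etrans (lin_sum _ _ _ (@tens_poly_linear k.+1)) _; apply: eq_bigr => l _.
apply: etrans (tens_polyS _ _) _; rewrite IH; last exact: ltnW.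
rewrite monodromy_embM ?leqnn //; symmetry; apply: lax_embM.
rewrite -IH; last exact: ltnW.
by apply: tens_poly_free; rewrite leqnn.
Qed.

Lemma poly_degree_linear : linear (@poly_degree K n).
Proof. by rewrite poly_degreeE; apply: mlift_linear. Qed.

Lemma P_degree_linear k a : linear (@P_degree K n z k a).
Proof.
elim: k => [|k IH] /=; first exact: poly_degree_linear.
by case: eqP => _; apply: tmap_is_linear => //; apply: poly_degree_linear.
Qed.

Definition row_degree c (g : P) := \sum_i xop c i (dop c i g).

Lemma row_degree_linear c : linear (row_degree c).
Proof.
by apply: linear_sumf => i; apply: linear_comp; [apply: xop_linear|apply: dop_linear].
Qed.

Lemma row_degree_embM c p g : free_of c g ->
  row_degree c (emb c p * g) = emb c (poly_degree p) * g.
Proof.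
move=> gc; rewrite /row_degree poly_degree_euler (lin_sum _ _ _ (emb_linear c)) [RHS]mulr_suml.
by apply: eq_bigr => i _; exact: (xop_dop_embM i i p gc).
Qed.

Lemma tens_poly_degree k a t : (k <= top)%N -> (a <= k)%N ->
  tens_poly k (@P_degree K n z k a t) = row_degree (row a) (tens_poly k t).
Proof.
elim: k t => [|k IH] t kt ak.
  have -> : a = 0%N by lia.
  have := @row_degree_embM (row 0%N) t 1 (free_of1 _ _).
  by rewrite !mulr1.
move: t; apply: eq_tensor.
- exact: (linear_comp (@tens_poly_linear k.+1) (@P_degree_linear k.+1 a)).
- exact: (linear_comp (row_degree_linear (row a)) (@tens_poly_linear k.+1)).
move=> p s; rewrite tens_polyS /=; case: (eqVneq a k.+1) => [->|ak1].
  apply: etrans (congr1 (tens_poly k.+1) (tmap_tens poly_degree_linear (@linear_idfun _ _) p s)) _.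
  apply: etrans (tens_polyS _ _) _; rewrite row_degree_embM //.
  by apply: tens_poly_free; rewrite leqnn.
apply: etrans (congr1 (tens_poly k.+1)
  (tmap_tens (@linear_idfun _ _) (@P_degree_linear k a) p s)) _.
apply: etrans (tens_polyS _ _) _; rewrite IH; [|lia|lia].
apply: etrans (mulr_sumr _ _ _ _) _; apply: eq_bigr => i _.
by rewrite dop_embM_neq ?xop_embM //; apply: row_neq => //; lia.
Qed.

Fixpoint ptens (d : nat -> 'X_{1..n}) k : PT k :=
  match k return PT k with
  | 0%N => 'X_[d 0%N] : P_module n (z 0%N)
  | k'.+1 => tens ('X_[d k'.+1] : P_module n (z k'.+1)) (ptens d k')
  end.

Lemma eq_ptens d d' k : (forall a, (a <= k)%N -> d a = d' a) -> ptens d k = ptens d' k.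
Proof.
elim: k => [|k IH] dd'; first by apply: (congr1 (fun e => 'X_[e])); apply: dd'.
apply: (congr2 (fun e s => tens 'X_[e] s)); first exact: dd'.
by apply: IH => a ak; apply: dd'; apply: ltnW.
Qed.

(** Tensors of monomials span; on them both maps between the tensor product and
    the polynomial ring are explicit. *)
Lemma eq_on_ptens (U : lmodType K) k (f g : PT k -> U) : linear f -> linear g ->
  (forall d, f (ptens d k) = g (ptens d k)) -> f =1 g.
Proof.
elim: k f g => [|k IH] f g fL gL fg.
  by apply: eq_on_monomials => // e; apply: (fg (fun=> e)).
apply: eq_tensor => // p s; move: p.
apply: eq_on_monomials.
- exact: (linear_comp fL (tens_linearl s)).
- exact: (linear_comp gL (tens_linearl s)).
move=> e; move: s; apply: IH.
- exact: (linear_comp fL (@tens_linearr K (P_module n (z k.+1)) (PT k) 'X_[e])).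
- exact: (linear_comp gL (@tens_linearr K (P_module n (z k.+1)) (PT k) 'X_[e])).
move=> d; pose d' a := if a == k.+1 then e else d a.
have -> : ptens d k = ptens d' k.
  by apply: eq_ptens => a ak; rewrite /d' ltn_eqF.
by have := fg d'; rewrite /= {1 3}/d' eqxx.
Qed.

Definition rows_mnm (d : nat -> 'X_{1..n}) k : 'X_{1..m * n} :=
  (\sum_(a < k.+1) place (row a) (d a))%MM.

Lemma tens_poly_ptens d k : tens_poly k (ptens d k) = 'X_[rows_mnm d k].
Proof.
elim: k => [|k IH]; first by rewrite /= emb_mon /rows_mnm big_ord1.
apply: etrans (tens_polyS _ _) _.
by rewrite emb_mon IH -mpolyXD /rows_mnm [in RHS]big_ord_recr /= addmC.
Qed.

Lemma row_rows_mnm d k a : (k <= top)%N -> (a <= k)%N ->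
  row_mnm (row a) (rows_mnm d k) = d a.
Proof.
move=> kt ak; apply/mnmP => i; rewrite mnmE mnm_sumE.
have ak1 : (a < k.+1)%N by [].
rewrite (bigD1 (Ordinal ak1)) //= placeE eqxx mul1n big1 ?addn0 // => b.
rewrite -val_eqE /= => ba; rewrite placeE (negbTE (row_neq _ _ _)) ?mul0n //; first by lia.
  by have := ltn_ord b; lia.
by rewrite eq_sym.
Qed.

Definition poly_tens k : P -> PT k :=
  mlift (fun e => ptens (fun a => row_mnm (row a) e) k).

Lemma poly_tens_linear k : linear (@poly_tens k).
Proof. exact: mlift_linear. Qed.

Lemma tens_polyK k : (k <= top)%N -> cancel (tens_poly k) (@poly_tens k).
Proof.
move=> kt; apply: eq_on_ptens.
- exact: (linear_comp (@poly_tens_linear k) (@tens_poly_linear k)).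
- exact: linear_idfun.
move=> d; rewrite tens_poly_ptens /poly_tens mlift_X.
by apply: eq_ptens => a ak; apply: row_rows_mnm.
Qed.

Lemma poly_tensK : (forall c, exists2 a, (a <= top)%N & row a = c) ->
  cancel (@poly_tens top) (tens_poly top).
Proof.
move=> row_surj; apply: eq_on_monomials.
- exact: (linear_comp (@tens_poly_linear top) (@poly_tens_linear top)).
- exact: linear_idfun.
move=> e; rewrite /poly_tens mlift_X tens_poly_ptens; congr 'X_[_].
apply: mnm_rowsP => c; have [a at_ <-] := row_surj c.
by rewrite row_rows_mnm.
Qed.

End TensorModule.

(** * Products of series of operators *)

Section SeriesProducts.
Variables (K : fieldType) (G : classical_group) (n : nat) (V : lmodType K).
Local Notation ser := (nat -> 'I_n -> 'I_n -> V -> V).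
Local Notation scalT := (@scalT K n V).
Local Notation dualT := (@dualT K G n V).
Implicit Types (A B : ser).

Lemma mulT_scalT f g : mulT (scalT f) (scalT g) = scalT (series_mul f g).
Proof.
apply: eq_ser => r i j w; rewrite mul_scalTl /scalT /series_mul mulr_suml scaler_suml.
by apply: eq_bigr => s _; rewrite scalerA mulrA.
Qed.

Lemma scalT_central f A : lin_ser A -> mulT A (scalT f) = mulT (scalT f) A.
Proof.
move=> AL; apply: eq_ser => r i j w; rewrite mul_scalTl /mulT (reindex_inj rev_ord_inj).
apply: eq_bigr => s _; rewrite /scalT (bigD1 j) //= big1 ?addr0.
  by rewrite eqxx mulr1 subSS subKn ?leq_ord // (linZ _ _ (AL _ _ _)).
by move=> k /negbTE kj; rewrite kj mulr0 scale0r (lin0 (AL _ _ _)).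
Qed.

Lemma prodT_scalT (f : nat -> series K) k :
  prodT (fun j => scalT (f j)) k = scalT (\big[@series_mul K/series1 K]_(j < k) f j).
Proof.
elim: k f => [|k IH] f.
  rewrite big_ord0; apply: eq_ser => r i j w; rewrite /= /oneT /scalT /series1.
  by case: eqP; case: eqP; rewrite ?mulr1 ?mulr0.
rewrite prodT_recl; last by move=> j; apply: scalT_linear.
by rewrite IH mulT_scalT big_ord_recl.
Qed.

Lemma prodT_scal_mul (f : nat -> series K) (F : nat -> ser) k :
  (forall j, lin_ser (F j)) ->
  prodT (fun j => mulT (scalT (f j)) (F j)) k =
  mulT (prodT (fun j => scalT (f j)) k) (prodT F k).
Proof.
move=> FL; have SL j := @scalT_linear K n V (f j).
elim: k => [|k IH] /=; first by rewrite mul1T.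
have PL := prodT_linear k FL; have QL := prodT_linear k SL.
rewrite IH -[LHS]mulTA // -[RHS]mulTA // !(mulTA _ _ PL) (mulTA _ _ (SL k)).
by rewrite (scalT_central _ PL).
Qed.

Lemma prodT_unital (F : nat -> ser) k : (forall j, unital (F j)) -> unital (prodT F k).
Proof.
move=> F1; elim: k => [|k IH] /=; last exact: mulT_unital.
by move=> i j w; rewrite /oneT.
Qed.

(** Transposition reverses the products of matrices with commuting entries. *)
Lemma dualTM A B : lin_ser A -> lin_ser B ->
  (forall r s i j k l w, A r i j (B s k l w) = B s k l (A r i j w)) ->
  dualT (mulT A B) = mulT (dualT B) (dualT A).
Proof.
move=> AL BL AB; apply: eq_ser => r i j w; rewrite /dualT /mulT scaler_sumr.
rewrite (reindex_inj rev_ord_inj); apply: eq_bigr => s _ /=.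
rewrite (reindex_inj (inv_inj (@tildeK n))) scaler_sumr; apply: eq_bigr => k _.
rewrite subSS subKn ?leq_ord // AB (linZ _ _ (BL _ _ _)) !scalerA; congr (_ *: _).
rewrite -{1}(subnKC (leq_ord s)) exprD.
transitivity ((-1) ^+ s * (-1) ^+ (r - s) * (theta K G k * theta K G k) * theta K G i * theta K G j).
  by rewrite theta_sq mulr1.
by ring.
Qed.

End SeriesProducts.

(** (1 - 1 / (u + c + 1)) / (u + c) = 1 / (u + c + 1). *)
Lemma series_fac_inv (K : fieldType) (c : K) r :
  \sum_(s < r.+1) series_fac (c + 1) s * series_inv c (r - s)%N = series_inv (c + 1) r.
Proof.
case: r => [|r]; first by rewrite big_ord1 mulr0.
rewrite big_ord_recr /= subnn mulr0 addr0.
transitivity (\sum_(s < r.+1) series_fac (c + 1) s * (- c) ^+ (r - s)).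
  by apply: eq_bigr => s _; rewrite subSn ?leq_ord.
elim: r => [|r IH].
  by rewrite big_ord1 /series_fac /series_inv /series1 /= subr0 mulr1.
rewrite big_ord_recr /= subnn expr0 mulr1.
transitivity (- c * \sum_(s < r.+1) series_fac (c + 1) s * (- c) ^+ (r - s)
  + series_fac (c + 1) r.+1).
  congr (_ + _); rewrite mulr_sumr; apply: eq_bigr => s _.
  by rewrite subSn ?leq_ord // exprS mulrCA.
rewrite IH /series_fac /series1 /series_inv sub0r exprS.
by ring.
Qed.

(** * The coinvariants as a product of oscillator modules *)

Section Factorization.
Variables (K : fieldType) (G : classical_group) (n m' : nat).
Hypothesis n_even : G = Symplectic -> ~~ odd n.
Hypothesis two_neq0 : 2%:R != 0 :> K.
Local Notation m := m'.+1.
Local Notation N := (m + m)%N.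
Variable mu : weight K G m.
Local Notation P := (polymn K m n).
Local Notation pop := (@pop K G m n).
Local Notation qop := (@qop K G m n).
Local Notation half := (pm K G / 2%:R).
Local Notation h := (pm K G / 2%:R + m%:R).
Local Notation wt := (fun d : 'I_N => weight_ext mu (Fel K G d d)).
Local Notation dualT := (@dualT K G n P).
Local Notation th := (theta K G).

(** The tensor factor with label mu_a is counted from the right, and corresponds
    to the element F_(m-a+1)(m-a+1), hence to the variables of that row. *)
Definition factor_row (a : nat) : 'I_m := rev_ord (inord a).

Lemma factor_row_inj : {in [pred a | a <= m']%N &, injective factor_row}.
Proof.
move=> a b am bm /rev_ord_inj /(congr1 val) /=.
by rewrite !inordK.
Qed.

Lemma factor_row_rev c : factor_row (rev_ord c) = c.
Proof. by rewrite /factor_row inord_val rev_ordK. Qed.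

Lemma factor_row_surj c : exists2 a, (a <= m')%N & factor_row a = c.
Proof. by exists (rev_ord c); [rewrite -ltnS|apply: factor_row_rev]. Qed.

Variable za : nat -> K.
Hypothesis zaE : forall a : 'I_m, za a = wlabel mu a + half + (m - a.+1)%:R.
Local Notation L := (fun a => @lax K n m (factor_row a) (za a)).
Local Notation T := (@monodromy K n m za factor_row).
Local Notation F := (rev_factor pop qop (@Fmx K G m) h wt).
Local Notation fac := (fun a : nat => series_fac (za a + 1)).

(** At a negative index p q is x d/dx, in the order of the oscillator module. *)
Lemma factor_lax (a : 'I_m) : F (m + rev_ord a) = L a.
Proof.
have aN : (N - (m + rev_ord a).+1)%N = a by have := ltn_ord a; rewrite /=; lia.
have aI : (a < N)%N := ltn_addr _ (ltn_ord a).
apply: eq_ser => r i j g; rewrite /rev_factor aN (insubT (fun k => k < N)%N aI) /=.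
have -> : Sub (a : nat) aI = lshift m a by apply: val_inj.
have R : factor_row a = rev_ord a by rewrite /factor_row inord_val.
rewrite /factor /lax R.
case: r => [|r]; first by rewrite mul1r scale0r addr0.
rewrite /series1 mul0r scale0r add0r /series_inv opprK pop_lshift qop_lshift.
congr (_ ^+ _ *: _); rewrite (shifted_weightE n_even two_neq0) (weight_ext_lshift mu) zaE /= ltn_ord.
have -> : (N - a.+1 = m + (m - a.+1))%N by have := ltn_ord a; lia.
rewrite natrD.
have H : pm K G = half + half by rewrite -[LHS](divfK two_neq0) mulr_natr mulr2n.
rewrite {1}H; ring.
Qed.

Lemma dualT_laxE a r i j g : dualT (L a) r i j g =
  (series1 K r * (i == j)%:R) *: g - (series_inv (za a) r * (th i * th j)) *:
    xop (factor_row a) (tilde j) (dop (factor_row a) (tilde i) g).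
Proof.
rewrite /dualT /lax scalerDr !scalerA -scaleNr (inj_eq (inv_inj (@tildeK n))).
rewrite [j == i]eq_sym; congr (_ *: _ + _ *: _).
  case: r => [|r]; last by rewrite /series1 !mul0r mulr0.
  by case: eqP => [->|_]; rewrite ?mulr0 // expr0 !mul1r theta_sq mulr1.
case: r => [|r] /=; first by rewrite mulr0 mul0r oppr0.
by rewrite opprK exprS [(- za a) ^+ r]exprNn; ring.
Qed.

(** At a positive index p q is - d/dx x up to signs and tilde; reordering it as
    - x d/dx - 1 costs the scalar series with parameter za a + 1. *)
Lemma factor_dual_lax (a : 'I_m) : F a = mulT (scalT (fac a)) (dualT (L a)).
Proof.
pose c := rev_ord a.
have aN : (N - a.+1)%N = (m + c)%N by have := ltn_ord a; rewrite /=; lia.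
have aI : (m + c < N)%N by rewrite ltn_add2l.
apply: eq_ser => r i j g; rewrite /rev_factor aN (insubT (fun k => k < N)%N aI) /=.
have -> : Sub (m + c)%N aI = rshift m c by apply: val_inj.
have R : factor_row a = c by rewrite /factor_row inord_val.
pose X := xop c (tilde j) (dop c (tilde i) g).
have -> : mulT (scalT (fac a)) (dualT (L a)) r i j g =
    (fac a r * (i == j)%:R) *: g - (series_inv (za a + 1) r * (th i * th j)) *: X.
  rewrite mul_scalTl; under eq_bigr do rewrite dualT_laxE R scalerBr !scalerA.
  rewrite sumrB -!scaler_suml; congr (_ *: _ - _ *: _).
    rewrite big_ord_recr /= big1 ?add0r ?subnn ?mul1r // => s _.
    by rewrite /series1 subn_eq0 leqNgt ltn_ord mul0r mulr0.
  rewrite -series_fac_inv mulr_suml; apply: eq_bigr => s _; exact: mulrA.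
rewrite /factor; case: r => [|r].
  by rewrite /series_fac /series1 subr0 mul1r mul0r scale0r subr0.
rewrite pop_rshift qop_rshift (linZ _ _ (dop_linear _ _)) dop_xop eqxx /= -/X.
rewrite (inj_eq (inv_inj (@tildeK n))) !scalerDr !scalerA addrC -scaleNr.
have swE : shifted_weight (@Fmx K G m) h wt (rshift m c) = - (za a + 1).
  rewrite (shifted_weightE n_even two_neq0) (weight_ext_rshift mu) rev_ordK zaE.
  rewrite ltnNge leq_addr /= addr0.
  have -> : (N - (m + c).+1 = a)%N by have := ltn_ord a; rewrite /=; lia.
  have -> : m%:R = a%:R + 1 + (m - a.+1)%:R :> K.
    by rewrite -[1]/(1%:R) -!natrD; congr (_%:R); have := ltn_ord a; lia.
  by ring.
rewrite swE /series_fac /series1 sub0r /series_inv; congr (_ *: _ + _ *: _); last by ring.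
case: eqP => [->|_]; last by rewrite !mulr0.
by rewrite !mulr1 mulrN mulNr -mulrA theta_sq mulr1.
Qed.

Lemma prodT_lax k : prodT (fun j => L (k - j)%N) k.+1 = T k.
Proof.
elim: k => [|k IH]; first by rewrite /= mul1T.
rewrite prodT_recl; last by move=> j; apply: lax_linear.
have -> : T k.+1 = mulT (L k.+1) (T k) by [].
by rewrite subn0 -IH; congr (mulT _ _); apply: eq_prodT => j _; rewrite subSS.
Qed.

Lemma prodT_dual_lax k : (k <= m')%N -> prodT (fun j => dualT (L j)) k.+1 = dualT (T k).
Proof.
elim: k => [|k IH] km; first by rewrite /= mul1T.
apply: etrans (congr1 (fun A => mulT A _) (IH (ltnW km))) _.
symmetry; apply: dualTM; [exact: lax_linear|exact: monodromy_linear|].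
move=> r s i j k1 l w; apply: (@lax_monodromy_comm K n m za factor_row m' factor_row_inj).
by rewrite leqnn.
Qed.

(** The factors with positive index come first and give f(u) T'(-u), those with
    negative index give T(u). *)
Lemma prodT_factors : prodT F N =
  S_twist (\big[@series_mul K/series1 K]_(a < m) fac a) (mulT (dualT (T m')) (T m')).
Proof.
rewrite prodT_add; last first.
  by move=> j; apply: rev_factor_linear; [apply: pop_linear|apply: qop_linear].
have -> : prodT F m = prodT (fun j => mulT (scalT (fac j)) (dualT (L j))) m.
  by apply: eq_prodT => j jm; apply: (factor_dual_lax (Ordinal jm)).
have -> : prodT (fun j => F (m + j)%N) m = T m'.
  rewrite -prodT_lax; apply: eq_prodT => j jm.
  have := factor_lax (rev_ord (Ordinal jm)); rewrite rev_ordK /= => ->.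
  by rewrite subSS.
rewrite prodT_scal_mul; last by move=> j; apply: dualT_linear; apply: lax_linear.
rewrite prodT_scalT prodT_dual_lax // S_twistE -mulTA //.
exact: scalT_linear.
Qed.
End Factorization.

(** * Transport of bimodules *)

Section Transport.
Variables (K : fieldType) (G : classical_group) (n m : nat).
Variables (B B0 : bimodule K m n) (phi : B -> B0) (psi : B0 -> B).
Hypotheses (phiL : linear phi) (phiK : cancel phi psi) (psiK : cancel psi phi).
Hypothesis phiS : forall r i j w, phi (Sop r i j w) = Sop r i j (phi w).
Hypothesis phiH : forall a w, phi (Hop a w) = Hop a (phi w).
Local Notation I2 := ('I_n * 'I_n)%type.

Lemma transport_linear : linear psi.
Proof. by move=> c x y; rewrite -[RHS]phiK phiL !psiK. Qed.

Lemma mul_transport (X Y : nat -> nat -> I2 -> I2 -> B -> B)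
    (X0 Y0 : nat -> nat -> I2 -> I2 -> B0 -> B0) :
  (forall r s x y w, phi (X r s x y w) = X0 r s x y (phi w)) ->
  (forall r s x y w, phi (Y r s x y w) = Y0 r s x y (phi w)) ->
  forall r s x y w, phi (@mxseries_mul K n B X Y r s x y w) =
    @mxseries_mul K n B0 X0 Y0 r s x y (phi w).
Proof.
move=> hX hY r s x y w; rewrite (lin_sum _ _ _ phiL); apply: eq_bigr => r1 _.
rewrite (lin_sum _ _ _ phiL); apply: eq_bigr => s1 _.
by rewrite (lin_sum _ _ _ phiL); apply: eq_bigr => u _; rewrite hX hY.
Qed.

Let phiZ c w : phi (c *: w) = c *: phi w. Proof. exact: linZ. Qed.

Lemma R_transport r s x y w : phi (@R_series K n B r s x y w) = @R_series K n B0 r s x y (phi w).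
Proof. by case: r s => [|[|r]] [|[|s]] //=; rewrite ?phiZ ?(lin0 phiL). Qed.

Lemma R'_transport r s x y w :
  phi (@R'_series K G n B r s x y w) = @R'_series K G n B0 r s x y (phi w).
Proof. by case: r s => [|[|r]] [|[|s]] //=; rewrite ?phiZ ?(lin0 phiL). Qed.

Lemma S1_transport r s x y w : phi (@S1_series K n B (@Sop K m n B) r s x y w) =
  @S1_series K n B0 (@Sop K m n B0) r s x y (phi w).
Proof. by rewrite /S1_series phiZ phiS. Qed.

Lemma S2_transport r s x y w : phi (@S2_series K n B (@Sop K m n B) r s x y w) =
  @S2_series K n B0 (@Sop K m n B0) r s x y (phi w).
Proof. by rewrite /S2_series phiZ phiS. Qed.

Lemma is_bimodule_transport : is_bimodule G B0 -> is_bimodule G B.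
Proof.
have phiI := can_inj phiK.
case=> [[SL HL] S0 X0 HH HS]; split.
- split=> [r i j|a] c x y; apply: phiI.
    by rewrite phiL !phiS phiL SL.
  by rewrite phiL !phiH phiL HL.
- by move=> i j w; apply: phiI; rewrite phiS S0 phiZ.
- move=> r s x y w; apply: phiI.
  have R := R_transport; have R' := R'_transport.
  have S1 := S1_transport; have S2 := S2_transport.
  apply: etrans (mul_transport R (mul_transport S1 (mul_transport R' S2)) r s x y w) _.
  apply: etrans (X0 r s x y (phi w)) _; symmetry.
  exact: (mul_transport S2 (mul_transport R' (mul_transport S1 R)) r s x y w).
- by move=> a b w; apply: phiI; rewrite !phiH HH.
by move=> a r i j w; apply: phiI; rewrite phiH !phiS phiH HS.
Qed.

End Transport.

(** The axioms are verified in the third bimodule, from which both others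
    inherit them. *)
Lemma bimodule_equiv_common (K : fieldType) (G : classical_group) (n m : nat)
    (B1 B2 B0 : bimodule K m n)
    (phi1 : B1 -> B0) (psi1 : B0 -> B1) (phi2 : B2 -> B0) (psi2 : B0 -> B2) :
  linear phi1 -> cancel phi1 psi1 -> cancel psi1 phi1 ->
  (forall r i j w, phi1 (Sop r i j w) = Sop r i j (phi1 w)) ->
  (forall a w, phi1 (Hop a w) = Hop a (phi1 w)) ->
  linear phi2 -> cancel phi2 psi2 -> cancel psi2 phi2 ->
  (forall r i j w, phi2 (Sop r i j w) = Sop r i j (phi2 w)) ->
  (forall a w, phi2 (Hop a w) = Hop a (phi2 w)) ->
  is_bimodule G B0 -> bimodule_equiv G B1 B2.
Proof.
move=> L1 K1 K1' S1 H1 L2 K2 K2' S2 H2 B0P; split.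
- exact: is_bimodule_transport L1 K1 S1 H1 B0P.
- exact: is_bimodule_transport L2 K2 S2 H2 B0P.
pose phi := psi2 \o phi1.
have phiL : linear phi := linear_comp (transport_linear L2 K2 K2') L1.
exists (HB.pack_for {linear B1 -> B2} phi (GRing.isLinear.Build K B1 B2 *:%R phi phiL)).
split=> /=.
- exists (psi1 \o phi2) => w /=; rewrite /phi /=; first by rewrite K2' K1.
  by rewrite K1' K2.
- by move=> r i j w; apply: (can_inj K2); rewrite S2 /phi /= !K2' S1.
by move=> a w; apply: (can_inj K2); rewrite H2 /phi /= !K2' H1.
Qed.

(** * The equivalence *)

Section Common.
Variables (K : fieldType) (G : classical_group) (n m' : nat).
Hypothesis n_even : G = Symplectic -> ~~ odd n.
Hypothesis two_neq0 : 2%:R != 0 :> K.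
Local Notation m := m'.+1.
Variables (mu : weight K G m) (za : nat -> K).
Hypothesis zaE : forall a : 'I_m,
  za a = wlabel mu a + pm K G / 2%:R + (m - a.+1)%:R.
Local Notation P := (polymn K m n).
Local Notation T := (@monodromy K n m za (@factor_row m') m').
Local Notation f := (\big[@series_mul K/series1 K]_(a < m) series_fac (za a + 1)).

Definition poly_bimodule : bimodule K m n :=
  @Bimodule K m n P (S_twist f (mulT (dualT G T) T))
    (fun c g => (n%:R / 2%:R) *: g + row_degree c g - wlabel mu (rev_ord c) *: g).

(** In a row the degree is the action of the identity matrix, which is central
    in gl_n. *)
Lemma row_degree_xop_dop c d i j (w : P) :
  row_degree c (xop d i (dop d j w)) = xop d i (dop d j (row_degree c w)).
Proof.
have XDL : linear (fun g : P => xop d i (dop d j g)).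
  by apply: linear_comp; [apply: xop_linear|apply: dop_linear].
rewrite (lin_sum _ _ _ XDL); apply/eqP; rewrite -subr_eq0 -sumrB; apply/eqP.
under eq_bigr do rewrite xop_dop_comm.
case: (eqVneq c d) => [->|_]; last by apply: big1 => k _; rewrite !scale0r subrr.
rewrite sumrB (bigD1 i) //= eqxx scale1r big1 ?addr0; last first.
  by move=> k /negbTE ki; rewrite ki scale0r.
rewrite (bigD1 j) //= eqxx scale1r big1 ?addr0 ?subrr //.
by move=> k /negbTE kj; rewrite kj scale0r.
Qed.

Lemma row_degree_comm c d (w : P) :
  row_degree c (row_degree d w) = row_degree d (row_degree c w).
Proof.
apply: etrans (lin_sum _ _ _ (row_degree_linear c)) _.
by apply: eq_bigr => i _; apply: row_degree_xop_dop.
Qed.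

Lemma row_degree_lax c d z' r i j (w : P) :
  row_degree c (lax d z' r i j w) = lax d z' r i j (row_degree c w).
Proof.
rewrite /lax (linD _ _ (row_degree_linear c)) !(linZ _ _ (row_degree_linear c)).
by rewrite row_degree_xop_dop.
Qed.

Lemma row_degree_monodromy c k r i j (w : P) :
  row_degree c (@monodromy K n m za (@factor_row m') k r i j w) =
  @monodromy K n m za (@factor_row m') k r i j (row_degree c w).
Proof.
elim: k r i j w => [|k IH] r i j w; first exact: row_degree_lax.
apply: mulT_comm => //; first exact: row_degree_linear.
exact: row_degree_lax.
Qed.

Let TL : lin_ser T. Proof. exact: monodromy_linear. Qed.
Let ST := mulT (dualT G T) T.
Let STL : lin_ser ST. Proof. by apply: mulT_linear => //; apply: dualT_linear. Qed.

Let SopL r i j : linear (@Sop K m n poly_bimodule r i j).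
Proof. by apply: linear_sumf => s; apply: linear_scalef. Qed.

Let row_degree_S c r i j (w : P) :
  row_degree c (S_twist f ST r i j w) = S_twist f ST r i j (row_degree c w).
Proof.
have RL := @row_degree_linear K n m c.
rewrite (lin_sum _ _ _ RL); apply: eq_bigr => s _; rewrite (linZ _ _ RL); congr (_ *: _).
apply: mulT_comm => // [r1 i1 j1 w1|r1 i1 j1 w1].
  by rewrite /dualT (linZ _ _ RL) row_degree_monodromy.
exact: row_degree_monodromy.
Qed.

Lemma poly_bimoduleP : is_bimodule G poly_bimodule.
Proof.
have RL := @row_degree_linear K n m.
have HL a : linear (@Hop K m n poly_bimodule a).
  apply: linear_addf; first by apply: linear_addf => //; apply: linear_scale.
  by apply: linear_oppf; apply: linear_scale.
have HopM (H : P -> P) : linear H -> (forall c w, row_degree c (H w) = H (row_degree c w)) ->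
    forall a w, @Hop K m n poly_bimodule a (H w) = H (@Hop K m n poly_bimodule a w).
  move=> HL' HC a w; rewrite /= HC.
  by rewrite (linB _ _ HL') (linD _ _ HL') !(linZ _ _ HL').
split; first by split=> [r i j|a]; [apply: SopL|apply: HL].
- have -> : @Sop K m n poly_bimodule = mulT (scalT f) ST by rewrite -S_twistE.
  apply: mulT_unital; last first.
    by apply: mulT_unital; [apply: dualT_unital|]; apply: monodromy_unital.
  have F1 j : unital (@scalT K n P (series_fac (za j + 1))).
    by move=> i k w; rewrite /scalT /series_fac /series1 subr0 mul1r.
  by have := prodT_unital m F1; rewrite prodT_scalT.
- apply: X_relations_twist => //; apply: reflection => //; first exact: monodromy_unital.
  exact: (@monodromy_rtt K n m za (@factor_row m') m' (@factor_row_inj m') m' (leqnn _)).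
- move=> a b w; apply: (HopM (@Hop K m n poly_bimodule b)); first exact: HL.
  move=> c v; rewrite /= (linB _ _ (RL c)) (linD _ _ (RL c)) !(linZ _ _ (RL c)).
  by rewrite row_degree_comm.
move=> a r i j w; apply: (HopM (@Sop K m n poly_bimodule r i j)); first exact: SopL.
by move=> c v; apply: row_degree_S.
Qed.

Local Notation B1 := (coinvariants n (verma mu)).
Local Notation phi1 := (@poly_of K G n m mu).

Lemma poly_of_Sop r i j (w : B1) :
  phi1 (Sop r i j w) = @Sop K m n poly_bimodule r i j (phi1 w).
Proof.
rewrite -{1}[w](poly_ofK n_even two_neq0).
apply: etrans (congr1 _ (Sop_coinv_of n_even two_neq0 mu r i j _)) _.
rewrite (coinv_ofK n_even two_neq0).
by rewrite (prodT_factors n_even two_neq0 zaE).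
Qed.

Lemma poly_of_Hop a (w : B1) :
  phi1 (Hop a w) = @Hop K m n poly_bimodule a (phi1 w).
Proof.
rewrite -{1}[w](poly_ofK n_even two_neq0).
apply: etrans (congr1 _ (Hop_coinv_of n_even two_neq0 mu a _)) _.
rewrite (coinv_ofK n_even two_neq0) (weight_ext_rshift mu) scaleNr addrC.
by rewrite /zeta split_rshift /zeta_pos eqxx mul1r.
Qed.

Local Notation PT := (P_tensor n za m').
Local Notation B2 := (@Bimodule K m n PT (S_twist f (@S_of_T K G n PT))
  (fun c t => (n%:R / 2%:R) *: t + P_degree (rev_ord c) t - wlabel mu (rev_ord c) *: t)).
Local Notation phi2 := (@tens_poly K n m za (@factor_row m') m').

Lemma tens_poly_Sop r i j (t : B2) :
  phi2 (Sop r i j t) = @Sop K m n poly_bimodule r i j (phi2 t).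
Proof.
have PL := @tens_poly_linear K n m za (@factor_row m') m'.
have PTop := @tens_poly_Top K n m za (@factor_row m') m' (@factor_row_inj m') m'.
apply: etrans (lin_sum _ _ _ PL) _; apply: eq_bigr => s _.
apply: etrans (linZ _ _ PL) _; congr (_ *: _).
apply: etrans (lin_sum _ _ _ PL) _; apply: eq_bigr => s1 _.
apply: etrans (lin_sum _ _ _ PL) _; apply: eq_bigr => k _.
apply: etrans (linZ _ _ PL) _; congr (_ *: _).
by rewrite !PTop.
Qed.

Lemma tens_poly_Hop a (t : B2) :
  phi2 (Hop a t) = @Hop K m n poly_bimodule a (phi2 t).
Proof.
have PL := @tens_poly_linear K n m za (@factor_row m') m'.
have PD := @tens_poly_degree K n m za (@factor_row m') m' (@factor_row_inj m')
  m' (rev_ord a) t (leqnn _) (leq_ord _).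
apply: etrans (linB _ _ PL) _; apply: (congr2 (fun u v => u - v) _ (linZ _ _ PL)).
apply: etrans (linD _ _ PL) _; apply: (congr2 +%R (linZ _ _ PL)).
by rewrite PD factor_row_rev.
Qed.

Lemma coinvariants_equiv : bimodule_equiv G B1 B2.
Proof.
apply: (@bimodule_equiv_common K G n m B1 B2 poly_bimodule
  phi1 (coinv_of mu) phi2 (@poly_tens K n m za (@factor_row m') m')).
- exact: poly_of_linear n_even two_neq0 mu.
- exact: (@poly_ofK K G n m n_even two_neq0 mu).
- exact: (@coinv_ofK K G n m n_even two_neq0 mu).
- exact: poly_of_Sop.
- exact: poly_of_Hop.
- exact: tens_poly_linear.
- exact: (tens_polyK (@factor_row_inj m')).
- exact: (@poly_tensK K n m za (@factor_row m') m' (@factor_row_inj m') (@factor_row_surj m')).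
- exact: tens_poly_Sop.
- exact: tens_poly_Hop.
exact: poly_bimoduleP.
Qed.

End Common.

Theorem corollary2p7 (R : realType) (G : classical_group) (n m : nat)
    (n_gt0 : (0 < n)%N) (n_even : G = Symplectic -> ~~ odd n)
    (m_gt0 : (0 < m)%N) (mu : weight R[i] G m) :
  let z : R[i] := pm R[i] G / 2%:R in
  let za := extend0 (fun a : 'I_m => wlabel mu a + z + (m - a.+1)%:R) in
  let P := P_tensor n za m.-1 in
  let f := \big[@series_mul R[i]/series1 R[i]]_(a < m)
             series_fac (z + (m - a)%:R + wlabel mu a) in
  bimodule_equiv G
    (coinvariants n (verma mu))
    (@Bimodule R[i] m n P
       (S_twist f (@S_of_T R[i] G n P))
       (fun c t => let a := rev_ord c in
          (n%:R / 2%:R) *: t + P_degree a t - wlabel mu a *: t)).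
Proof.
case: m m_gt0 mu => [//|m'] _ mu z za P f.
have two_neq0 : 2%:R != 0 :> R[i] by rewrite Num.Theory.pnatr_eq0.
have zaE (a : 'I_m'.+1) : za a = wlabel mu a + z + (m'.+1 - a.+1)%:R.
  by rewrite /za /extend0 valK.
have fE : \big[@series_mul R[i]/series1 R[i]]_(a < m'.+1) series_fac (za a + 1) = f.
  apply: eq_bigr => a _; congr (series_fac _); rewrite zaE subSS subSn ?leq_ord //.
  by rewrite -natr1; ring.
by have := coinvariants_equiv n_even two_neq0 zaE; rewrite fE.
Qed.
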